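(* Let $\kappa\in\mathbb{N}$, let $G\in L_2(\mathbb{R},\phi(w)\,dw)$ have Hermite rank $\kappa$, and let $\eta(x)$, $x\in\mathbb{R}^d$, be a measurable mean-square continuous homogeneous isotropic real-valued Gaussian random field with $\mathbf{E}\,\eta(x)=0$ whose covariance function $B(x)=\mathbf{E}\,\eta(0)\eta(x)$ satisfies $$B(0)=1,\qquad B(x)=\|x\|^{-\alpha}L_0(\|x\|),\quad x\neq 0,$$ where $L_0$ is slowly varying at infinity and $\alpha\in(0,(d-1)/\kappa)$. Put $$K_r:=\int_{\partial\Delta(r)}G(\eta(x))\,d\sigma(x),\qquad K_{r,\kappa}:=\frac{C_\kappa}{\kappa!}\int_{\partial\Delta(r)}H_\kappa(\eta(x))\,d\sigma(x).$$ If at least one of the following random variables $$\frac{K_r}{\sqrt{\mathbf{Var}\,K_r}},\qquad \frac{K_r}{\sqrt{\mathbf{Var}\,K_{r,\kappa}}},\qquad \frac{K_{r,\kappa}}{\sqrt{\mathbf{Var}\,K_{r,\kappa}}}$$ has a limit distribution as $r\to\infty$, then the limit distributions of the other two random variables also exist and all of them coincide as $r\to\infty$.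
   Context: Geometric setting. $d\ge 2$; $\Delta\subset\mathbb{R}^d$ is a bounded set with boundary $\partial\Delta$, a closed hypersurface; $\sigma$ denotes the $(d-1)$-dimensional Lebesgue (surface) measure on a hypersurface. For $r>0$, $\Delta(r)=r\Delta$ is the homothetic image of $\Delta$ with centre at the origin and coefficient $r$, and $\partial\Delta(r)$ is its boundary. Standing assumptions on $\partial\Delta$: (i) it is Ahlfors-David regular: there is a constant $C$ such that $C^{-1}s^{d-1}<\sigma(\partial\Delta\cap B(y,s))<Cs^{d-1}$ for all $y\in\partial\Delta$ and $0<s\le \mathrm{diam}(\partial\Delta)$, where $B(y,s)$ is the ball with centre $y$ and radius $s$; (ii) with $\mathcal{K}(x):=\int_{\partial\Delta}e^{i\langle x,u\rangle}\,d\sigma(u)$, there is a constant $C$ such that $\int_{S_{d-1}(1)}|\mathcal{K}(\omega r)|^2\,d\omega\le C r^{-d+1}$ for all $r>0$, where $S_{d-1}(1)$ is the unit sphere in $\mathbb{R}^d$ (known to hold when $\Delta$ is convex, is a polyhedron, or has a sufficiently smooth boundary, e.g. of class $C^{3/2}$). Hermite rank. $\phi(w)=\frac{1}{\sqrt{2\pi}}e^{-w^2/2}$; $H_k$, $k\ge0$, are the (probabilists') Hermite polynomials, orthogonal in $L_2(\mathbb{R},\phi(w)\,dw)$ with $\int H_k^2\phi\,dw=k!$. For $G\in L_2(\mathbb{R},\phi(w)\,dw)$ let $C_j:=\int_{\mathbb{R}}G(w)H_j(w)\phi(w)\,dw$, so that $G=\sum_{j\ge0}C_jH_j/j!$. $G$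 has Hermite rank $\kappa\in\mathbb{N}$ ($\kappa\ge1$) if $C_j=0$ for all $0\le j\le\kappa-1$ and $C_\kappa\ne0$. Slow variation. A measurable $L:(0,\infty)\to(0,\infty)$ is slowly varying at infinity if $\lim_{\lambda\to\infty}L(\lambda t)/L(\lambda)=1$ for all $t>0$. *)

(* Defs.v *)
From HB Require Import structures.
From mathcomp Require Import all_boot all_order all_algebra.
From mathcomp Require Import all_classical all_reals all_analysis complex.
From mathcomp Require Import ring lra.
Set Implicit Arguments.
Unset Strict Implicit.
Unset Printing Implicit Defensive.
Import Order.TTheory GRing.Theory Num.Theory numFieldNormedType.Exports.
Local Open Scope classical_set_scope.
Local Open Scope ring_scope.

Section euclidean.
Context {R : realType} {d : nat}.
Implicit Types (x y z : 'rV[R]_d) (A : set 'rV[R]_d).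

Definition dotp x y : R := \sum_(i < d) x ord0 i * y ord0 i.

(* [`|x|] on row vectors is the sup norm of the library; it induces the same
   topology as [enorm]. *)
Definition enorm x : R := Num.sqrt (dotp x x).

Definition ediam A : \bar R :=
  ereal_sup [set (enorm (p.1 - p.2))%:E | p in A `*` A].

Definition eball x (s : R) : set 'rV[R]_d := [set y | enorm (y - x) <= s].

Definition usphere : set 'rV[R]_d := [set x | enorm x = 1].

Definition boundary A : set 'rV[R]_d := closure A `\` A°.

Definition dilate (r : R) A : set 'rV[R]_d := [set r *: x | x in A].

Lemma dotp_ge0 x : 0 <= dotp x x.
Proof. by apply: sumr_ge0 => i _; rewrite -expr2 sqr_ge0. Qed.

Lemma dotpDl x y z : dotp (x + y) z = dotp x z + dotp y z.
Proof. by rewrite -big_split; apply: eq_bigr => i _; rewrite mxE mulrDl. Qed.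

Lemma dotpZl (a : R) x y : dotp (a *: x) y = a * dotp x y.
Proof. by rewrite mulr_sumr; apply: eq_bigr => i _; rewrite mxE mulrA. Qed.

Lemma dotpC x y : dotp x y = dotp y x.
Proof. by apply: eq_bigr => i _; rewrite mulrC. Qed.

Lemma dotp_sqr_le x y : dotp x y ^+ 2 <= dotp x x * dotp y y.
Proof.
have H (a b : R) : 0 <= a ^+ 2 * dotp x x + a * b * dotp x y *+ 2
                        + b ^+ 2 * dotp y y.
  have := dotp_ge0 (a *: x + b *: y).
  rewrite dotpDl !dotpZl ![dotp _ (_ + _)]dotpC !dotpDl !dotpZl.
  rewrite [dotp y x]dotpC => /le_trans; apply.
  by rewrite le_eqVlt; apply/orP; left; apply/eqP; ring.
have xx := dotp_ge0 x; have yy := dotp_ge0 y.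
have [y0|y0] := eqVneq (dotp y y) 0.
  have := H (dotp x y) (- (dotp x x + 1)).
  rewrite y0 !mulr0 addr0; have := sqr_ge0 (dotp x y); nra.
have ygt0 : 0 < dotp y y by rewrite lt_neqAle eq_sym y0.
have := H (dotp y y) (- dotp x y).
rewrite (_ : _ + _ = dotp y y * (dotp x x * dotp y y - dotp x y ^+ 2)).
  by rewrite pmulr_rge0// subr_ge0.
by ring.
Qed.

Lemma enorm_ge0 x : 0 <= enorm x. Proof. exact: sqrtr_ge0. Qed.

Lemma sqr_enorm x : enorm x ^+ 2 = dotp x x.
Proof. by rewrite sqr_sqrtr ?dotp_ge0. Qed.

Lemma enormD x y : enorm (x + y) <= enorm x + enorm y.
Proof.
have h : 0 <= enorm x + enorm y by rewrite addr_ge0 ?enorm_ge0.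
rewrite -(@ler_pXn2r _ 2)// ?nnegrE ?enorm_ge0//.
rewrite sqr_enorm dotpDl ![dotp _ (_ + _)]dotpC !dotpDl sqrrD !sqr_enorm.
rewrite [dotp y x]dotpC.
suff : dotp x y <= enorm x * enorm y by nra.
rewrite (le_trans (ler_norm _))// -(@ler_pXn2r _ 2)// ?nnegrE ?normr_ge0//.
  by rewrite exprMn !sqr_enorm real_normK ?num_real// dotp_sqr_le.
by rewrite mulr_ge0 ?enorm_ge0.
Qed.

Lemma enormN x : enorm (- x) = enorm x.
Proof.
by congr Num.sqrt; apply: eq_bigr => i _; rewrite mxE mulrNN.
Qed.

Lemma coord_le_enorm x i : `|x ord0 i| <= enorm x.
Proof.
rewrite -sqrtr_sqr ler_wsqrtr// /dotp (bigD1 i)//= -expr2 lerDl.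
by apply: sumr_ge0 => j _; rewrite -expr2 sqr_ge0.
Qed.

Lemma closed_enorm_gap (F : set 'rV[R]_d) x : closed F -> ~ F x ->
  exists k : nat, forall y, F y -> k.+1%:R^-1 <= enorm (x - y).
Proof.
move=> cF Fx; have /open_nbhs_nbhs : open_nbhs x (~` F).
  by split => //; exact: closed_openC.
move=> /nbhs_ballP[e /= e0 eF].
have [k] := ltr_add_invr e0; rewrite add0r => ke.
exists k => y Fy; rewrite leNgt; apply/negP => xy.
apply: (eF y) => //; split => // i j; rewrite ord1 /ball/= .
have := coord_le_enorm (x - y) j; rewrite !mxE => /le_lt_trans; apply.
exact: lt_trans ke.
Qed.

Lemma le_ediam A x y : A x -> A y -> ((enorm (x - y))%:E <= ediam A)%E.
Proof. by move=> Ax Ay; apply: ereal_sup_ubound; exists (x, y). Qed.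

Lemma ediam_ge0 A : A !=set0 -> (0 <= ediam A)%E.
Proof.
move=> [x Ax]; apply: le_trans (le_ediam Ax Ax).
by rewrite lee_fin enorm_ge0.
Qed.

End euclidean.

(* $\pi^{n/2}/\Gamma(n/2+1)$, the volume of the unit ball of $R^n$. *)
Fixpoint unit_ball_volume {R : realType} (n : nat) : R :=
  match n with
  | 0 => 1
  | 1 => 2
  | m.+2 => 2 * pi / m.+2%:R * unit_ball_volume m
  end.

Lemma unit_ball_volume_ge0 (R : realType) n : 0 <= @unit_ball_volume R n.
Proof.
suff : 0 <= @unit_ball_volume R n /\ 0 <= @unit_ball_volume R n.+1 by case.
elim: n => [|n [h1 h2]]; first by split => //=; rewrite ler0n.
split => //=; rewrite mulr_ge0// divr_ge0// mulr_ge0// pi_ge0//.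
Qed.

Definition borelV (R : realType) (d : nat) : Type :=
  g_sigma_algebraType (@open 'rV[R]_d).
HB.instance Definition _ (R : realType) (d : nat) :=
  Measurable.on (borelV R d).

Section hausdorff.
Context {R : realType} {d : nat}.
Local Open Scope ereal_scope.
Implicit Types (A B : set 'rV[R]_d).

Definition hgauge (n : nat) A : \bar R :=
  if A == set0 then 0 else (unit_ball_volume n / 2 ^+ n)%:E * ediam A ^+ n.

Definition hausdorff_content (n : nat) (delta : R) A : \bar R :=
  ereal_inf [set \sum_(k <oo) hgauge n (U k) | U in
    [set U : (set 'rV[R]_d)^nat |
      A `<=` \bigcup_k U k /\ forall k, ediam (U k) <= delta%:E]].

(* The normalization makes it the [n]-dimensional surface measure on
   [n]-dimensional hypersurfaces. *)
Definition hausdorff_measure (n : nat) (A : set (borelV R d)) : \bar R :=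
  ereal_sup [set hausdorff_content n delta A | delta in `]0%R, +oo[].

Lemma hgauge0 n : hgauge n set0 = 0.
Proof. by rewrite /hgauge eqxx. Qed.

Lemma hgauge_ge0 n A : 0 <= hgauge n A.
Proof.
rewrite /hgauge; case: ifPn => // /set0P A0.
rewrite mule_ge0 ?expe_ge0 ?ediam_ge0// lee_fin.
by rewrite divr_ge0 ?unit_ball_volume_ge0 ?exprn_ge0.
Qed.

Let allV := g_sigma_algebraType [set: set 'rV[R]_d].
Let pregauge n (delta : R) (A : set allV) : \bar R :=
  if `[< A = set0 >] then 0 else
  if ediam (A : set 'rV[R]_d) <= delta%:E then hgauge n A else +oo.

Let pregauge_ge0 n delta A : 0 <= pregauge n delta A.
Proof.
rewrite /pregauge; case: ifP => // _; case: ifP => // _; exact: hgauge_ge0.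
Qed.

Let pregauge0 n delta : pregauge n delta set0 = 0.
Proof. by rewrite /pregauge; case: asboolP. Qed.

Let ediam0 (delta : R) : (0 < delta)%R ->
  ediam (set0 : set 'rV[R]_d) <= delta%:E.
Proof. by move=> ?; apply: ge_ereal_sup => _ [[x y] [[]]]. Qed.

Let hausdorff_contentE n delta A : (0 < delta)%R ->
  hausdorff_content n delta A = mu_ext (pregauge n delta) (A : set allV).
Proof.
move=> delta0; apply/eqP; rewrite eq_le; apply/andP; split.
  apply: le_ereal_inf_tmp => _ [U [_ AU] <-].
  have [/existsNP[k Uk]|/contrapT Ud] :=
      pselect (~ forall k, ediam (U k : set 'rV[R]_d) <= delta%:E).
    rewrite (@nneseries_pinfty _ _ xpredT k) ?leey// /pregauge.
    case: asboolP => [U0|_]; last by case: ifPn.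
    by exfalso; apply: Uk; rewrite U0; exact: ediam0.
  apply: ereal_inf_lbound; exists U => //.
  apply: eq_eseriesr => k _; rewrite /pregauge Ud.
  by case: asboolP => // ->; rewrite hgauge0.
apply: le_ereal_inf_tmp => _ [U [AU Ud] <-].
apply: ereal_inf_lbound; exists U.
  by split => // k; apply: sub_sigma_algebra.
apply: eq_eseriesr => k _; rewrite /pregauge Ud.
by case: asboolP => // ->; rewrite hgauge0.
Qed.

Lemma hausdorff_measure0 n : hausdorff_measure n set0 = 0.
Proof.
rewrite /hausdorff_measure (_ : [set _ | _ in _] = [set 0]) ?ereal_sup1//.
apply/seteqP; split => [_ [delta d0 <-]|_ ->].
  move: d0; rewrite /= in_itv/= andbT => d0.
  by rewrite hausdorff_contentE// mu_ext0.
exists 1%R; first by rewrite /= in_itv/= andbT.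
by rewrite hausdorff_contentE// mu_ext0.
Qed.

Lemma hausdorff_measure_ge0 n A : 0 <= hausdorff_measure n A.
Proof.
apply: le_ereal_sup_tmp; exists (hausdorff_content n 1 A).
  by exists 1%R => //=; rewrite in_itv/= andbT.
by rewrite hausdorff_contentE// mu_ext_ge0.
Qed.

Lemma le_hausdorff_measure n :
  {homo hausdorff_measure n : A B / A `<=` B >-> A <= B}.
Proof.
move=> A B AB; apply: ge_ereal_sup => _ [delta d0 <-].
apply: le_ereal_sup_tmp; exists (hausdorff_content n delta B).
  by exists delta.
move: d0; rewrite /= in_itv/= andbT => d0.
by rewrite !hausdorff_contentE// le_mu_ext.
Qed.

Lemma hausdorff_measure_sigma_subadditive n :
  sigma_subadditive (hausdorff_measure n).
Proof.
move=> F; apply: ge_ereal_sup => _ [delta d0 <-].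
have d0' : (0 < delta)%R by move: d0; rewrite /= in_itv/= andbT.
rewrite hausdorff_contentE//.
have := @mu_ext_sigma_subadditive _ allV R _ (pregauge_ge0 n delta) F.
move=> sub; refine (le_trans sub _).
apply: lee_nneseries => [i _ _|i _]; first exact: mu_ext_ge0.
rewrite -hausdorff_contentE//; apply: ereal_sup_ubound; by exists delta.
Qed.

HB.instance Definition _ n := isOuterMeasure.Build R _
  (@hausdorff_measure n) (hausdorff_measure0 n) (hausdorff_measure_ge0 n)
  (@le_hausdorff_measure n) (@hausdorff_measure_sigma_subadditive n).

Lemma hausdorff_measure_separated n A B (e : R) : (0 < e)%R ->
  (forall x y, A x -> B y -> (e <= enorm (x - y))%R) ->
  hausdorff_measure n A + hausdorff_measure n B <=
  hausdorff_measure n (A `|` B).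
Proof.
move=> e0 AB.
have content_le delta delta' C : (0 < delta)%R -> (delta <= delta')%R ->
    hausdorff_content n delta' C <= hausdorff_content n delta C.
  move=> d0 dd; apply: ereal_inf_le_tmp => _ [U [CU Ud] <-].
  exists U => //; split => // k; apply: le_trans (Ud k) _.
  by rewrite lee_fin.
have split_le delta : (0 < delta)%R -> (delta < e)%R ->
    hausdorff_content n delta A + hausdorff_content n delta B <=
    hausdorff_measure n (A `|` B).
  move=> d0 de; apply: (@le_trans _ _ (hausdorff_content n delta (A `|` B)));
    last first.
    by apply: ereal_sup_ubound; exists delta => //=; rewrite in_itv/= andbT.
  apply: le_ereal_inf_tmp => _ [U [ABU Ud] <-].
  pose V C k := if `[< U k `&` C !=set0 >] then U k else set0.
  have content_V C : C `<=` A `|` B ->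
      hausdorff_content n delta C <= \sum_(k <oo) hgauge n (V C k).
    move=> CAB; apply: ereal_inf_lbound; exists (V C) => //; split.
      move=> x Cx; have [k _ Ukx] := ABU x (CAB x Cx).
      by exists k => //; rewrite /V asboolT//; exists x.
    by move=> k; rewrite /V; case: ifP => // _; exact: ediam0.
  apply: (le_trans (leeD (content_V A _) (content_V B _))).
  - by move=> x; left.
  - by move=> x; right.
  rewrite -nneseriesD; try by move=> *; exact: hgauge_ge0.
  apply: lee_nneseries => [k _ _|k _]; first by rewrite adde_ge0 ?hgauge_ge0.
  rewrite /V; case: asboolP => [[x [Ux Ax]]|_]; last first.
    by case: asboolP => _; rewrite hgauge0 add0e ?hgauge0 ?hgauge_ge0.
  case: asboolP => [[y [Uy By]]|_]; last by rewrite hgauge0 adde0.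
  have := le_trans (le_ediam Ux Uy) (Ud k); rewrite lee_fin => xy.
  by have := lt_le_trans de (le_trans (AB x y Ax By) xy); rewrite ltxx.
have measure_lim C : hausdorff_measure n C =
    ereal_sup [set hausdorff_content n delta C | delta in `]0%R, e[].
  apply/eqP; rewrite eq_le; apply/andP; split; last first.
    apply: ereal_sup_le => _ [delta d0 <-].
    move: d0; rewrite /= in_itv/= => /andP[d0 _].
    by exists delta => //=; rewrite in_itv/= andbT.
  apply: ge_ereal_sup => _ [delta d0 <-].
  move: d0; rewrite /= in_itv/= andbT => d0.
  pose delta' := Num.min delta (e / 2)%R.
  have d'0 : (0 < delta')%R by rewrite lt_min d0/= divr_gt0.
  apply: le_ereal_sup_tmp; exists (hausdorff_content n delta' C).
    exists delta' => //=; rewrite in_itv/= d'0/= /delta' gt_min; apply/orP.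
    by right; lra.
  by apply: content_le => //; rewrite /delta' ge_min lexx.
have content_ge0 delta C : (0 < delta)%R -> 0 <= hausdorff_content n delta C.
  by move=> d0; rewrite hausdorff_contentE// mu_ext_ge0.
have [->|moo] := eqVneq (hausdorff_measure n (A `|` B)) +oo.
  by rewrite leey.
have content_fin delta C : (0 < delta)%R -> C `<=` A `|` B ->
    hausdorff_content n delta C \is a fin_num.
  move=> d0 CAB; rewrite ge0_fin_numE ?content_ge0//.
  apply: (@le_lt_trans _ _ (hausdorff_measure n (A `|` B))); last first.
    by rewrite ltey.
  apply: (le_trans _ (le_hausdorff_measure n CAB)).
  by apply: ereal_sup_ubound; exists delta => //=; rewrite in_itv/= andbT.
have sA : A `<=` A `|` B by move=> x; left.
have sB : B `<=` A `|` B by move=> x; right.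
have Bfin : hausdorff_measure n B \is a fin_num.
  rewrite ge0_fin_numE ?hausdorff_measure_ge0//.
  by rewrite (le_lt_trans (le_hausdorff_measure n sB))// ltey.
rewrite -leeBrDr// measure_lim.
apply: ge_ereal_sup => _ [delta d0e <-].
  move: d0e; rewrite /= in_itv/= => /andP[d0 de].
rewrite leeBrDr// addeC -leeBrDr ?content_fin// (measure_lim B).
apply: ge_ereal_sup => _ [delta' d'0e <-].
  move: d'0e; rewrite /= in_itv/= => /andP[d'0 d'e].
rewrite leeBrDr ?content_fin//.
pose m := Num.min delta delta'.
have m0 : (0 < m)%R by rewrite lt_min d0 d'0.
apply: le_trans (split_le m m0 _); last by rewrite /m gt_min de.
by rewrite addeC leeD// content_le// /m ge_min lexx ?orbT.
Qed.

Lemma hausdorff_closed_caratheodory n (F : set 'rV[R]_d) : closed F ->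
  (@hausdorff_measure n).-caratheodory F.
Proof.
move=> cF; apply: (@le_caratheodory_measurable _ _ (@hausdorff_measure n)) => X.
pose mu : set 'rV[R]_d -> \bar R := hausdorff_measure n.
rewrite -[leLHS]/(mu (X `&` F) + mu (X `&` ~` F)) -[leRHS]/(mu X).
have [->|Xoo] := eqVneq (mu X) +oo; first by rewrite leey.
have fin Y : Y `<=` X -> mu Y \is a fin_num.
  move=> YX; rewrite ge0_fin_numE ?hausdorff_measure_ge0//.
  by rewrite (le_lt_trans (le_hausdorff_measure n YX))// ltey.
pose S k := [set x | X x /\ forall y, F y -> (k.+1%:R^-1 <= enorm (x - y))%R].
pose D k := S k.+1 `\` S k.
have SX k : S k `<=` X by move=> x [].
have DX k : D k `<=` X by move=> x [/SX].
have SS k : S k `<=` S k.+1.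
  move=> x [Xx Sx]; split => // y Fy; apply: le_trans (Sx y Fy).
  by rewrite lef_pV2 ?posrE// ler_nat.
have step k : mu (S k) + mu (D k.+1) <= mu (S k.+2).
  have e0 : (0 < k.+1%:R^-1 - k.+2%:R^-1 :> R)%R.
    by rewrite subr_gt0 ltf_pV2 ?posrE// ltr_nat.
  apply: (@le_trans _ _ (mu (S k `|` D k.+1))).
    apply: (@hausdorff_measure_separated n _ _ _ e0) => x z [Xx Sx] [[Xz _]] nSz.
    have [y] : exists y, F y /\ (enorm (z - y)%R < k.+2%:R^-1)%R.
      apply: contrapT => /forallNP nF; apply: nSz; split => // y Fy.
      by rewrite leNgt; apply/negP => ?; exact: (nF y).
    move=> [Fy zy]; have := Sx y Fy.
    have := enormD (x - z) (z - y); rewrite subrKA => tri Sxy.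
    rewrite lerBlDr (le_trans Sxy)// (le_trans tri)// lerD2l.
    exact: ltW.
  apply: le_hausdorff_measure => x [/SS/SS//|[]//].
have sumD N : \sum_(0 <= k < N) mu (D k.+1) <= mu (S N) + mu (S N.+1).
  elim: N => [|N ih]; first by rewrite big_geq// adde_ge0 ?hausdorff_measure_ge0.
  rewrite big_nat_recr//=; apply: (le_trans (leeD ih (lexx _))).
  by rewrite addeAC addeC leeD.
have D_lty : \sum_(k <oo) mu (D k.+1) < +oo.
  apply: (@le_lt_trans _ _ (mu X + mu X)).
    apply: lime_le.
      by apply: is_cvg_nneseries => *; exact: hausdorff_measure_ge0.
    near=> N; apply: (le_trans (sumD N)).
    by apply: leeD; exact: le_hausdorff_measure.
  by rewrite -ge0_fin_numE ?adde_ge0 ?hausdorff_measure_ge0// fin_numD !fin.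
have tail := nneseries_tail_cvg D_lty
  (fun k _ => hausdorff_measure_ge0 n (D k.+1)).
have bound N : mu (X `&` F) + mu (X `&` ~` F) <=
    mu X + \sum_(N <= k <oo) mu (D k.+1).
  have XF : X `&` ~` F `<=` S N.+1 `|` \bigcup_(k in ~` `I_N) D k.+1.
    move=> x [Xx Fx]; have [k xk] := closed_enorm_gap cF Fx.
    have Sk : S k x by [].
    have mono i j : (i <= j)%N -> S i `<=` S j.
      move=> /subnK <-; elim: (j - i)%N => // m ih y /ih; rewrite addSn; exact: SS.
    have [kN|Nk] := leqP k N.+1; first by left; exact: mono Sk.
    have [Sx|nSx] := pselect (S N.+1 x); first by left.
    right.
    have [j [Nj Sj nSj]] : exists j, [/\ (N < j)%N, S j.+1 x & ~ S j x].
      move: Nk Sk; elim: k {xk} => // k ih Nk Sk.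
      have [Sk'|] := pselect (S k x); last by exists k.
      have [kN|Nk'] := leqP k N.+1; last exact: ih.
      by exfalso; apply: nSx; exact: mono Sk'.
    case: j Nj Sj nSj => // j Nj Sj nSj.
    by exists j => //=; apply/negP; rewrite -leqNgt.
  have := le_hausdorff_measure n XF => /le_trans.
  have := @outer_measureU2 _ _ (@hausdorff_measure n) (S N.+1) (\bigcup_(k in ~` `I_N) D k.+1).
  move=> /[swap] /[apply].
  have := outer_measure_sigma_subadditive_tail (@hausdorff_measure n) N (fun k => D k.+1).
  move=> tailN XFle.
  have {}XFle : mu (X `&` ~` F) <= mu (S N.+1) + \sum_(N <= k <oo) mu (D k.+1).
    by apply: (le_trans XFle); rewrite leeD2l.
  apply: (le_trans (leeD (lexx _) XFle)); rewrite addeA leeD2r//.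
  have e0 : (0 < N.+2%:R^-1 :> R)%R by rewrite invr_gt0.
  apply: (@le_trans _ _ (mu ((X `&` F) `|` S N.+1))).
    apply: (@hausdorff_measure_separated n _ _ _ e0) => x y [_ Fx] [_ /(_ x Fx)].
    by rewrite -enormN opprB.
  by apply: le_hausdorff_measure => x [[]//|[]].
have lim_bound : mu X + \sum_(N <= k <oo) mu (D k.+1) @[N --> \oo] --> mu X.
  rewrite -[X in _ --> X]adde0.
  apply: cvgeD => //; last exact: cvg_cst.
  by apply: fin_num_adde_defr; exact: fin.
by apply: (cvge_ge _ lim_bound); near=> N; exact: bound.
Unshelve. all: by end_near. Qed.

Lemma borel_caratheodory n (A : set (borelV R d)) : measurable A ->
  (@hausdorff_measure n).-caratheodory A.
Proof.
apply: smallest_sub.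
- split.
  + exact: (@caratheodory_measurable_set0 _ _ (@hausdorff_measure n)).
  + move=> B; rewrite setTD.
    exact: (@caratheodory_measurable_setC _ _ (@hausdorff_measure n)).
  + exact: (@caratheodory_measurable_bigcup _ _ (@hausdorff_measure n)).
- move=> U oU; rewrite -[U]setCK.
  apply: (@caratheodory_measurable_setC _ _ (@hausdorff_measure n)).
  by apply: hausdorff_closed_caratheodory; exact: open_closedC.
Qed.

Lemma hausdorff_measure_semi_sigma_additive n :
  semi_sigma_additive (hausdorff_measure n).
Proof.
move=> A mA tA mUA.
apply: (@caratheodory_measure_sigma_additive _ _ (@hausdorff_measure n)) => //.
- by move=> i; exact: borel_caratheodory.
- exact: borel_caratheodory.
Qed.

HB.instance Definition _ n := isMeasure.Build _ (borelV R d) R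
  (@hausdorff_measure n) (hausdorff_measure0 n) (hausdorff_measure_ge0 n)
  (@hausdorff_measure_semi_sigma_additive n).

End hausdorff.

Section surface.
Context {R : realType} {d : nat}.
Implicit Types (S : set 'rV[R]_d).

Local Notation sigma := (@hausdorff_measure R d d.-1).

Definition rectifiable (n : nat) S : Prop :=
  exists f : nat -> 'rV[R]_n -> 'rV[R]_d,
    (forall k, exists L : R, forall x y,
      enorm (f k x - f k y) <= L * enorm (x - y)) /\
    hausdorff_measure n (S `\` \bigcup_k range (f k)) = 0%E.

(* No smoothness class is imposed: countable rectifiability is the weakest
   condition under which Lebesgue surface measure makes sense, and it holds for
   boundaries of convex sets, for polyhedra and for Lipschitz or smoother
   hypersurfaces. *)
Definition closed_hypersurface S : Prop :=
  [/\ compact S, (0 < sigma S)%E & rectifiable d.-1 S].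

Definition ahlfors_david_regular S : Prop :=
  exists C : R, 0 < C /\ forall (y : 'rV[R]_d) (s : R),
    S y -> 0 < s -> (s%:E <= ediam S)%E ->
    ((C^-1 * s ^+ d.-1)%:E < sigma (S `&` eball y s) < (C * s ^+ d.-1)%:E)%E.

(* $\int_S e^{i<x,u>} d\sigma(u)$, given by its real and imaginary parts. *)
Definition surface_fourier S (x : 'rV[R]_d) : R[i] :=
  Complex (\int[sigma]_(u in S) cos (dotp x u))
          (\int[sigma]_(u in S) sin (dotp x u)).

Definition fourier_decay S : Prop :=
  exists C : R, forall r : R, 0 < r ->
    (\int[sigma]_(w in usphere)
       (ComplexField.Normc.normc (surface_fourier S (r *: w)) ^+ 2)%:E
     <= (C * r ^- d.-1)%:E)%E.

End surface.

Section hermite.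
Context {R : realType}.
Implicit Types (G : R -> R).

Fixpoint hermite (k : nat) : {poly R} :=
  if k is m.+1 then 'X * hermite m - (hermite m)^`() else 1.

Definition gaussian_L2 G : Prop :=
  measurable_fun setT G /\
  (\int[lebesgue_measure]_w (G w ^+ 2 * normal_pdf 0 1 w)%:E < +oo)%E.

Definition hermite_coef G (j : nat) : R :=
  \int[lebesgue_measure]_w (G w * (hermite j).[w] * normal_pdf 0 1 w).

Definition hermite_rank G (kappa : nat) : Prop :=
  [/\ (0 < kappa)%N, forall j, (j < kappa)%N -> hermite_coef G j = 0
    & hermite_coef G kappa != 0].

Definition slowly_varying (L : R -> R) : Prop :=
  [/\ measurable_fun (`]0, +oo[%classic : set R) L, forall t, 0 < t -> 0 < L t
    & forall t, 0 < t -> L (l * t) / L l @[l --> +oo] --> (1 : R)].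

End hermite.

Section random_field.
Context {R : realType} {d : nat} {disp : measure_display}
  {Omega : measurableType disp} (P : probability Omega R).
Implicit Types (eta : 'rV[R]_d -> Omega -> R).

Definition measurable_field eta : Prop :=
  measurable_fun [set: borelV R d * Omega] (fun p => eta p.1 p.2).

Definition ms_continuous eta : Prop :=
  forall x, 'E_P[fun w => ((eta y w - eta x w) ^+ 2)%R]%E @[y --> x] --> 0%E.

(* [normal_prob m 0] is not the point mass at [m] in the library. *)
Definition gaussian_law (m s : R) : set R -> \bar R :=
  if s == 0 then \d_m else normal_prob m s.

Definition gaussian_field eta : Prop :=
  forall (n : nat) (a : 'I_n -> R) (x : 'I_n -> 'rV[R]_d),
    exists m s : R, forall A : set R, measurable A ->
      P ((fun w => \sum_(i < n) a i * eta (x i) w) @^-1` A) =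
      gaussian_law m s A.

(* Invariance of the first two moments; for Gaussian fields it is equivalent to
   invariance of all finite-dimensional distributions. *)
Definition homogeneous_field eta : Prop :=
  forall x y h, 'E_P[eta (x + h)%R]%E = 'E_P[eta x]%E /\
    covariance P (eta (x + h)) (eta (y + h)) = covariance P (eta x) (eta y).

Definition isotropic_field eta : Prop :=
  forall (Q : 'M[R]_d) x y, Q *m Q^T = 1%:M -> \det Q = 1 ->
    'E_P[eta (x *m Q)%R]%E = 'E_P[eta x]%E /\
    covariance P (eta (x *m Q)) (eta (y *m Q)) = covariance P (eta x) (eta y).

Definition covariance_function eta (x : 'rV[R]_d) : \bar R :=
  'E_P[fun w => (eta 0 w * eta x w)%R]%E.

Definition surface_functional (S : set 'rV[R]_d) (G : R -> R) eta (w : Omega) : R :=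
  \int[@hausdorff_measure R d d.-1]_(x in S) G (eta x w).

Definition Kr (Delta : set 'rV[R]_d) (G : R -> R) eta (r : R) : Omega -> R :=
  surface_functional (boundary (dilate r Delta)) G eta.

(* $K_{r,\kappa}$ *)
Definition Kr_rank (Delta : set 'rV[R]_d) (G : R -> R) (kappa : nat) eta
    (r : R) : Omega -> R :=
  fun w => hermite_coef G kappa / kappa`!%:R *
    surface_functional (boundary (dilate r Delta)) (fun u => (hermite kappa).[u]) eta w.

Definition normalized_by (X Y : R -> Omega -> R) (r : R) (w : Omega) : R :=
  X r w / Num.sqrt (fine 'V_P[Y r]%E).

(* Weak convergence of the law of [X r] to [mu] as [r] tends to infinity. *)
Definition limit_distribution (X : R -> Omega -> R) (mu : probability R R) :
    Prop :=
  forall f : R -> R, continuous f -> bounded_fun f ->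
    'E_P[fun w => f (X r w)]%E @[r --> +oo] --> (\int[mu]_x (f x)%:E)%E.

End random_field.

(* Main.v *)
(* Write [F := G - (C_kappa / kappa!) H_kappa], so that [F] is orthogonal to
   [H_0, ..., H_kappa]. For a standard Gaussian pair with correlation [rho] in
   [0, 1], the orthogonality relations [E H_j(X) H_k(Y) = delta_jk k! rho^k] and the
   density of polynomials give [|E F(X) F(Y)| <= rho^(kappa+1) |F|_2^2]. Hence
   [E (K_r - K_{r,kappa})^2 <= |F|_2^2 J_{kappa+1}(r)], whereas
   [Var K_{r,kappa} = (C_kappa^2 / kappa!) J_kappa(r)], where [J_k(r)] is the integral
   of the [k]-th power of the covariance over pairs of points of the surface.
   Pairs at bounded distance contribute [O(r^(d-1))] by regularity, on the other
   pairs the covariance is small (and positive, as [L0 > 0]), and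
   [J_kappa(r) / r^(d-1)] tends to infinity because [alpha kappa < d - 1]; so
   [J_{kappa+1}(r) = o(J_kappa(r))]. The three normalized variables are then
   asymptotically equal in [L2]. *)
Require Import Defs.
From HB Require Import structures.
From mathcomp Require Import all_boot all_order all_algebra.
From mathcomp Require Import all_classical all_reals all_analysis.
From mathcomp Require Import measurable_realfun ring lra.
Import Order.TTheory GRing.Theory Num.Theory numFieldNormedType.Exports.
Local Open Scope classical_set_scope.
Local Open Scope ring_scope.
Set Implicit Arguments.
Unset Strict Implicit.
Unset Printing Implicit Defensive.

(** * Square-integrable functions *)

(** Two obstacles shape the proof. A Gaussian field is given only by the laws of linear combinations
    of its values, and two values may be perfectly correlated, so no bivariate density is at hand.
    The relations for [E H_j(X) H_k(Y)] are therefore drawn from moments: Stein's identity for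
    [a X + Y], valid for every [a], is an identity between polynomials in [a], and its coefficients
    govern the mixed moments of [(X, Y)]. In the same spirit, density of polynomials comes from
    dominated limits alone, which lead from polynomials to sines, to indicators of half-lines, to
    Borel indicators and simple functions. The second obstacle is that slow variation controls [L0]
    only for each fixed ratio. Uniformity over bounded ratios, proved in logarithmic coordinates,
    confines [L0] between small negative and positive powers; both asymptotic claims on the
    covariance then reduce to comparing exponents. *)

Section integrable_real.
Context d (T : measurableType d) (R : realType) (mu : {measure set T -> \bar R}).
Implicit Types f g : T -> R.

Lemma integrable_EFinD f g : mu.-integrable setT (EFin \o f) ->
  mu.-integrable setT (EFin \o g) ->
  mu.-integrable setT (EFin \o (fun x => f x + g x)).
Proof. by move=> hf hg; exact: (integrableD measurableT hf hg). Qed.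

Lemma integrable_EFinZ a f : mu.-integrable setT (EFin \o f) ->
  mu.-integrable setT (EFin \o (fun x => a * f x)).
Proof. by move=> hf; exact: (integrableZl measurableT a hf). Qed.

Lemma integrable_EFinB f g : mu.-integrable setT (EFin \o f) ->
  mu.-integrable setT (EFin \o g) ->
  mu.-integrable setT (EFin \o (fun x => f x - g x)).
Proof. by move=> hf hg; exact: (integrableB measurableT hf hg). Qed.

Lemma Rintegral_dominated_cvg (F : nat -> T -> R) (f g : T -> R) :
  (forall n, measurable_fun setT (F n)) -> measurable_fun setT f ->
  (forall x, F n x @[n --> \oo] --> f x) ->
  mu.-integrable setT (EFin \o g) -> (forall n x, `|F n x| <= g x) ->
  mu.-integrable setT (EFin \o f) /\
  \int[mu]_x F n x @[n --> \oo] --> \int[mu]_x f x.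
Proof.
move=> mF mf Ff ig Fg.
have [i _ c] : [/\ mu.-integrable setT (EFin \o f),
    (\int[mu]_x `|(F n x)%:E - (f x)%:E|)%E @[n --> \oo] --> 0%E &
    (\int[mu]_x (F n x)%:E)%E @[n --> \oo] --> (\int[mu]_x (f x)%:E)%E].
  apply: (@dominated_convergence _ _ _ mu setT measurableT
    (fun n => EFin \o F n) (EFin \o f) (EFin \o g)) => //.
  - by move=> n; exact/measurable_EFinP.
  - exact/measurable_EFinP.
  - by apply: aeW => x _; apply: cvg_EFin => //; [exact: nearW|exact: Ff].
  - by apply: aeW => x n _; rewrite /= lee_fin.
split => //; apply: fine_cvg; rewrite fineK//.
exact: integrable_fin_num.
Qed.

End integrable_real.

Section square_integrable.
Context d (T : measurableType d) (R : realType) (mu : {measure set T -> \bar R}).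
Implicit Types f g : T -> R.

Definition sqint f : Prop :=
  measurable_fun setT f /\ mu.-integrable setT (EFin \o (fun x => f x ^+ 2)).

Lemma sqint_measurable f : sqint f -> measurable_fun setT f.
Proof. by case. Qed.

Lemma sqint_sqr f : sqint f -> mu.-integrable setT (EFin \o (fun x => f x ^+ 2)).
Proof. by case. Qed.

(** The pointwise bound [|f g| <= f^2 + g^2] supplies the integrable majorant. *)
Lemma sqint_mul f g : sqint f -> sqint g ->
  mu.-integrable setT (EFin \o (fun x => f x * g x)).
Proof.
move=> [mf f2] [mg g2].
apply: (le_integrable _ _ _ (integrableD measurableT f2 g2)) => //.
  by apply/measurable_EFinP; apply: measurable_funM.
move=> x _ /=; rewrite lee_fin normrM [leRHS]ger0_norm; last first.
  by rewrite addr_ge0 ?sqr_ge0.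
rewrite -(real_normK (num_real (f x))) -(real_normK (num_real (g x))).
have := normr_ge0 (f x); have := normr_ge0 (g x).
by move: `|f x| `|g x| => a b ? ?; nra.
Qed.

Lemma sqintD f g : sqint f -> sqint g -> sqint (fun x => f x + g x).
Proof.
move=> hf hg; have [mf f2] := hf; have [mg g2] := hg.
split; first exact: measurable_funD.
under eq_fun do rewrite sqrrD -mulr_natl.
apply: integrable_EFinD => //; apply: integrable_EFinD => //.
by apply: integrable_EFinZ; exact: sqint_mul.
Qed.

Lemma sqintZ a f : sqint f -> sqint (fun x => a * f x).
Proof.
move=> [mf f2]; split; first exact: measurable_funM.
by under eq_fun do rewrite exprMn; exact: integrable_EFinZ.
Qed.

Lemma sqintB f g : sqint f -> sqint g -> sqint (fun x => f x - g x).
Proof.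
move=> hf hg; rewrite (_ : (fun _ => _) = (fun x => f x + (-1) * g x)).
  by apply: sqintD => //; exact: sqintZ.
by apply/funext => x; rewrite mulN1r.
Qed.

Lemma sqint_eq f g : f =1 g -> sqint f -> sqint g.
Proof. by move=> /funext ->. Qed.

Lemma dotL2_Dl f g h : sqint f -> sqint g -> sqint h ->
  \int[mu]_x ((f x + g x) * h x) = \int[mu]_x (f x * h x) + \int[mu]_x (g x * h x).
Proof.
move=> hf hg hh; rewrite -RintegralD//; try exact: sqint_mul.
by apply: eq_Rintegral => x _; rewrite mulrDl.
Qed.

Lemma dotL2_Zl a f h : sqint f -> sqint h ->
  \int[mu]_x ((a * f x) * h x) = a * \int[mu]_x (f x * h x).
Proof.
move=> hf hh; rewrite -RintegralZl//; try exact: sqint_mul.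
by apply: eq_Rintegral => x _; rewrite mulrA.
Qed.

Lemma dotL2C f h : \int[mu]_x (f x * h x) = \int[mu]_x (h x * f x).
Proof. by apply: eq_Rintegral => x _; rewrite mulrC. Qed.

Lemma sqrL2_ge0 f : 0 <= \int[mu]_x (f x ^+ 2).
Proof. by apply: Rintegral_ge0 => x _; exact: sqr_ge0. Qed.

Lemma sqrL2_lincomb a b f g : sqint f -> sqint g ->
  \int[mu]_x ((a * f x + b * g x) ^+ 2) =
  a ^+ 2 * \int[mu]_x (f x ^+ 2) + 2 * a * b * \int[mu]_x (f x * g x) +
  b ^+ 2 * \int[mu]_x (g x ^+ 2).
Proof.
move=> hf hg; have ff := sqint_sqr hf; have gg := sqint_sqr hg.
have fg := sqint_mul hf hg.
rewrite -!RintegralZl// -!RintegralD//;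
  try (repeat apply: integrable_EFinD); try exact: integrable_EFinZ.
by apply: eq_Rintegral => x _; ring.
Qed.

Lemma cauchy_schwarz_L2 f g : sqint f -> sqint g ->
  (\int[mu]_x (f x * g x)) ^+ 2 <= \int[mu]_x (f x ^+ 2) * \int[mu]_x (g x ^+ 2).
Proof.
move=> hf hg; have H a b := sqrL2_lincomb a b hf hg.
have := sqrL2_ge0; move: H (sqrL2_ge0 f) (sqrL2_ge0 g).
set F := \int[mu]_x (f x ^+ 2); set G := \int[mu]_x (g x ^+ 2).
set C := \int[mu]_x (f x * g x) => H F0 G0 P.
have {P}H a b : 0 <= a ^+ 2 * F + 2 * a * b * C + b ^+ 2 * G by rewrite -H.
have [G00|G00] := eqVneq G 0.
  (* With [G = 0] the form at [(C, -(F + 1))] equals [- C^2 (F + 2)], so [C] must vanish. *)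
  have := H C (- (F + 1)); rewrite G00 !mulr0 addr0 => h.
  have := sqr_ge0 C; nra.
have Gp : 0 < G by rewrite lt_neqAle eq_sym G00.
have := H G (- C).
rewrite (_ : _ + _ = G * (F * G - C ^+ 2)); last by ring.
by rewrite pmulr_rge0// subr_ge0.
Qed.

(** Parallelogram identity with the square of [f - g] dropped. *)
Lemma sqrL2_le_double f g : sqint f -> sqint g ->
  \int[mu]_x ((f x + g x) ^+ 2) <= 2 * \int[mu]_x (f x ^+ 2) + 2 * \int[mu]_x (g x ^+ 2).
Proof.
move=> hf hg.
have H1 : \int[mu]_x ((f x + g x) ^+ 2) = \int[mu]_x ((1 * f x + 1 * g x) ^+ 2).
  by apply: eq_Rintegral => x _; ring.
have := sqrL2_ge0 (fun x => 1 * f x + (-1) * g x).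
rewrite H1 !sqrL2_lincomb//; lra.
Qed.

Definition normL2 f := Num.sqrt (\int[mu]_x (f x ^+ 2)).

Lemma normL2_ge0 f : 0 <= normL2 f. Proof. exact: sqrtr_ge0. Qed.

Lemma sqr_normL2 f : normL2 f ^+ 2 = \int[mu]_x (f x ^+ 2).
Proof. by rewrite sqr_sqrtr// sqrL2_ge0. Qed.

Lemma normr_dotL2_le f g : sqint f -> sqint g ->
  `|\int[mu]_x (f x * g x)| <= normL2 f * normL2 g.
Proof.
move=> hf hg; rewrite -(@ler_pXn2r _ 2)// ?nnegrE ?mulr_ge0 ?normL2_ge0//.
by rewrite real_normK ?num_real// exprMn !sqr_normL2 cauchy_schwarz_L2.
Qed.

Lemma normL2_triangle f g : sqint f -> sqint g ->
  normL2 (fun x => f x + g x) <= normL2 f + normL2 g.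
Proof.
move=> hf hg; rewrite -(@ler_pXn2r _ 2)// ?nnegrE ?addr_ge0 ?normL2_ge0//.
rewrite sqr_normL2 (_ : \int[mu]_x _ = \int[mu]_x ((1 * f x + 1 * g x) ^+ 2)); last first.
  by apply: eq_Rintegral => x _; ring.
rewrite sqrL2_lincomb// -!sqr_normL2.
have := le_trans (ler_norm _) (normr_dotL2_le hf hg); lra.
Qed.

End square_integrable.

Section square_integrable_finite.
Context d (T : measurableType d) (R : realType)
  (mu : {finite_measure set T -> \bar R}).
Implicit Types f g : T -> R.

Lemma sqint_cst a : sqint mu (fun=> a).
Proof.
split => //; apply: measurable_bounded_integrable => //.
- exact: (fin_num_fun_lty (fin_num_measure mu)).
- exists (`|a ^+ 2|); split; first exact: num_real.
  by move=> M aM x _ /=; exact: ltW.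
Qed.

Lemma sqint_integrable f : sqint mu f -> mu.-integrable setT (EFin \o f).
Proof.
move=> hf; have := sqint_mul hf (sqint_cst 1).
by under eq_fun do rewrite mulr1.
Qed.

Lemma bounded_sqint f (M : R) : measurable_fun setT f ->
  (forall x, `|f x| <= M) -> sqint mu f.
Proof.
move=> mf fM; split => //.
have [_ h] := sqint_cst M; apply: (le_integrable _ _ _ h) => //.
  by apply/measurable_EFinP; exact: measurable_funX.
move=> x _ /=; rewrite lee_fin !normrX lerXn2r// ?nnegrE//.
exact: le_trans (fM x) (ler_norm _).
Qed.

End square_integrable_finite.

(** * Growth of slowly varying functions *)

Section slow_variation.
Context {R : realType}.
Implicit Types (h L : R -> R) (e : R).
Local Notation leb := (@lebesgue_measure R).

(** Lebesgue measure is determined by its values on the intervals []b, c]], so it is enough to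
    translate those. *)
Lemma lebesgue_measure_translate (a : R) (A : set R) : measurable A ->
  leb ((fun x => x + a) @^-1` A) = leb A.
Proof.
move=> mA.
have mf : measurable_fun [set: measurableTypeR R]
    (fun x : measurableTypeR R => x + a : measurableTypeR R).
  exact: measurable_funD.
rewrite -[LHS]/(pushforward leb (fun x : measurableTypeR R => x + a : measurableTypeR R) A).
apply/esym/lebesgue_measure_unique => //= _ [[b c]] _ <-.
rewrite /pushforward/= (_ : _ @^-1` _ = `](b - a), (c - a)]%classic); last first.
  by apply/seteqP; split => x /=; rewrite !in_itv/= ltrBlDr lerBrDr.
rewrite !lebesgue_measure_itv/= !lte_fin ltrD2r; case: ifP => // _.
by rewrite -!EFinB; congr EFin; ring.
Qed.

Let good h (x : nat -> R) e (n : nat) : set R :=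
  `[0, 2]%classic `&` [set v | forall m, (n <= m)%N -> `|h (x m + v) - h (x m)| < e].

Let measurable_good h x e n : measurable_fun setT h -> measurable (good h x e n).
Proof.
move=> mh; apply: measurableI => //.
rewrite (_ : mkset _ = \bigcap_(m in [set m | (n <= m)%N])
   [set v | `|h (x m + v) - h (x m)| < e]); last by apply/seteqP; split.
apply: bigcap_measurable => [|m _]; first by exists n => /=.
have : measurable_fun setT (fun v => `|h (x m + v) - h (x m)|).
  apply: measurableT_comp => //; apply: measurable_funB => //.
  by apply: measurableT_comp => //; exact: measurable_funD.
move=> /(_ measurableT `]-oo, e[%classic); rewrite setTI.
rewrite (_ : _ @^-1` _ = [set v | `|h (x m + v) - h (x m)| < e]); first exact.
by apply/seteqP; split => v /=; rewrite in_itv.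
Qed.

(** Pointwise convergence makes the increasing sets [good h x e n] exhaust [[0, 2]]; continuity of
    the measure from below then brings their measure close to 2. *)
Let good_large h (x : nat -> R) e : measurable_fun setT h ->
  (forall u, h (x + u) - h x @[x --> +oo] --> 0) -> 0 < e ->
  x @ \oo --> +oo -> \forall n \near \oo, ((3 / 2)%:E < leb (good h x e n))%E.
Proof.
move=> mh hu e0 xoo.
have U : \bigcup_n good h x e n = `[0, 2]%classic.
  apply/seteqP; split => [v [n _ []]//|v v02].
  have : (h (x n + v) - h (x n)) @[n --> \oo] --> 0.
    exact: (cvg_comp _ _ xoo (hu v)).
  move=> /cvgr0_norm_lt/(_ e e0)[n _ nP].
  by exists n => //; split => // m /nP.
have : (leb \o good h x e) @ \oo --> 2%:E.
  rewrite (_ : 2%:E = leb (\bigcup_n good h x e n)); last first.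
    by rewrite U lebesgue_measure_itv/= lte_fin ltr0n/= oppr0 adde0.
  apply: nondecreasing_cvg_mu.
  - by move=> n; exact: measurable_good.
  - by rewrite U.
  - move=> n m nm; apply/subsetPset => v [? vP]; split => // k mk.
    by apply: vP; exact: leq_trans mk.
move=> H; apply: (H [set y | ((3 / 2)%:E < y)%E]); apply: open_nbhs_nbhs; split => /=.
  exact: open_ereal_gt_ereal.
by rewrite lte_fin; lra.
Qed.

(* If uniformity fails along [x n], [u n], the good sets of increments from
   [x n] and from [x n + u n] both have measure above 3/2 inside [0, 2]; after
   translation by [u n] they still meet inside [0, 3]. *)
Lemma uniform_slow_variation h e : measurable_fun setT h ->
  (forall u, h (x + u) - h x @[x --> +oo] --> 0) -> 0 < e ->
  exists X, forall x u, X <= x -> 0 <= u <= 1 -> `|h (x + u) - h x| < e.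
Proof.
move=> mh hu e0; apply: contrapT => /forallNP H.
have {}H n : {p : R * R | [/\ n%:R <= p.1, 0 <= p.2 <= 1 &
    e <= `|h (p.1 + p.2) - h p.1|]}.
  apply: cid; have /existsNP[x /existsNP[u]] := H n%:R.
  move=> /not_implyP[nx /not_implyP[u01 /negP]]; rewrite -leNgt => he.
  by exists (x, u).
pose x n := (sval (H n)).1; pose u n := (sval (H n)).2.
have xn n : n%:R <= x n by rewrite /x; case: (svalP (H n)).
have un n : 0 <= u n <= 1 by rewrite /u; case: (svalP (H n)).
have hn n : e <= `|h (x n + u n) - h (x n)| by rewrite /x /u; case: (svalP (H n)).
have xoo : x @ \oo --> +oo.
  by apply: ger_cvgy (@cvgr_idn R); near=> n; exact: xn.
have yoo : (fun n => x n + u n) @ \oo --> +oo.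
  apply: ger_cvgy (@cvgr_idn R); near=> n.
  by apply: (le_trans (xn n)); rewrite lerDl; case/andP: (un n).
have e2 : 0 < e / 2 by rewrite divr_gt0.
have [n] : exists n, ((3 / 2)%:E < leb (good h x (e / 2) n))%E /\
   ((3 / 2)%:E < leb (good h (fun n => (x n + u n)%R) (e / 2) n))%E.
  near \oo => n; exists n; split.
    by near: n; exact: good_large.
  by near: n; exact: good_large.
set A := good _ _ _ _; set B := good _ _ _ _ => -[A32 B32].
have mA : measurable A by exact: measurable_good.
have mB : measurable B by exact: measurable_good.
pose B' : set R := (fun x => x + - u n) @^-1` B.
have mB' : measurable B'.
  rewrite -[B']setTI; have : measurable_fun setT (fun x : R => x + - u n).
    exact: measurable_funD.
  exact.
have B'32 : ((3 / 2)%:E < leb B')%E by rewrite /B' lebesgue_measure_translate.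
have [v [Av B'v]] : exists v, A v /\ B' v.
  apply: contrapT => /forallNP AB.
  have : (leb (A `|` B') <= leb `[0%R, 3%R]%classic)%E.
    apply: le_measure; rewrite ?inE//; first exact: measurableU.
    have := un n => /andP[u0 u1].
    move=> v [[/=]|[/=]]; rewrite !in_itv/= => /andP[v0 v2] _; apply/andP; split; lra.
  rewrite measureU//; last first.
    by apply/seteqP; split => // v [? ?]; apply: (AB v).
  rewrite lebesgue_measure_itv/= lte_fin ltr0n/= oppr0 adde0 leNgt.
  move=> /negP; apply.
  rewrite (_ : 3 = 3 / 2 + 3 / 2)%R; last by lra.
  by rewrite EFinD; exact: lteD.
have [_ /(_ n (leqnn n)) h1] := Av.
have [_ /(_ n (leqnn n)) h2] := B'v.
have := hn n; rewrite leNgt => /negP; apply.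
rewrite (_ : _ - _ = (h (x n + v) - h (x n)) - (h (x n + v) - h (x n + u n))); last by ring.
rewrite (le_lt_trans (ler_normB _ _))//.
move: h2; rewrite (_ : x n + u n + (v + - u n) = x n + v); last by ring.
move: h1; lra.
Unshelve. all: by end_near. Qed.

(** A weak form of Potter's bounds. For [h x = ln (L (expR x))] slow variation says that increments
    over bounded steps tend to 0. Beyond some [X] each step of length at most 1 changes [h] by less
    than [e], so [h] drifts at most linearly with slope [e], which is a power bound in
    [t = expR x]. *)
Lemma slowly_varying_growth L e : slowly_varying L -> 0 < e ->
  exists T C, [/\ 0 < T, 0 < C & forall t, T <= t ->
    C^-1 * t `^ (- e) <= L t <= C * t `^ e].
Proof.
move=> [mL L0 Lt] e0; pose h x := ln (L (expR x)).
have mh : measurable_fun setT h.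
  apply: measurableT_comp; first exact: measurable_ln.
  rewrite -[fun x => _]/(L \o expR); have M := @measurable_comp _ _ _ _ _ _ _ L setT expR _ _ mL.
  apply: M => //.
  by move=> _ [x _ <-] /=; rewrite in_itv/= andbT expR_gt0.
have hu u : h (x + u) - h x @[x --> +oo] --> 0.
  have -> : (fun x => h (x + u) - h x) = @ln R \o (fun l => L (l * expR u) / L l) \o expR.
    apply/funext => x; rewrite /h /= expRD ln_div ?posrE ?L0 ?mulr_gt0 ?expR_gt0//.
  have expoo : @expR R x @[x --> +oo] --> +oo.
    by apply: ger_cvgy (@cvg_id _ +oo); near=> x; rewrite (le_trans _ (expR_ge1Dx x))// lerDr.
  rewrite -ln1; apply: (cvg_comp _ _ (cvg_comp _ _ expoo (Lt _ (expR_gt0 u)))).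
  exact: continuous_ln.
have [X HX] := uniform_slow_variation mh hu e0.
have step n u : 0 <= u <= 1 -> `|h (X + n%:R + u) - h X| <= n.+1%:R * e.
  elim: n u => [|n ih] u u01; first by rewrite addr0 mul1r ltW// HX.
  rewrite (_ : _ - _ = (h (X + n.+1%:R + u) - h (X + n.+1%:R)) + (h (X + n%:R + 1) - h X)); last first.
    by rewrite -natr1 addrA; ring.
  rewrite (le_trans (ler_normD _ _))// -(natr1 n.+1) mulrDl addrC lerD//.
    by apply: ih; rewrite ler01 lexx.
  by rewrite mul1r ltW// HX// lerDl.
(* The constant collects the starting value [h X], one [e] for the last incomplete unit step, and
   [e |X|] for replacing [ln t - X] by [ln t]. *)
exists (expR X), (expR (`|h X| + e + e * `|X|)); split; rewrite ?expR_gt0// => t Xt.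
have t0 : 0 < t by rewrite (lt_le_trans _ Xt)// expR_gt0.
have Xlt : X <= ln t by rewrite -[X]expRK ler_ln// posrE ?expR_gt0.
have : `|h (ln t) - h X| <= (ln t - X + 1) * e.
  have [n /andP[n1 n2]] : exists n : nat, n%:R <= ln t - X < n.+1%:R.
    by exists (Num.truncn (ln t - X)); apply: truncn_itv; rewrite subr_ge0.
  have n3 : 0 <= ln t - X - n%:R <= 1 by move: n2; rewrite -natr1; lra.
  have := step n _ n3.
  rewrite (_ : X + n%:R + _ = ln t); last by ring.
  move=> /le_trans; apply; rewrite ler_wpM2r ?(ltW e0)//.
  by move: n1; rewrite -(natr1 n); lra.
rewrite {1}/h lnK ?posrE// ler_distl => /andP[h1 h2].
rewrite /powR gt_eqF// -expRN -!expRD -[L t]lnK ?posrE ?L0// !ler_expR.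
have := ler_norm (h X); have := ler_norm (- h X); rewrite normrN => ? ?.
have : e * (- X) <= e * `|X| by rewrite ler_wpM2l ?(ltW e0)// -normrN ler_norm.
by move: h1 h2; rewrite mulrDl mul1r mulrBl; move: (e * `|X|) => a; nra.
Unshelve. all: by end_near. Qed.

End slow_variation.

(** * Hausdorff measure and dilations *)

Section dilations.
Context {R : realType} {d : nat}.
Implicit Types (A B : set 'rV[R]_d) (r s : R) (x y : 'rV[R]_d).

Lemma enormZ r x : 0 <= r -> enorm (r *: x) = r * enorm x.
Proof.
move=> r0; rewrite /enorm dotpZl dotpC dotpZl mulrA -expr2 sqrtrM ?sqr_ge0//.
by rewrite sqrtr_sqr ger0_norm.
Qed.

Lemma enorm_eq0 x : (enorm x == 0) = (x == 0).
Proof.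
apply/idP/eqP => [/eqP x0|->].
  apply/rowP => i; rewrite mxE; apply/eqP; rewrite -normr_le0 -x0.
  exact: coord_le_enorm.
by rewrite /enorm /dotp big1 ?sqrtr0// => i _; rewrite mxE mul0r.
Qed.

Lemma dilate1 A : dilate 1 A = A.
Proof.
by apply/seteqP; split => [_ [x Ax <-]|x Ax]; rewrite ?scale1r//; exists x => //; rewrite scale1r.
Qed.

Lemma dilate_dilate r s A : dilate r (dilate s A) = dilate (r * s) A.
Proof.
apply/seteqP; split => [_ [_ [x Ax <-] <-]|_ [x Ax <-]].
  by exists x => //; rewrite scalerA.
by exists (s *: x); [exists x|rewrite scalerA].
Qed.

Lemma dilateE r A : r != 0 -> dilate r A = (fun x => r^-1 *: x) @^-1` A.
Proof.
move=> r0; apply/seteqP; split => [_ [x Ax <-]/=|x /= Ax].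
  by rewrite scalerA mulVf// scale1r.
by exists (r^-1 *: x) => //; rewrite scalerA mulfV// scale1r.
Qed.

Lemma continuous_scale r : continuous (fun x : 'rV[R]_d => r *: x).
Proof. exact: scaler_continuous. Qed.

Lemma nbhs_scale r x A : r != 0 ->
  nbhs (r *: x) A <-> nbhs x ((fun y => r *: y) @^-1` A).
Proof.
move=> r0; split => [h|h]; first exact: (@continuous_scale r x A h).
have -> : A = (fun y => r^-1 *: y) @^-1` ((fun y => r *: y) @^-1` A).
  by apply/funext => y /=; rewrite scalerA mulfV// scale1r.
by apply: (@continuous_scale r^-1); rewrite /= scalerA mulVf// scale1r.
Qed.

Lemma boundary_dilate r A : r != 0 -> boundary (dilate r A) = dilate r (boundary A).
Proof.
move=> r0; have ri0 : r^-1 != 0 by rewrite invr_eq0.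
rewrite !dilateE//; apply/seteqP.
have closureE x : closure ((fun x => r^-1 *: x) @^-1` A) x <-> closure A (r^-1 *: x).
  split=> [cl B /(continuous_scale (r := r^-1)) /cl [y [Ay By]]|cl B].
    by exists (r^-1 *: y).
  rewrite -[x](scale1r) -(mulfV r0) -scalerA => /(nbhs_scale _ _ r0)/cl[y [Ay By]].
  by exists (r *: y); split => //=; rewrite scalerA mulVf// scale1r.
have interiorE x : ((fun x => r^-1 *: x) @^-1` A)° x <-> A° (r^-1 *: x).
  by rewrite /interior /=; split => /(nbhs_scale _ _ ri0).
by split => x [/closureE cx ix]; split => //; apply: contra_not ix => /interiorE.
Qed.

Local Open Scope ereal_scope.

Lemma ediam_dilate r A : (0 < r)%R -> ediam (dilate r A) = r%:E * ediam A.
Proof.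
move=> r0; rewrite /ediam -ereal_sup_pZl//; congr ereal_sup.
apply/seteqP; split => [_ [[_ _] [[x Ax <-] [y Ay <-]] <-]|_ [_ [[x y] [Ax Ay] <-] <-]] /=.
  exists (enorm (x - y))%:E; first by exists (x, y).
  by rewrite -scalerBr enormZ ?ltW.
exists (r *: x, r *: y)%R; first by split; [exists x|exists y].
by rewrite /= -scalerBr enormZ ?ltW.
Qed.

Lemma hgauge_dilate n r A : (0 < r)%R ->
  hgauge n (dilate r A) = (r ^+ n)%:E * hgauge n A.
Proof.
move=> r0; rewrite /hgauge; have [->|A0] := eqVneq A set0.
  by rewrite /dilate image_set0 eqxx mule0.
case: eqP => [rA0|_].
  exfalso; move/set0P: A0 => [x Ax].
  have : dilate r A (r *: x)%R by exists x.
  by rewrite rA0.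
rewrite ediam_dilate// muleCA; congr (_ * _).
elim: n => [|n ih]; first by rewrite !expe0 mul1e.
by rewrite !expeS ih muleACA -EFinM exprS.
Qed.

(** Dilation carries covers of [A] of mesh [delta / r] to covers of the dilate of mesh [delta] and
    multiplies each gauge by [r^n]. *)
Let hausdorff_measure_dilate_le n r A : (0 < r)%R ->
  hausdorff_measure n (dilate r A) <= (r ^+ n)%:E * hausdorff_measure n A.
Proof.
move=> r0; apply: ge_ereal_sup => _ [delta /= + <-]; rewrite in_itv/= andbT => d0.
apply: (@le_trans _ _ ((r ^+ n)%:E * hausdorff_content n (delta / r) A)); last first.
  rewrite lee_pmul2l ?lte_fin ?exprn_gt0//; apply: ereal_sup_ubound.
  by exists (delta / r)%R => //=; rewrite in_itv/= andbT divr_gt0.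
rewrite muleC -lee_pdivrMr ?exprn_gt0//.
apply: le_ereal_inf_tmp => _ [U [AU Ud] <-].
rewrite lee_pdivrMr ?exprn_gt0// muleC -nneseriesZl; last first.
  by move=> *; exact: hgauge_ge0.
apply: ereal_inf_lbound; exists (fun k => dilate r (U k)).
  split=> [_ [x /AU[k _ Ukx] <-]|k]; first by exists k => //; exists x.
  by rewrite ediam_dilate// -lee_pdivlMl// -EFinM mulrC.
by apply: eq_eseriesr => k _; rewrite hgauge_dilate.
Qed.

(** The missing inequality is the previous one for the factor [r^-1] applied to [dilate r A]. *)
Lemma hausdorff_measure_dilate n r A : (0 < r)%R ->
  hausdorff_measure n (dilate r A) = (r ^+ n)%:E * hausdorff_measure n A.
Proof.
move=> r0; apply/eqP; rewrite eq_le hausdorff_measure_dilate_le//=.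
have := @hausdorff_measure_dilate_le n r^-1 (dilate r A).
rewrite invr_gt0 => /(_ r0); rewrite dilate_dilate mulVf ?gt_eqF// dilate1.
by rewrite exprVn lee_pdivlMl ?exprn_gt0.
Qed.

(** Needed to see that a surface of positive measure has positive diameter. The cover by [A] itself
    and empty sets costs nothing because [n > 0]. *)
Lemma hausdorff_measure_subsingleton n A : (0 < n)%N ->
  (forall x y, A x -> A y -> x = y) -> hausdorff_measure n A = 0.
Proof.
move=> n0 Axy; apply/eqP; rewrite eq_le hausdorff_measure_ge0 andbT.
have A0 : ediam A <= 0.
  apply: ge_ereal_sup => _ [[x y] [Ax Ay] <-] /=.
  have e0 : enorm (0 : 'rV[R]_d) = 0%R by apply/eqP; rewrite enorm_eq0.
  by rewrite (Axy x y Ax Ay) subrr e0.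
apply: ge_ereal_sup => _ [delta /= + <-]; rewrite in_itv/= andbT => d0.
apply: ereal_inf_lbound; exists (fun k : nat => if k is 0%N then A else set0 : set 'rV[R]_d).
  split=> [x Ax|[|k]]; first by exists 0%N.
  - by rewrite (le_trans A0)// lee_fin ltW.
  - by apply: ge_ereal_sup => _ [[x y] [[]]].
apply: eseries0 => -[|k] _ _; last by rewrite hgauge0.
rewrite /hgauge; case: eqP => // /eqP/set0P A0'.
have -> : ediam A = 0 by apply/eqP; rewrite eq_le A0 ediam_ge0.
by case: n n0 => // n _; rewrite expeS mul0e mule0.
Qed.

Lemma closed_measurable_borelV A : closed A -> measurable (A : set (borelV R d)).
Proof.
move=> cA; rewrite -[A]setCK; apply: measurableC.
by apply: sub_sigma_algebra; exact: closed_openC.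
Qed.

End dilations.

(** * Gaussian integrals *)

Section density.
Context d (T : measurableType d) (R : realType).
Variables (mu nu : {measure set T -> \bar R}) (p : T -> R).
Hypothesis mp : measurable_fun setT p.
Hypothesis p0 : forall x, 0 <= p x.
Hypothesis nuE : forall A, measurable A -> nu A = (\int[mu]_(x in A) (p x)%:E)%E.

Local Open Scope ereal_scope.
Import HBNNSimple.

Let integral_density_indic A : measurable A ->
  \int[nu]_x (\1_A x)%:E = \int[mu]_x ((\1_A x)%:E * (p x)%:E).
Proof.
move=> mA; rewrite integral_indic// setIT nuE// integral_mkcond.
apply: eq_integral => x _; rewrite patchE indicE.
by case: ifPn => xA; rewrite ?mul1e ?mul0e.
Qed.

Let mpE : measurable_fun setT (EFin \o p). Proof. exact/measurable_EFinP. Qed.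

Let integral_density_nnsfun (f : {nnsfun T >-> R}) :
  \int[nu]_x (f x)%:E = \int[mu]_x ((f x)%:E * (p x)%:E).
Proof.
under [LHS]eq_integral do rewrite fimfunE -fsumEFin//.
rewrite [LHS]ge0_integral_fsum//; last 2 first.
  - by move=> r; exact/measurable_EFinP/measurableT_comp.
  - by move=> n x _; rewrite EFinM nnfun_muleindic_ge0.
under [RHS]eq_integral.
  move=> x xD; rewrite fimfunE -fsumEFin// muleC ge0_mule_fsumr; last first.
    by move=> r; rewrite EFinM nnfun_muleindic_ge0.
  over.
rewrite [RHS]ge0_integral_fsum//; last 2 first.
  - move=> r; apply: emeasurable_funM => //.
    by apply/measurable_EFinP; exact: measurableT_comp.
  - move=> n x _; rewrite EFinM mule_ge0//; last by rewrite nnfun_muleindic_ge0.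
    by rewrite lee_fin.
apply: eq_fsbigr => r _.
rewrite integralZl_indic_nnsfun//= integral_density_indic//.
have [r0|r0] := leP 0%R r.
  rewrite -ge0_integralZl//.
  - by apply: eq_integral => x _; rewrite ?EFinM [RHS]muleC -muleA.
  - apply: emeasurable_funM => //; exact/measurable_EFinP/measurable_indic.
  - by move=> x _; rewrite mule_ge0 ?lee_fin.
rewrite preimage_nnfun0// indic0 [X in (_ * X)%E]integral0_eq ?mule0; last first.
  by move=> x _; rewrite mul0e.
by rewrite integral0_eq// => x _; rewrite mulr0 mule0.
Qed.

(** Monotone convergence from simple functions. The density is used in two guises: the normal
    density against Lebesgue measure, and [\1_D] for a measure restricted to [D]. *)
Lemma ge0_integral_density (f : T -> \bar R) :
  measurable_fun setT f -> (forall x, 0 <= f x) ->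
  \int[nu]_x f x = \int[mu]_x (f x * (p x)%:E).
Proof.
move=> mf f0; pose f_ := nnsfun_approx measurableT mf.
have f_f x : (f_ n x)%:E @[n --> \oo] --> f x by exact: cvg_nnsfun_approx.
have f_nd x n m : (n <= m)%N -> ((f_ n x)%:E <= (f_ m x)%:E)%E.
  by move=> nm; rewrite lee_fin; exact/lefP/nd_nnsfun_approx.
have mf_ n : measurable_fun setT (fun x => (f_ n x)%:E).
  exact/measurable_EFinP.
have c1 : (\int[nu]_x (f_ n x)%:E) @[n --> \oo] --> \int[nu]_x f x.
  rewrite (_ : \int[nu]_x f x = \int[nu]_x limn (fun n => (f_ n x)%:E)); last first.
    by apply: eq_integral => x _; apply/esym/cvg_lim.
  apply: cvg_monotone_convergence => //.
  - by move=> n x _; rewrite lee_fin.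
  - by move=> x _ n m; exact: f_nd.
have c2 : (\int[mu]_x ((f_ n x)%:E * (p x)%:E)) @[n --> \oo] -->
    \int[mu]_x (f x * (p x)%:E).
  rewrite (_ : \int[mu]_x (f x * (p x)%:E) =
     \int[mu]_x limn (fun n => (f_ n x)%:E * (p x)%:E)); last first.
    apply: eq_integral => x _; apply/esym/cvg_lim => //.
    by apply: cvgeZr.
  apply: cvg_monotone_convergence => //.
  - by move=> n; exact: emeasurable_funM.
  - by move=> n x _; rewrite mule_ge0 ?lee_fin.
  - by move=> x _ n m nm; rewrite lee_wpmul2r ?lee_fin// -lee_fin f_nd.
rewrite -(cvg_lim _ c1)// -(cvg_lim _ c2)//.
by apply: congr_lim; apply/funext => n; exact: integral_density_nnsfun.
Qed.

Lemma integrable_density (f : T -> R) : measurable_fun setT f ->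
  nu.-integrable setT (EFin \o f) <->
  mu.-integrable setT (EFin \o (fun x => f x * p x)%R).
Proof.
move=> mf; have mfE : measurable_fun setT (EFin \o f) by exact/measurable_EFinP.
have E : \int[nu]_x `|(EFin \o f) x| = \int[mu]_x `|(EFin \o (fun x => f x * p x)%R) x|.
  rewrite ge0_integral_density//; last exact: measurableT_comp.
  by apply: eq_integral => x _; rewrite /= normrM (ger0_norm (p0 x)) EFinM.
split => /integrableP[_ h]; apply/integrableP; split => //.
- exact/measurable_EFinP/measurable_funM.
- by rewrite -E.
- by rewrite E.
Qed.

Lemma Rintegral_density (f : T -> R) : measurable_fun setT f ->
  (\int[nu]_x f x = \int[mu]_x (f x * p x))%R.
Proof.
move=> mf; have mfE : measurable_fun setT (EFin \o f) by exact/measurable_EFinP.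
rewrite /Rintegral; congr fine.
rewrite integralE [RHS]integralE !ge0_integral_density//.
- congr (_ - _); apply: eq_integral => x _.
    by rewrite !funeposE maxe_pMl ?lee_fin// mul0e.
  by rewrite !funenegE maxe_pMl ?lee_fin// mul0e /= -EFinM mulNr.
- exact: measurable_funeneg.
- exact: measurable_funepos.
Qed.

End density.

Section gaussian_measure.
Context {R : realType}.
Implicit Types (f : R -> R) (m s c x : R) (p : {poly R}).
Local Notation leb := (@lebesgue_measure R).
Local Notation gam := (@normal_prob R 0 1).

Lemma normal_prob_density m s (A : set (measurableTypeR R)) : measurable A ->
  normal_prob m s A = (\int[leb]_(x in A) (normal_pdf m s x)%:E)%E.
Proof. by []. Qed.

Lemma integrable_normal_prob m s f : measurable_fun setT f ->
  (normal_prob m s).-integrable setT (EFin \o f) <->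
  leb.-integrable setT (EFin \o (fun x => f x * normal_pdf m s x)).
Proof.
apply: (@integrable_density _ (measurableTypeR R) R leb (normal_prob m s) (normal_pdf m s)).
- exact: measurable_normal_pdf.
- by move=> x; exact: normal_pdf_ge0.
- exact: normal_prob_density.
Qed.

Lemma Rintegral_normal_prob m s f : measurable_fun setT f ->
  \int[normal_prob m s]_x f x = \int[leb]_x (f x * normal_pdf m s x).
Proof.
apply: (@Rintegral_density _ (measurableTypeR R) R leb (normal_prob m s) (normal_pdf m s)).
- exact: measurable_normal_pdf.
- by move=> x; exact: normal_pdf_ge0.
- exact: normal_prob_density.
Qed.

(** Completing the square: exponential tilting only shifts the mean of a normal density, up to a
    constant factor. Integrability and boundedness of tilted densities follow at once. *)
Lemma expR_normal_pdf m s c x : s != 0 -> expR (c * x) * normal_pdf m s x =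
  expR (c * m + c ^+ 2 * s ^+ 2 / 2) * normal_pdf (m + c * s ^+ 2) s x.
Proof.
move=> s0; rewrite !normal_pdfE// /normal_fun mulrCA [RHS]mulrCA; congr (_ * _).
by rewrite -!expRD; congr expR; field.
Qed.

Lemma integrable_normal_expR m s c : s != 0 ->
  (normal_prob m s).-integrable setT (EFin \o (fun x => expR (c * x))).
Proof.
move=> s0; apply/integrable_normal_prob.
  by apply: measurableT_comp => //; exact: measurable_funM.
under eq_fun do rewrite /= expR_normal_pdf//.
by apply: integrable_EFinZ; exact: integrable_normal_pdf.
Qed.

(** A class closed under products, containing the polynomials, and integrable under every
    nondegenerate normal law. *)
Definition exp_dominated f : Prop :=
  measurable_fun setT f /\ exists C c, forall x, `|f x| <= C * expR (c * `|x|).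

Lemma expR_normr_le c x : expR (c * `|x|) <= expR (c * x) + expR (- c * x).
Proof.
have [x0|x0] := leP 0 x; first by rewrite ger0_norm// lerDl expR_ge0.
by rewrite ltr0_norm// mulrN mulNr lerDr expR_ge0.
Qed.

Lemma exp_dominated_integrable m s f : s != 0 -> exp_dominated f ->
  (normal_prob m s).-integrable setT (EFin \o f).
Proof.
move=> s0 [mf [C [c fC]]].
have H := integrable_EFinZ `|C| (integrable_EFinD (integrable_normal_expR m c s0)
  (integrable_normal_expR m (- c) s0)).
apply: (le_integrable _ _ _ H) => //; first exact/measurable_EFinP.
move=> x _ /=; rewrite lee_fin (le_trans (fC x))// (le_trans _ (ler_norm _))//.
apply: (@le_trans _ _ (`|C| * expR (c * `|x|))).
  by rewrite ler_wpM2r ?expR_ge0// ler_norm.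
by rewrite ler_wpM2l// expR_normr_le.
Qed.

Lemma exp_dominated_mul f g : exp_dominated f -> exp_dominated g ->
  exp_dominated (fun x => f x * g x).
Proof.
move=> [mf [C [c fC]]] [mg [D [e gD]]]; split; first exact: measurable_funM.
exists (C * D), (c + e) => x; rewrite normrM mulrDl expRD mulrACA.
by apply: ler_pM.
Qed.

Lemma exp_dominated_sqint f : exp_dominated f -> sqint gam f.
Proof.
move=> hf; split; first by case: hf.
by under eq_fun do rewrite expr2; apply/exp_dominated_integrable/exp_dominated_mul => //; exact: oner_neq0.
Qed.

(** The free bound [M] allows [M] to be an exponential, whose powers are again exponentials; this
    serves compositions of polynomials with exponentially bounded functions. *)
Lemma poly_growth p : exists C n, forall y M, `|y| <= M -> 1 <= M ->
  `|p.[y]| <= C * M ^+ n.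
Proof.
elim/poly_ind: p => [|p a [C [n H]]].
  by exists 0, 0%N => y M _ _; rewrite hornerE normr0 mul0r.
exists (`|C| + `|a|), n.+1 => y M yM M1; rewrite !hornerE mulrDl.
rewrite (le_trans (ler_normD _ _))// lerD//.
  rewrite normrM exprSr mulrA; apply: ler_pM => //.
  rewrite (le_trans (H y M yM M1))// ler_wpM2r ?ler_norm//.
  by rewrite exprn_ge0// (le_trans _ M1).
by rewrite ler_peMr// exprn_ege1.
Qed.

Lemma exp_dominated_poly p f : measurable_fun setT f ->
  (exists c, forall x, `|f x| <= expR (c * `|x|)) -> exp_dominated (fun x => p.[f x]).
Proof.
move=> mf [c fc]; split.
  elim/poly_ind: p => [|p a ih]; first by under eq_fun do rewrite hornerE; exact: measurable_cst.
  by under eq_fun do rewrite !hornerE; apply: measurable_funD => //; exact: measurable_funM.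
have [C [n H]] := poly_growth p.
exists C, (`|c| * n%:R) => x.
apply: (le_trans (H (f x) (expR (`|c| * `|x|)) _ _)).
- by rewrite (le_trans (fc x))// ler_expR ler_wpM2r// ler_norm.
- by rewrite -[leLHS]expR0 ler_expR mulr_ge0.
- by rewrite -expRM_natl mulrA [n%:R * _]mulrC.
Qed.

Lemma exp_dominated_horner p : exp_dominated (fun x => p.[x]).
Proof.
apply: exp_dominated_poly => //; exists 1 => x; rewrite mul1r.
by rewrite (le_trans _ (expR_ge1Dx _))// lerDr.
Qed.

End gaussian_measure.

Section gaussian_integration_by_parts.
Context {R : realType}.
Implicit Types (x : R) (p : {poly R}).
Local Notation leb := (@lebesgue_measure R).
Variables (m s : R).
Hypothesis s0 : s != 0.

Let phi := @normal_pdf R m s.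

Let phiE x : phi x = normal_peak s * expR (- ((s ^+ 2 *+ 2)^-1 * (x - m) ^+ 2)).
Proof.
by rewrite /phi normal_pdfE// /normal_fun mulNr; congr (_ * expR (- _)); rewrite mulrC.
Qed.

Let is_derive_phi x : is_derive x 1 phi (- (s ^- 2 * ((x - m) * phi x))).
Proof.
have -> : phi = (normal_peak s \*:
    (@expR R \o (horner (- ((s ^+ 2 *+ 2)^-1 *: ('X - m%:P) ^+ 2))))).
  by apply/funext => y; rewrite phiE /= !(hornerE, horner_exp).
apply: (is_derive_eq (is_deriveZ _ (is_derive1_comp (is_derive_expR _) (is_derive_poly _ _)))).
rewrite derivN derivZ deriv_exp derivXsubC /= !(hornerE, horner_exp, hornerMn) /GRing.scale/= mulr2n.
by field; rewrite s0 -mulr2n mulrn_eq0/= expf_neq0.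
Qed.

Let is_derive_poly_phi p x :
  is_derive x 1 (fun y => p.[y] * phi y)
    ((p^`() - s ^- 2 *: (('X - m%:P) * p)).[x] * phi x).
Proof.
apply: (is_derive_eq (is_deriveM (is_derive_poly p x) (is_derive_phi x))).
by rewrite !hornerE /GRing.scale/=; ring.
Qed.

(** If [p] is dominated by [expR (c |x|)], tilting [phi] by [c + 1] instead of [c] keeps it bounded,
    and the extra unit in the exponent is the decay [expR (- |x|)]. *)
Let poly_phi_bound p : exists C, forall x, `|p.[x] * phi x| <= C * expR (- `|x|).
Proof.
have [_ [C [c H]]] := @exp_dominated_horner R p.
have tilt b : exists K, forall x, expR (b * x) * phi x <= K.
  exists (expR (b * m + b ^+ 2 * s ^+ 2 / 2) * normal_peak s) => x.
  by rewrite expR_normal_pdf// ler_wpM2l ?expR_ge0// normal_pdf_ub.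
have [K1 h1] := tilt (c + 1); have [K2 h2] := tilt (- (c + 1)).
exists (`|C| * (K1 + K2)) => x.
have p0 : 0 <= phi x by exact: normal_pdf_ge0.
rewrite normrM (ger0_norm p0).
apply: (@le_trans _ _ (`|C| * ((expR ((c + 1) * x) + expR (- (c + 1) * x)) * phi x) * expR (- `|x|))).
  rewrite [leRHS](_ : _ = (`|C| * ((expR ((c + 1) * x) + expR (- (c + 1) * x)) *
    expR (- `|x|))) * phi x); last by ring.
  rewrite ler_wpM2r// (le_trans (H x))//.
  apply: (@le_trans _ _ (`|C| * expR (c * `|x|))).
    by rewrite ler_wpM2r ?expR_ge0 ?ler_norm.
  rewrite ler_wpM2l// (_ : c * `|x| = (c + 1) * `|x| + - `|x|); last by ring.
  by rewrite expRD ler_wpM2r ?expR_ge0// expR_normr_le.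
by rewrite ler_wpM2r ?expR_ge0// ler_wpM2l// mulrDl lerD.
Qed.

Let cvg_poly_phi p (t : R) : `|t| = 1 -> p.[t * n%:R] * phi (t * n%:R) @[n --> \oo] --> 0.
Proof.
move=> t1; have [C H] := poly_phi_bound p.
apply/norm_cvg0P; apply: (@squeeze_cvgr _ _ _ _ (cst 0) (fun n => C * expR (1 *- n))).
- near=> n; rewrite normr_ge0/= (le_trans (H _))//.
  by rewrite normrM t1 mul1r normr_nat.
- exact: cvg_cst.
- by rewrite -[0](mulr0 C); apply: cvgMr; exact: cvgn_expR.
Unshelve. all: by end_near. Qed.

(** The difference of the two integrands, divided by [s^2], has the density of the derivative of
    [p phi] up to sign. By the fundamental theorem of calculus its integral over [[-n, n]] is a
    boundary term, which tends to 0, and dominated convergence passes to the whole line. *)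
Lemma normal_by_parts p :
  \int[normal_prob m s]_x ((x - m) * p.[x]) =
  s ^+ 2 * \int[normal_prob m s]_x p^`().[x].
Proof.
have ed q := @exp_dominated_horner R q.
have iq q := exp_dominated_integrable m s0 (ed q).
have mq q : measurable_fun setT (fun x : R => q.[x]) by case: (ed q).
suff H : \int[normal_prob m s]_x (p^`() - s ^- 2 *: (('X - m%:P) * p)).[x] = 0.
  have i1 : (normal_prob m s).-integrable setT (EFin \o (fun x => s ^+ 2 * p^`().[x])).
    by apply: integrable_EFinZ; exact: iq.
  have i2 : (normal_prob m s).-integrable setT (EFin \o (fun x => (x - m) * p.[x])).
    by have := iq (('X - m%:P) * p); under eq_fun do rewrite !hornerE.
  apply/eqP; rewrite -RintegralZl//.
  rewrite eq_sym -subr_eq0 -RintegralB//.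
  rewrite -(mulr0 (s ^+ 2)) -H -RintegralZl//.
  apply/eqP; apply: eq_Rintegral => x _; by rewrite hornerD hornerN hornerZ hornerM hornerXsubC; field.
rewrite Rintegral_normal_prob//; set q := _ - _.
pose f x := q.[x] * phi x.
have cphi x : {for x, continuous phi} by exact/continuous_normal_pdf.
have cf : continuous f by move=> x; apply: cvgM; [exact: continuous_horner|exact: cphi].
have mf : measurable_fun setT f by exact: continuous_measurable_fun.
pose I (n : nat) : set R := `[- (1 * n%:R), 1 * n%:R]%classic.
pose F n x := f x * \1_(I n) x.
have [_ c1] : leb.-integrable setT (EFin \o f) /\
    \int[leb]_x F n x @[n --> \oo] --> \int[leb]_x f x.
  apply: (@Rintegral_dominated_cvg _ _ _ leb F f (fun x => `|f x|)).
  - by move=> n; apply: measurable_funM => //; apply: measurable_indic; exact: measurable_itv.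
  - exact: mf.
  - move=> x; rewrite /F; apply: cvg_near_cst.
    near=> n; rewrite indicE mem_set ?mulr1// /I /= in_itv/= !mul1r -ler_norml.
    by near: n; exact: nbhs_infty_ger.
  - have : leb.-integrable setT (EFin \o f) by exact: ((integrable_normal_prob m s (mq q)).1 (iq q)).
    by move=> /integrable_norm.
  - move=> n x; rewrite /F normrM ler_piMr//.
    by rewrite indicE; case: (_ \in _); rewrite ?normr1 ?normr0.
rewrite -[LHS]/(\int[leb]_x f x); apply: (cvg_unique _ c1) => //.
have -> : 0 = 0 - 0 :> R by rewrite subr0.
apply: (cvg_trans _ (cvgB (@cvg_poly_phi p 1 (normr1 _)) (@cvg_poly_phi p (-1) (normrN1 _)))).
apply: near_eq_cvg; near=> n.
have n0 : (0 < n)%N by near: n; exists 1%N.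
rewrite /F /Rintegral.
rewrite (_ : (\int[leb]_x _)%E = (\int[leb]_(x in I n) (f x)%:E)%E); last first.
  rewrite [RHS]integral_mkcond; apply: eq_integral => x _.
  by rewrite patchE indicE; case: (_ \in _); rewrite ?mulr1 ?mulr0.
rewrite (@continuous_FTC2 _ f (fun y => p.[y] * phi y))//=.
- by rewrite !fctE !mulN1r !mul1r.
- by rewrite mul1r gtrN ?ltr0n.
- exact: continuous_subspaceT.
- split => [x _||].
  + by have [] := is_derive_poly_phi p x.
  + apply: cvg_at_right_filter; apply: cvgM; [exact: continuous_horner|exact: cphi].
  + apply: cvg_at_left_filter; apply: cvgM; [exact: continuous_horner|exact: cphi].
- by move=> x _; rewrite derive1E; have [_ ->] := is_derive_poly_phi p x.
Unshelve. all: by end_near. Qed.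

End gaussian_integration_by_parts.

(** * Density of polynomials in the Gaussian L2 space *)

Section polynomial_closure.
Context {R : realType}.
Implicit Types (x y : R) (f g : R -> R) (p : {poly R}).
Local Notation gam := (@normal_prob R 0 1).

Definition polynomial_limit f : Prop :=
  sqint gam f /\ forall e, 0 < e ->
    exists p, \int[gam]_x ((f x - p.[x]) ^+ 2) < e.

Lemma sqint_horner p : sqint gam (fun x => p.[x]).
Proof. exact/exp_dominated_sqint/exp_dominated_horner. Qed.

Lemma polynomial_limit_horner p : polynomial_limit (fun x => p.[x]).
Proof.
split => [|e e0]; first exact: sqint_horner.
exists p; rewrite (_ : \int[gam]_x _ = \int[gam]_x (0 * 0 : R)).
  by rewrite RintegralZl ?mul0r//; exact: integrable0.
by apply: eq_Rintegral => x _; rewrite subrr expr2.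
Qed.

Lemma polynomial_limit_close f : sqint gam f ->
  (forall e, 0 < e -> exists g, polynomial_limit g /\
     \int[gam]_x ((f x - g x) ^+ 2) < e) -> polynomial_limit f.
Proof.
move=> sf H; split => // e e0; have e4 : 0 < e / 4 by rewrite divr_gt0.
have [g [[sg gp] fg]] := H _ e4; have [p gpe] := gp _ e4; exists p.
have := sqrL2_le_double (sqintB sf sg) (sqintB sg (sqint_horner p)).
rewrite (_ : \int[gam]_x ((f x - g x + (g x - p.[x])) ^+ 2) =
  \int[gam]_x ((f x - p.[x]) ^+ 2)); last first.
  by apply: eq_Rintegral => x _; congr (_ ^+ 2); rewrite subrKA.
move=> h; apply: (le_lt_trans h); move: fg gpe; lra.
Qed.

Lemma polynomial_limitD f g : polynomial_limit f -> polynomial_limit g ->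
  polynomial_limit (fun x => f x + g x).
Proof.
move=> [sf fp] [sg gp]; split => [|e e0]; first exact: sqintD.
have e4 : 0 < e / 4 by rewrite divr_gt0.
have [p fpe] := fp _ e4; have [q gqe] := gp _ e4; exists (p + q).
have := sqrL2_le_double (sqintB sf (sqint_horner p)) (sqintB sg (sqint_horner q)).
rewrite (_ : \int[gam]_x ((f x - p.[x] + (g x - q.[x])) ^+ 2) =
  \int[gam]_x ((f x + g x - (p + q).[x]) ^+ 2)); last first.
  by apply: eq_Rintegral => x _; congr (_ ^+ 2); rewrite hornerD; ring.
move=> h; apply: (le_lt_trans h); move: fpe gqe; lra.
Qed.

Lemma polynomial_limitZ a f : polynomial_limit f ->
  polynomial_limit (fun x => a * f x).
Proof.
move=> [sf fp]; split => [|e e0]; first exact: sqintZ.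
have a0 : 0 < a ^+ 2 + 1 by rewrite ltr_wpDl ?sqr_ge0.
have [p fpe] := fp (e / (a ^+ 2 + 1)) (divr_gt0 e0 a0); exists (a *: p).
rewrite (_ : \int[gam]_x _ = a ^+ 2 * \int[gam]_x ((f x - p.[x]) ^+ 2)).
  rewrite (@le_lt_trans _ _ ((a ^+ 2 + 1) * \int[gam]_x ((f x - p.[x]) ^+ 2)))//.
    by rewrite ler_wpM2r ?sqrL2_ge0// lerDl.
  by rewrite mulrC -ltr_pdivlMr.
rewrite -RintegralZl//; last exact: (sqint_sqr (sqintB sf (sqint_horner p))).
by apply: eq_Rintegral => x _; rewrite hornerZ -mulrBr exprMn.
Qed.

Lemma polynomial_limit0 : polynomial_limit (fun=> 0).
Proof.
have := polynomial_limit_horner 0; rewrite (_ : (fun _ => _) = fun=> 0)//.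
by apply/funext => x; rewrite hornerE.
Qed.

Lemma polynomial_limit_sum (I : Type) (s : seq I) (F : I -> R -> R) :
  (forall i, polynomial_limit (F i)) ->
  polynomial_limit (fun x => \sum_(i <- s) F i x).
Proof.
move=> hF; elim: s => [|i s ih].
  by under eq_fun do rewrite big_nil; exact: polynomial_limit0.
by under eq_fun do rewrite big_cons; exact: polynomial_limitD.
Qed.

(** Pointwise limits under a square-integrable envelope are limits in [L2]. Every passage to the
    limit below, from polynomials to sines, indicators and nonnegative functions, has this form. *)
Lemma polynomial_limit_cvg (F : nat -> R -> R) f g :
  (forall n, polynomial_limit (F n)) -> measurable_fun setT f ->
  (forall x, F n x @[n --> \oo] --> f x) ->
  sqint gam g -> (forall n x, `|F n x| <= g x) -> polynomial_limit f.
Proof.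
move=> hF mf Ff sg Fg.
have fg x : `|f x| <= g x.
  apply: (@cvgr_to_le _ _ _ _ _ _ _ (cvg_norm (Ff x))).
  by apply: nearW => n; exact: Fg.
have sf : sqint gam f.
  split => //; apply: (le_integrable _ _ _ (sqint_sqr sg)) => //.
    by apply/measurable_EFinP; exact: measurable_funX.
  move=> x _; rewrite /= lee_fin !normrX lerXn2r// ?nnegrE//.
  by rewrite (le_trans (fg x))// ler_norm.
apply: polynomial_limit_close => // e e0.
have [_ c] : gam.-integrable setT (EFin \o (fun=> 0 : R)) /\
    \int[gam]_x ((f x - F n x) ^+ 2) @[n --> \oo] --> \int[gam]_x (0 : R).
  apply: (@Rintegral_dominated_cvg _ _ _ gam _ _ (fun x => (2 * g x) ^+ 2)).
  - move=> n; apply: measurable_funX; apply: measurable_funB => //.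
    exact: sqint_measurable (hF n).1.
  - exact: measurable_cst.
  - move=> x; rewrite [X in _ --> X](_ : _ = (f x - f x) ^+ 2); last first.
      by rewrite subrr expr0n.
    apply: (cvg_comp (fun n => f x - F n x) (fun y => y ^+ 2) _ (@sqr_continuous R _)).
    exact: (cvgB (cvg_cst (f x)) (Ff x)).
  - exact: sqint_sqr (sqintZ 2 sg).
  - move=> n x; have g0 : 0 <= g x by rewrite (le_trans _ (fg x)).
    rewrite normrX lerXn2r ?nnegrE ?mulr_ge0//.
    by rewrite (le_trans (ler_normB _ _))// mulr2n mulrDl mul1r lerD.
move: c; rewrite Rintegral_cst// mul0r => /cvgr0_norm_lt/(_ e e0)[n _ /(_ n (leqnn n))] h.
exists (F n); split; first exact: hF.
by rewrite (le_lt_trans (ler_norm _) h).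
Qed.

(* Partial sums of the sine series are dominated by the exponential, hence
   polynomials in [sin (t x)] are limits of polynomials. *)
Let sin_poly (t : R) (N : nat) : {poly R} :=
  \sum_(0 <= k < N) (sin_coeff 1 k * t ^+ k) *: 'X^k.

Let sin_polyE t N x : (sin_poly t N).[x] = series (sin_coeff (t * x)) N.
Proof.
rewrite /sin_poly horner_sum /series /=; apply: eq_bigr => k _.
by rewrite hornerZ hornerXn /sin_coeff /= expr1n exprMn; ring.
Qed.

Let sin_poly_bound t N x : `|(sin_poly t N).[x]| <= expR (`|t| * `|x|).
Proof.
rewrite sin_polyE -normrM; move: (t * x) => y.
apply: (@le_trans _ _ (series (exp_coeff `|y|) N)).
  rewrite /series/= (le_trans (ler_norm_sum _ _ _))//; apply: ler_sum => k _.
  rewrite /sin_coeff /exp_coeff/= !normrM normfV !normr_nat !normrX normrN normr1.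
  rewrite expr1n mulr1; case: (odd k); first by rewrite mul1r.
  by rewrite !mul0r divr_ge0// exprn_ge0.
apply: nondecreasing_cvgn_le; last exact: is_cvg_series_exp_coeff.
apply/nondecreasing_seqP => n; rewrite /series/= big_nat_recr//= lerDl.
by rewrite /exp_coeff/= divr_ge0// exprn_ge0.
Qed.

Lemma polynomial_limit_sin p t : polynomial_limit (fun x => p.[sin (t * x)]).
Proof.
have msin : measurable_fun setT (fun x : R => sin (t * x)).
  apply: measurableT_comp; last exact: measurable_funM.
  by apply: continuous_measurable_fun; exact: continuous_sin.
have [C [n H]] := poly_growth p.
pose F N x := (p \Po sin_poly t N).[x].
apply: (@polynomial_limit_cvg F _ (fun x => C * expR (n%:R * `|t| * `|x|))).
- by move=> N; exact: polynomial_limit_horner.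
- apply: measurableT_comp msin.
  by apply: continuous_measurable_fun; exact: continuous_horner.
- move=> x; rewrite /F; under eq_fun do rewrite horner_comp sin_polyE.
  apply: (cvg_comp (series (sin_coeff (t * x))) (horner p) _ (@continuous_horner _ p _)).
  have h := @is_cvg_series_sin_coeff R (t * x); rewrite sin.unlock; exact: h.
- apply: sqintZ; apply: exp_dominated_sqint; split.
    apply: (measurableT_comp (f := expR)) => //; apply: measurable_funM => //.
  by exists 1, (n%:R * `|t|) => x; rewrite mul1r ger0_norm ?expR_ge0.
- move=> N x; rewrite /F horner_comp.
  rewrite (le_trans (H _ _ (sin_poly_bound t N x) _))//.
    by rewrite -[leLHS]expR0 ler_expR mulr_ge0.
  by rewrite -expRM_natl mulrA.
Qed.

(* [(1 - v^n)^(n 2^n)] tends to the indicator of [v < 1/2] on [0, 1]. *)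
Let step_poly (n : nat) (v : R) : R := (1 - v ^+ n) ^+ (n * 2 ^ n).

Let step_poly01 n v : 0 <= v <= 1 -> 0 <= step_poly n v <= 1.
Proof.
move=> /andP[v0 v1]; rewrite /step_poly exprn_ge0 ?exprn_ile1//.
- by rewrite subr_ge0 exprn_ile1.
- by rewrite gerBl exprn_ge0.
- by rewrite subr_ge0 exprn_ile1.
Qed.

Let bernoulli (x : R) n : 0 <= x <= 1 -> 1 - n%:R * x <= (1 - x) ^+ n.
Proof.
move=> /andP[x0 x1]; elim: n => [|n ih]; first by rewrite mul0r subr0 expr0.
rewrite exprS; apply: (@le_trans _ _ ((1 - x) * (1 - n%:R * x))); last first.
  by rewrite ler_wpM2l// subr_ge0.
rewrite -natr1; have : 0 <= n%:R * x ^+ 2 by rewrite mulr_ge0// sqr_ge0.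
nra.
Qed.

Let bernoulli_inv (x : R) n : 0 <= x <= 1 -> (1 - x) ^+ n * (1 + n%:R * x) <= 1.
Proof.
move=> /andP[x0 x1]; have x1' : 0 <= 1 - x by rewrite subr_ge0.
elim: n => [|n ih]; first by rewrite mul0r addr0 expr0 mul1r.
rewrite exprSr -mulrA (le_trans _ ih)// ler_wpM2l ?exprn_ge0//.
rewrite -natr1; have : 0 <= n%:R * x ^+ 2 by rewrite mulr_ge0// sqr_ge0.
nra.
Qed.

(** Write [z = s^2]. One factor [s^n] absorbs [n], since [n (s^-1 - 1) <= s^-n] by Bernoulli's
    inequality, and the other factor [s^n] tends to 0. *)
Let cvg_nat_geo (z : R) : 0 <= z < 1 -> n%:R * z ^+ n @[n --> \oo] --> 0.
Proof.
move=> /andP[z0 z1].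
have [->|zn0] := eqVneq z 0.
  apply: cvg_near_cst; near=> n; rewrite expr0n gtn_eqF ?mulr0//.
  by near: n; exists 1%N.
have zp : 0 < z by rewrite lt_neqAle eq_sym zn0.
pose s := Num.sqrt z.
have s0 : 0 < s by rewrite sqrtr_gt0.
have s1 : s < 1 by rewrite -sqrtr1 ltr_sqrt.
have ss : z = s * s by rewrite -expr2 sqr_sqrtr// ltW.
have B n : n%:R * z ^+ n <= s ^+ n / (s^-1 - 1).
  have h : 0 < s^-1 - 1 by rewrite subr_gt0 invf_gt1.
  rewrite ler_pdivlMr// ss exprMn.
  have : n%:R * (s^-1 - 1) <= s ^- n.
    rewrite -exprVn.
    have {h} : 1 <= s^-1 by rewrite -subr_ge0 ltW.
    move: (s^-1) => y y1; elim: n => [|n ih]; first by rewrite mul0r expr0.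
    rewrite exprS -natr1 mulrDl mul1r.
    have : 1 <= y ^+ n by rewrite exprn_ege1.
    by move: ih; move: (y ^+ n) => w; nra.
  rewrite -[leRHS]mul1r -ler_pdivrMr ?invr_gt0 ?exprn_gt0// invrK => hn.
  rewrite (_ : _ * _ * _ = (n%:R * (s^-1 - 1) * s ^+ n) * s ^+ n); last by ring.
  by rewrite -[leRHS]mul1r ler_wpM2r// exprn_ge0// ltW.
apply: (@squeeze_cvgr _ _ _ _ (cst 0) (fun n => s ^+ n / (s^-1 - 1))).
- by near=> n; rewrite B mulr_ge0// exprn_ge0.
- exact: cvg_cst.
- rewrite -[0](mul0r (s^-1 - 1)^-1); apply: cvgMl.
  by apply: cvg_expr; rewrite ger0_norm// ltW.
Unshelve. all: by end_near. Qed.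

(** The exponent is chosen so that [n 2^n v^n = n (2 v)^n], which tends to 0 for [v < 1/2] and is at
    least [n] for [v >= 1/2], endpoint included. [bernoulli] yields the limit 1 in the first case,
    [bernoulli_inv] the bound [1 / (n + 1)] in the second. *)
Let cvg_step_poly (v : R) : 0 <= v <= 1 ->
  step_poly n v @[n --> \oo] --> ((if v < 2^-1 then 1 else 0) : R).
Proof.
move=> /andP[v0 v1]; have E n : (n * 2 ^ n)%:R * v ^+ n = n%:R * (2 * v) ^+ n.
  by rewrite natrM natrX exprMn mulrA.
have vn n : 0 <= v ^+ n <= 1 by rewrite exprn_ge0// exprn_ile1.
have v01 : 0 <= v <= 1 by rewrite v0.
have [v2|v2] := ltP v 2^-1.
  apply: (@squeeze_cvgr _ _ _ _ (fun n => 1 - n%:R * (2 * v) ^+ n) (cst 1)).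
  - near=> n; rewrite -E bernoulli//=.
    by case/andP: (step_poly01 n v01).
  - rewrite -[X in _ --> X]subr0; apply: (@cvgB _ R^o); first exact: cvg_cst.
    by apply: cvg_nat_geo; rewrite mulr_ge0//= -ltr_pdivlMl// mulr1.
  - exact: cvg_cst.
apply: (@squeeze_cvgr _ _ _ _ (cst 0) harmonic).
- near=> n; have /andP[p0 _] := step_poly01 n v01; rewrite p0/=.
  have h := @bernoulli_inv (v ^+ n) (n * 2 ^ n) (vn n).
  rewrite -[leRHS]mul1r ler_pdivlMr//; apply: le_trans h.
  rewrite -/(step_poly n v) ler_wpM2l// E -natr1 addrC lerD2l -[leLHS]mulr1.
  by rewrite ler_wpM2l// exprn_ege1// mulrC -ler_pdivrMr// div1r.
- exact: cvg_cst.
- exact: cvg_harmonic.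
Unshelve. all: by end_near. Qed.

(** The difference of sines lies in [[-2, 2]]; this affine map brings it to [[0, 1]] and places the
    threshold [sin a < sin b] at 1/2, where the limit of [step_poly] jumps. *)
Let sin01 (a b : R) : 0 <= 2^-1 + (sin a - sin b) / 4 <= 1.
Proof.
have := sin_max a; have := sin_max b; rewrite !ler_norml => /andP[? ?] /andP[? ?].
apply/andP; split; lra.
Qed.

Let polynomial_limit_sin_lt (t a : R) :
  polynomial_limit (fun x => if sin (t * x) < sin (t * a) then 1 else 0).
Proof.
pose P n : {poly R} := (1 - ((2^-1 - sin (t * a) / 4)%:P + 4^-1 *: 'X) ^+ n) ^+ (n * 2 ^ n).
have PE n x : (P n).[sin (t * x)] = step_poly n (2^-1 + (sin (t * x) - sin (t * a)) / 4).
  rewrite /P /step_poly !(hornerE, horner_exp); congr ((1 - _ ^+ n) ^+ _); lra.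
have msin : measurable_fun setT (fun x : R => sin (t * x)).
  apply: measurableT_comp; last exact: measurable_funM.
  by apply: continuous_measurable_fun; exact: continuous_sin.
apply: (@polynomial_limit_cvg (fun n x => (P n).[sin (t * x)]) _ (fun=> 1)).
- by move=> n; exact: polynomial_limit_sin.
- by apply: measurable_fun_if => //; apply: measurable_fun_ltr.
- move=> x; under eq_fun do rewrite PE.
  rewrite (_ : (_ < _) = (2^-1 + (sin (t * x) - sin (t * a)) / 4 < 2^-1)); last first.
    by apply/idP/idP => h; lra.
  exact: cvg_step_poly (sin01 _ _).
- exact: sqint_cst.
- move=> n x; rewrite PE; have /andP[p0 p1] := step_poly01 n (sin01 (t * x) (t * a)).
  by rewrite ger0_norm.
Qed.

(** On [[-pi/2, pi/2]] the sine is increasing. Both [x / (n + 1)] and [a / (n + 1)] lie there once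
    [n] exceeds [|x|] and [|a|], so comparing their sines is eventually comparing [x] and [a]. *)
Let polynomial_limit_lt (a : R) : polynomial_limit (fun x => if x < a then 1 else 0).
Proof.
apply: (@polynomial_limit_cvg (fun n x =>
  if sin (n.+1%:R^-1 * x) < sin (n.+1%:R^-1 * a) then 1 else 0) _ (fun=> 1)).
- by move=> n; exact: polynomial_limit_sin_lt.
- by apply: measurable_fun_if => //; apply: measurable_fun_ltr.
- move=> x; apply: cvg_near_cst; near=> n.
  have small (y : R) : `|y| <= n%:R -> n.+1%:R^-1 * y \in `[(- (pi / 2)), pi / 2].
    move=> yn; rewrite in_itv/= -ler_norml normrM ger0_norm ?invr_ge0//.
    rewrite ler_pdivrMl// (le_trans yn)// -natr1.
    have := @pi_ge2 R; have : (0 : R) <= n%:R by []. 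
    by move=> ? ?; nra.
  rewrite ltr_sin; first by rewrite ltr_pM2l// invr_gt0.
    by apply: small; near: n; exact: nbhs_infty_ger.
  by apply: small; near: n; exact: nbhs_infty_ger.
- exact: sqint_cst.
- by move=> n x; case: ifP => _; rewrite ?normr1 ?normr0.
Unshelve. all: by end_near. Qed.

(** Half-lines [[x, +oo[] are stable under intersection and generate the Borel sets. The sets whose
    indicator is a limit of polynomials form a Dynkin system: complements correspond to [1 - f],
    disjoint unions to partial sums bounded by 1. *)
Lemma polynomial_limit_indic (A : set R) : measurable A -> polynomial_limit \1_A.
Proof.
have h1 := polynomial_limit_horner 1.
have {}h1 : polynomial_limit (fun=> 1).
  by move: h1; rewrite (_ : (fun _ => _) = fun=> 1)//; apply/funext => x; rewrite hornerE.
have compl f : polynomial_limit f -> polynomial_limit (fun x => 1 - f x).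
  move=> hf; have := polynomial_limitD h1 (polynomial_limitZ (-1) hf).
  by under eq_fun do rewrite mulN1r.
move=> mA.
apply: (@dynkin_induction _ (measurableTypeR R) (@RGenCInfty.G R) (fun A => polynomial_limit \1_A)).
- exact: RGenCInfty.measurableE.
- move=> _ _ [x ->] [y ->]; exists (Num.max x y).
  apply/seteqP; split => z /=; rewrite !in_itv/= !andbT ge_max.
    by move=> [-> ->].
  by move=> /andP[].
- by rewrite indicT.
- move=> _ [x ->]; have := compl _ (polynomial_limit_lt x).
  rewrite (_ : (fun _ => _) = \1_`[x, +oo[%classic)//.
  apply/funext => y; rewrite indicE; case: ltP => xy.
    by rewrite memNset ?subrr//= in_itv/= andbT leNgt xy.
  by rewrite mem_set ?subr0//= in_itv/= andbT.
- move=> B mB /compl; rewrite (_ : (fun _ => _) = \1_(~` B))//.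
  by apply/funext => y; rewrite !indicE in_setC; case: (_ \in _); rewrite ?subrr ?subr0.
- move=> F mF tF hF.
  have E n x : \sum_(0 <= k < n) \1_(F k) x = \1_(\bigcup_(k in `I_n) F k) x :> R.
    elim: n => [|n ih]; first by rewrite big_nil bigcup0// indic0.
    rewrite big_nat_recr//= ih !indicE; have [/set_mem Fnx|nFnx] := boolP (x \in F n).
      rewrite memNset ?mem_set ?add0r//; first by exists n => /=.
      move=> [k /= kn Fkx]; have : (F k `&` F n) x by [].
      by move/trivIsetP : tF => /(_ k n I I (negbT (ltn_eqF kn))) ->.
    rewrite addr0; congr (nat_of_bool _)%:R.
    apply/idP/idP => /set_mem[k /= kn Fkx]; apply/mem_set; exists k => //=.
      exact: ltnW.
    move: kn; rewrite ltnS leq_eqVlt => /predU1P[kn|//].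
    by move/negP: nFnx; rewrite -kn => /(_ (mem_set Fkx)).
  apply: (@polynomial_limit_cvg (fun n x => \sum_(0 <= k < n) \1_(F k) x) _ (fun=> 1)).
  + by move=> n; apply: polynomial_limit_sum => k; exact: hF.
  + by apply: measurable_indic; apply: bigcup_measurable => k _; exact: mF.
  + move=> x; apply: cvg_near_cst; have [[k _ Fkx]|nF] := pselect ((\bigcup_k F k) x).
      near=> n; rewrite E !indicE !mem_set//; first by exists k.
      by exists k => //=; near: n; exists k.+1.
    near=> n; rewrite E !indicE !memNset//.
    by move=> [k _ Fkx]; apply: nF; exists k.
  + exact: sqint_cst.
  + by move=> n x; rewrite E indicE; case: (_ \in _); rewrite ?normr1 ?normr0.
- by have e := RGenCInfty.measurableE R; rewrite -[X in X A]e.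
Unshelve. all: by end_near. Qed.

Import HBNNSimple.

Let polynomial_limit_nnsfun (f : {nnsfun measurableTypeR R >-> R}) : polynomial_limit f.
Proof.
rewrite (_ : (f : R -> R) = fun x =>
  \sum_(y <- finmap.enum_fset (fset_set (range f))) y * \1_(f @^-1` [set y]) x).
  apply: polynomial_limit_sum => y; apply: polynomial_limitZ; apply: polynomial_limit_indic.
  by rewrite -[X in measurable X]setTI; apply: (measurable_funP f).
by apply/funext => x; rewrite [LHS]fimfunE fsbig_finite.
Qed.

(** The approximating simple functions increase to [f], so [f] itself is the envelope. *)
Let polynomial_limit_ge0 f : sqint gam f -> (forall x, 0 <= f x) -> polynomial_limit f.
Proof.
move=> sf f0; have mf := sqint_measurable sf.
have mfE : measurable_fun [set: measurableTypeR R] (EFin \o f) by exact/measurable_EFinP.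
pose f_ := nnsfun_approx measurableT mfE.
have f_f x : f_ n x @[n --> \oo] --> f x.
  have : (f_ n x)%:E @[n --> \oo] --> (f x)%:E.
    by apply: cvg_nnsfun_approx => // y _; rewrite lee_fin.
  exact: fine_cvg.
apply: (@polynomial_limit_cvg (fun n => f_ n) _ f) => //.
move=> n x; rewrite ger0_norm//.
have nd : nondecreasing_seq (fun n => f_ n x).
  by move=> m k mk /=; have /lefP := nd_nnsfun_approx measurableT mfE mk; apply.
have := nondecreasing_cvgn_le nd (cvgP _ (f_f x)) n.
by rewrite (cvg_lim _ (f_f x)).
Qed.

Lemma polynomials_dense f : sqint gam f -> polynomial_limit f.
Proof.
move=> sf; have mf := sqint_measurable sf.
have pos g : sqint gam g -> sqint gam (fun x => Num.max (g x) 0).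
  move=> sg; have mg := sqint_measurable sg; have mm : measurable_fun setT (fun x => Num.max (g x) 0).
    exact: measurable_maxr.
  split => //; apply: (le_integrable _ _ _ (sqint_sqr sg)) => //.
    by apply/measurable_EFinP; exact: measurable_funX.
  move=> x _; rewrite /= lee_fin !normrX lerXn2r// ?nnegrE//.
  by case: (leP (g x) 0) => h; rewrite ?normr0.
have E : f = fun x => Num.max (f x) 0 + (-1) * Num.max (-1 * f x) 0.
  by apply/funext => x; case: (leP (f x) 0) => h; case: leP => h'; lra.
rewrite E; apply: polynomial_limitD; last apply: polynomial_limitZ.
- by apply: polynomial_limit_ge0 => [|x]; [exact: pos|rewrite le_max lexx orbT].
- apply: polynomial_limit_ge0 => [|x]; last by rewrite le_max lexx orbT.
  by apply: pos; exact: sqintZ.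
Qed.

End polynomial_closure.

(** * Gaussian variables *)

Section law_transfer.
Context d (T : measurableType d) d' (U : measurableType d') (R : realType).
Variables (mu : {measure set T -> \bar R}) (nu : {measure set U -> \bar R}).
Variable L : T -> U.
Hypothesis mL : measurable_fun setT L.
Hypothesis lawL : forall A, measurable A -> mu (L @^-1` A) = nu A.

Lemma integrable_law (f : U -> R) : nu.-integrable setT (EFin \o f) ->
  mu.-integrable setT (EFin \o (fun w => f (L w))).
Proof.
move=> fi; have /integrableP[mf foo] := fi; apply/integrableP; split.
  exact: (measurableT_comp mf mL).
rewrite -[ltLHS](ge0_integral_pushforward mL mu (D := setT) (f := fun y => `|(EFin \o f) y|%E))//.
  by rewrite (eq_measure_integral nu)// => A mA _; exact: lawL.
exact: measurableT_comp.
Qed.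

Lemma Rintegral_law (f : U -> R) : nu.-integrable setT (EFin \o f) ->
  \int[mu]_w f (L w) = \int[nu]_y f y.
Proof.
move=> fi; have /integrableP[mf foo] := fi; congr fine.
rewrite -[LHS](integral_pushforward mL (mu := mu) (D := setT) (f := EFin \o f))//.
  by apply: eq_measure_integral => A mA _; exact: lawL.
exact: integrable_law.
Qed.

Lemma sqint_law (f : U -> R) : sqint nu f -> sqint mu (fun w => f (L w)).
Proof.
move=> [mf f2]; split; first exact: measurableT_comp mf mL.
exact: (integrable_law f2).
Qed.

Lemma normL2_law (f : U -> R) : sqint nu f -> normL2 mu (fun w => f (L w)) = normL2 nu f.
Proof. by move=> [mf f2]; rewrite /normL2 (Rintegral_law f2). Qed.

End law_transfer.

Section gaussian_variable.
Context d (T : measurableType d) (R : realType) (P : probability T R).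
Implicit Types (L X Y : T -> R) (p : {poly R}).
Local Notation gam := (@normal_prob R 0 1).

(** Point masses are included; they do occur, since [a X + b Y] is constant when [Y = X] and
    [b = - a]. *)
Definition gaussian_variable L : Prop := exists m s : R,
  forall A : set R, measurable A -> P (L @^-1` A) = gaussian_law m s A.

Let dirac_integrable (m : R) (f : R -> R) : measurable_fun setT f ->
  (\d_(m : measurableTypeR R) : {measure set (measurableTypeR R) -> \bar R}).-integrable setT (EFin \o f).
Proof.
move=> mf; have mfE : measurable_fun [set: measurableTypeR R] (EFin \o f) by exact/measurable_EFinP.
apply/integrableP; split => //; rewrite integral_dirac//; last exact: measurableT_comp.
by rewrite diracT mul1e ltry.
Qed.

Let Rintegral_dirac (m : R) (f : R -> R) : measurable_fun setT f ->
  \int[(\d_(m : measurableTypeR R) : {measure set (measurableTypeR R) -> \bar R})]_x f x = f m.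
Proof.
move=> mf; have mfE : measurable_fun [set: measurableTypeR R] (EFin \o f) by exact/measurable_EFinP.
by rewrite /Rintegral integral_dirac// diracT mul1e.
Qed.

Lemma gaussian_variable_integrable L f : measurable_fun setT L ->
  gaussian_variable L -> exp_dominated f -> P.-integrable setT (EFin \o (fun w => f (L w))).
Proof.
move=> mL [m [s H]] hf; move: H; rewrite /gaussian_law; case: eqVneq => [_|s0] H.
  apply: (@integrable_law _ _ _ (measurableTypeR R) R P \d_(m : measurableTypeR R) L mL H).
  by apply: dirac_integrable; case: hf.
by apply: (@integrable_law _ _ _ (measurableTypeR R) R P (normal_prob m s) L mL H); exact: exp_dominated_integrable.
Qed.

(** Stein's identity with the variance written as a second moment, so that it also covers the point
    mass, where both sides vanish. In the nondegenerate case [normal_by_parts] with the polynomial 1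
    identifies the mean [m], and with ['X] the variance [s^2]. *)
Lemma gaussian_variable_by_parts L p : measurable_fun setT L -> gaussian_variable L ->
  \int[P]_w L w = 0 ->
  \int[P]_w (L w * p.[L w]) = \int[P]_w (L w ^+ 2) * \int[P]_w p^`().[L w].
Proof.
move=> mL [m [s H]]; have ed q := @exp_dominated_horner R q.
have mq q : measurable_fun setT (fun x : R => q.[x]) by case: (ed q).
pose E q := \int[P]_w q.[L w].
have toE q (f : T -> R) : (forall w, f w = q.[L w]) -> \int[P]_w f w = E q.
  by move=> h; apply: eq_Rintegral => w _; exact: h.
rewrite (toE 'X L); last by move=> w; rewrite hornerX.
rewrite (toE 'X^2 (fun w => L w ^+ 2)); last by move=> w; rewrite hornerXn.
rewrite (toE ('X * p) (fun w => L w * p.[L w])); last by move=> w; rewrite hornerM hornerX.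
rewrite -/(E p^`()).
move: H; rewrite /gaussian_law; case: eqVneq => [_|s0] H.
  have E' q : E q = q.[m].
    by rewrite /E (@Rintegral_law _ _ _ (measurableTypeR R) R P
      \d_(m : measurableTypeR R) L mL H _ (dirac_integrable m (mq q))) Rintegral_dirac.
  by rewrite !E' !hornerE => ->; rewrite expr0n !mul0r.
have iq q := exp_dominated_integrable m s0 (ed q).
have E' q : E q = \int[normal_prob m s]_x q.[x].
  by rewrite /E (@Rintegral_law _ _ _ (measurableTypeR R) R P (normal_prob m s) L mL H _ (iq q)).
have B q : E (('X - m%:P) * q) = s ^+ 2 * E q^`().
  by rewrite !E' -normal_by_parts//; apply: eq_Rintegral => x _; rewrite !hornerE.
have ED q r : E (q + r) = E q + E r.
  by rewrite !E' -RintegralD//; apply: eq_Rintegral => x _; rewrite hornerD.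
have EZ a q : E (a *: q) = a * E q.
  by rewrite !E' -RintegralZl//; apply: eq_Rintegral => x _; rewrite hornerZ.
have E1 : E 1 = 1.
  rewrite /E (_ : (fun _ => _) = fun=> 1); last by apply/funext => w; rewrite hornerE.
  by rewrite Rintegral_cst// [X in fine X](@probability_setT _ _ _ P) mul1r.
have m0 : E 'X = m.
  have := B 1; rewrite mulr1 derivC.
  have -> : E 0 = 0 by rewrite -(scale0r 0) EZ mul0r.
  by rewrite -[m%:P]alg_polyC -scaleNr ED EZ E1 mulr1 mulr0 => /eqP; rewrite subr_eq0 => /eqP.
rewrite m0 => m00; rewrite m00 in B.
have := B p; rewrite subr0 => ->; congr (_ * _).
by have := B 'X; rewrite subr0 derivX E1 mulr1 -expr2 => ->.
Qed.

End gaussian_variable.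

(** * Hermite polynomials of correlated Gaussian variables *)

Lemma poly_linear_ind (R : nzRingType) (Q : {poly R} -> Prop) :
  (forall p q, Q p -> Q q -> Q (p + q)) -> (forall a n, Q (a *: 'X^n)) ->
  forall p, Q p.
Proof.
move=> QD QX p; rewrite -(coefK p) poly_def.
apply: (big_ind Q) => //.
by have := QX 0 0%N; rewrite scale0r.
Qed.

(** The difference vanishes at as many distinct natural numbers as its size, one more than a nonzero
    polynomial can afford. *)
Lemma poly_fun_inj (R : numDomainType) (p q : {poly R}) :
  (forall a, p.[a] = q.[a]) -> p = q.
Proof.
move=> pq; apply/eqP; rewrite -subr_eq0; 
apply/eqP/(@roots_geq_poly_eq0 _ _ (map (fun i => i%:R) (iota 0 (size (p - q))))).
- by apply/allP => x _; rewrite /root hornerD hornerN pq subrr.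
- by rewrite map_inj_uniq ?iota_uniq//; exact: (mulrIn (oner_neq0 _)).
- by rewrite size_map size_iota.
Qed.

Section hermite_polynomials.
Context {R : realType}.

Lemma hermiteS k : @hermite R k.+1 = 'X * hermite k - (hermite k)^`().
Proof. by []. Qed.

Lemma deriv_hermite k : (@hermite R k.+1)^`() = k.+1%:R *: hermite k.
Proof.
elim: k => [|k ih].
  by rewrite hermiteS /= -[1]/(1%:P) derivC subr0 mulr1 derivX scale1r.
rewrite hermiteS ih derivB derivM derivX mul1r ih derivZ hermiteS.
rewrite -!mul_polyC -(natr1 k.+1) polyCD; ring.
Qed.

(** Monicity, in the form in which [hermite_expansion] uses it to remove a leading term. *)
Lemma size_hermite_sub k : (size (@hermite R k - 'X^k)%R <= k)%N.
Proof.
elim: k => [|k ih]; first by rewrite expr0 subrr size_poly0.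
rewrite hermiteS exprS addrAC -mulrBr (leq_trans (size_polyD _ _))// geq_max.
apply/andP; split.
  have [->|h0] := eqVneq (@hermite R k - 'X^k) 0; first by rewrite mulr0 size_poly0.
  by rewrite mulrC size_mulX.
have [->|h0] := eqVneq (@hermite R k) 0.
  by rewrite deriv0 oppr0 size_poly0.
rewrite size_polyN -ltnS (leq_trans (lt_size_deriv h0))//.
rewrite -(subrK 'X^k (hermite k)) (leq_trans (size_polyD _ _))// geq_max size_polyXn.
by rewrite (leq_trans ih)// leqW.
Qed.

Lemma hermite_expansion n (q : {poly R}) : (size q <= n)%N ->
  exists c : nat -> R, q = \sum_(j < n) c j *: hermite j.
Proof.
elim: n q => [|n ih] q qn.
  exists (fun=> 0); rewrite big_ord0; apply/eqP.
  by rewrite -size_poly_eq0 -leqn0.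
have [c qc] : exists c : nat -> R, q - q`_n *: hermite n = \sum_(j < n) c j *: hermite j.
  apply: ih; apply/leq_sizeP => j nj.
  rewrite coefB coefZ.
  have hn : (hermite n)`_j = ('X^n : {poly R})`_j.
    have /leq_sizeP/(_ j nj) := size_hermite_sub n.
    by rewrite coefB => /eqP; rewrite subr_eq0 => /eqP.
  rewrite hn coefXn; move: nj; rewrite leq_eqVlt => /predU1P[<-|nj].
    by rewrite eqxx mulr1 subrr.
  rewrite gtn_eqF// mulr0 subr0.
  by have /leq_sizeP/(_ j nj) := qn.
exists (fun j => if j == n then q`_n else c j).
rewrite big_ord_recr/= eqxx -[LHS](subrK (q`_n *: hermite n)) qc; congr (_ + _).
by apply: eq_bigr => i _; rewrite ltn_eqF.
Qed.

End hermite_polynomials.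

Section gaussian_pair.
Context d (T : measurableType d) (R : realType) (P : probability T R).
Implicit Types (X Y : T -> R) (p q r : {poly R}).

(** Joint Gaussianity is expressed through linear combinations, as in [gaussian_field]; in
    particular the degenerate correlations 1 and -1 are allowed. *)
Record gaussian_pair X Y (rho : R) : Prop := GaussianPair {
  gp_measurable1 : measurable_fun setT X ;
  gp_measurable2 : measurable_fun setT Y ;
  gp_linear : forall a b, gaussian_variable P (fun w => a * X w + b * Y w) ;
  gp_mean1 : \int[P]_w X w = 0 ;
  gp_mean2 : \int[P]_w Y w = 0 ;
  gp_var1 : \int[P]_w (X w ^+ 2) = 1 ;
  gp_var2 : \int[P]_w (Y w ^+ 2) = 1 ;
  gp_cov : \int[P]_w (X w * Y w) = rho }.

Variables (X Y : T -> R) (rho : R).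
Hypothesis XY : gaussian_pair X Y rho.

Let mX := gp_measurable1 XY.
Let mY := gp_measurable2 XY.

Let gX : gaussian_variable P X.
Proof.
by have := gp_linear XY 1 0; under eq_fun do rewrite mul1r mul0r addr0.
Qed.

Let gY : gaussian_variable P Y.
Proof.
by have := gp_linear XY 0 1; under eq_fun do rewrite mul1r mul0r add0r.
Qed.

Let sX p : sqint P (fun w => p.[X w]).
Proof.
have [mp _] := @exp_dominated_horner R p.
split; first exact: measurableT_comp mp mX.
have := gaussian_variable_integrable mX gX (exp_dominated_horner (p ^+ 2)).
by under eq_fun do rewrite horner_exp.
Qed.

Let sY p : sqint P (fun w => p.[Y w]).
Proof.
have [mp _] := @exp_dominated_horner R p.
split; first exact: measurableT_comp mp mY.
have := gaussian_variable_integrable mY gY (exp_dominated_horner (p ^+ 2)).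
by under eq_fun do rewrite horner_exp.
Qed.

Let B p q : R := \int[P]_w (p.[X w] * q.[Y w]).

Let BDl p q r : B (p + q) r = B p r + B q r.
Proof. by rewrite /B -dotL2_Dl//; apply: eq_Rintegral => w _; rewrite hornerD. Qed.

Let BZl a p r : B (a *: p) r = a * B p r.
Proof. by rewrite /B -dotL2_Zl//; apply: eq_Rintegral => w _; rewrite hornerZ. Qed.

Let BDr p q r : B p (q + r) = B p q + B p r.
Proof.
rewrite /B dotL2C [in X in _ = X + _]dotL2C [in X in _ = _ + X]dotL2C -dotL2_Dl//.
by apply: eq_Rintegral => w _; rewrite hornerD.
Qed.

Let BZr a p r : B p (a *: r) = a * B p r.
Proof.
rewrite /B dotL2C [in X in _ = _ * X]dotL2C -dotL2_Zl//.
by apply: eq_Rintegral => w _; rewrite hornerZ.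
Qed.

Let mon i j := B 'X^i 'X^j.

Let lin a w := a * X w + Y w.

(** The coefficients carry the mixed moments of degree [n], so identities for the one-dimensional
    moments of [lin a], valid for all [a], can be read off coefficient by coefficient. *)
Let P_ n : {poly R} := \sum_(i < n.+1) ('C(n, i)%:R * mon i (n - i)) *: 'X^i.

Let monI i j : P.-integrable setT (EFin \o (fun w => X w ^+ i * Y w ^+ j)).
Proof.
have := sqint_mul (sX 'X^i) (sY 'X^j).
by under eq_fun do rewrite !hornerXn.
Qed.

Let monE i j : mon i j = \int[P]_w (X w ^+ i * Y w ^+ j).
Proof. by apply: eq_Rintegral => w _; rewrite !hornerXn. Qed.

Let P_E n a : (P_ n).[a] = \int[P]_w (lin a w ^+ n).
Proof.
transitivity (\int[P]_w \sum_(i < n.+1) (('C(n, i)%:R * a ^+ i) * (X w ^+ i * Y w ^+ (n - i)))).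
  rewrite /P_ horner_sum.
  have : forall s : seq 'I_n.+1, P.-integrable setT (EFin \o (fun w =>
      \sum_(i <- s) (('C(n, i)%:R * a ^+ i) * (X w ^+ i * Y w ^+ (n - i))))) /\
     \sum_(i <- s) (('C(n, i)%:R * mon i (n - i)) *: 'X^i).[a] =
     \int[P]_w \sum_(i <- s) (('C(n, i)%:R * a ^+ i) * (X w ^+ i * Y w ^+ (n - i))).
    elim=> [|i s [i1 i2]].
      rewrite (_ : (fun w => \sum_(i <- [::]) _) = fun=> 0); last first.
        by apply/funext => w; rewrite big_nil.
      by rewrite big_nil; split; [exact: integrable0|rewrite Rintegral_cst// mul0r].
    have i3 := integrable_EFinZ ('C(n, i)%:R * a ^+ i) (monI i (n - i)).
    rewrite (_ : (fun w => \sum_(j <- i :: s) _) = fun w =>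
      'C(n, i)%:R * a ^+ i * (X w ^+ i * Y w ^+ (n - i)) +
      \sum_(j <- s) 'C(n, j)%:R * a ^+ j * (X w ^+ j * Y w ^+ (n - j))); last first.
      by apply/funext => w; rewrite big_cons.
    split; first exact: integrable_EFinD.
    rewrite big_cons i2 hornerZ hornerXn monE.
    by rewrite mulrAC -RintegralZl// -RintegralD.
  by move=> /(_ (index_enum _))[_ ->].
apply: eq_Rintegral => w _; rewrite /lin addrC exprDn; apply: eq_bigr => i _.
by rewrite exprMn -mulr_natl; ring.
Qed.

(** The variance of [lin a], as a polynomial in [a]. *)
Let Q : {poly R} := 'X^2 + (2 * rho) *: 'X + 1.

(** Stein's identity for [L = lin a] and ['X^(n+1)] reads [E L^(n+2) = (n + 1) E L^2 E L^n]. Being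
    true at every [a], it is an identity of polynomials. *)
Let P_rec n : P_ n.+2 = n.+1%:R *: (Q * P_ n).
Proof.
apply: poly_fun_inj => a; rewrite hornerZ hornerM !P_E.
have ml : measurable_fun setT (lin a) by apply: measurable_funD => //; exact: measurable_funM.
have gl : gaussian_variable P (lin a).
  by have := gp_linear XY a 1; under eq_fun do rewrite mul1r.
have iX : P.-integrable setT (EFin \o X).
  by have := monI 1 0; under eq_fun do rewrite expr0 mulr1 expr1.
have iY : P.-integrable setT (EFin \o Y).
  by have := monI 0 1; under eq_fun do rewrite expr0 mul1r expr1.
have sXX : sqint P X by have := sX 'X; under eq_fun do rewrite hornerX.
have sYY : sqint P Y by have := sY 'X; under eq_fun do rewrite hornerX.
have l0 : \int[P]_w lin a w = 0.
  rewrite RintegralD//; last exact: integrable_EFinZ.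
  by rewrite RintegralZl// (gp_mean1 XY) (gp_mean2 XY) mulr0 addr0.
have l2 : \int[P]_w (lin a w ^+ 2) = Q.[a].
  have := sqrL2_lincomb a 1 sXX sYY; rewrite (gp_var1 XY) (gp_var2 XY) (gp_cov XY).
  rewrite (_ : \int[P]_w ((a * X w + 1 * Y w) ^+ 2) = \int[P]_w (lin a w ^+ 2)); last first.
    by apply: eq_Rintegral => w _; rewrite mul1r.
  by move=> ->; rewrite /Q !(hornerE, hornerXn); ring.
have := gaussian_variable_by_parts 'X^(n.+1) ml gl l0.
rewrite l2 derivXn /=.
rewrite (_ : \int[P]_w (lin a w * ('X^(n.+1)).[lin a w]) = \int[P]_w (lin a w ^+ n.+2)); last first.
  by apply: eq_Rintegral => w _; rewrite hornerXn -exprS.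
move=> ->; rewrite mulrCA; congr (_ * _).
rewrite -RintegralZl//; last first.
  have := gaussian_variable_integrable ml gl (exp_dominated_horner 'X^n).
  by under eq_fun do rewrite hornerXn.
by apply: eq_Rintegral => w _; rewrite hornerMn hornerXn mulr_natl.
Qed.

Let dQ : Q^`() = 2%:R *: ('X + rho%:P).
Proof.
have d1 : (1 : {poly R})^`() = 0 by rewrite -polyC1 derivC.
rewrite /Q derivD derivD derivZ derivXn derivX d1 addr0 /= expr1.
by rewrite -!mul_polyC polyCM -mulr_natl !polyC_natr; ring.
Qed.

(* [P_ n] is [E (a X + Y)^n] as a polynomial in [a], a multiple of the [n]-th
   power of the standard deviation, i.e. of [Q^(n/2)]: this is its logarithmic
   derivative. *)
Let P_euler n : Q * (P_ n)^`() = n%:R *: (('X + rho%:P) * P_ n).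
Proof.
have H m : Q * (P_ m)^`() = m%:R *: (('X + rho%:P) * P_ m) ->
    Q * (P_ m.+2)^`() = m.+2%:R *: (('X + rho%:P) * P_ m.+2).
  move=> ih; rewrite !P_rec derivZ derivM dQ -scalerAr mulrDr ih.
  by rewrite -!mul_polyC -(natr1 m.+1) -(natr1 m) !polyCD; ring.
have P0 : (P_ 0)^`() = 0 by rewrite /P_ big_ord1 expr0 alg_polyC derivC.
have P1 : P_ 1 = 0.
  apply: poly_fun_inj => a; rewrite P_E horner0.
  have iX : P.-integrable setT (EFin \o X).
    by have := monI 1 0; under eq_fun do rewrite expr0 mulr1 expr1.
  have iY : P.-integrable setT (EFin \o Y).
    by have := monI 0 1; under eq_fun do rewrite expr0 mul1r expr1.
  under eq_Rintegral do rewrite expr1.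
  rewrite RintegralD//; last exact: integrable_EFinZ.
  by rewrite RintegralZl// (gp_mean1 XY) (gp_mean2 XY) mulr0 addr0.
suff : (Q * (P_ n)^`() = n%:R *: (('X + rho%:P) * P_ n)) /\
  (Q * (P_ n.+1)^`() = n.+1%:R *: (('X + rho%:P) * P_ n.+1)) by case.
elim: n => [|n [h1 h2]]; last by split => //; exact: H.
by rewrite P0 P1 deriv0 !mulr0 scale0r scaler0.
Qed.

Let mon_rec i j : mon i.+1 j = i%:R * mon i.-1 j + rho * j%:R * mon i j.-1.
Proof.
have D n : (P_ n.+2)^`() = (n.+1 * n.+2)%:R *: (('X + rho%:P) * P_ n).
  rewrite P_rec derivZ derivM dQ P_euler.
  by rewrite -!mul_polyC natrM -(natr1 n.+1) -(natr1 n) !polyCM !polyCD; ring.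
have coefP n k : (P_ n)`_k = if (k <= n)%N then 'C(n, k)%:R * mon k (n - k) else 0.
  by rewrite /P_ -(poly_def n.+1 (fun i => 'C(n, i)%:R * mon i (n - i))) coef_poly ltnS.
have [n ijn] : exists n, (i + j)%N = n by exists (i + j)%N.
case: n ijn => [|n] ijn.
  move/eqP: ijn; rewrite addn_eq0 => /andP[/eqP -> /eqP ->]; rewrite mulr0 !mul0r addr0.
  rewrite monE; under eq_Rintegral do rewrite expr0 mulr1 expr1.
  exact: gp_mean1 XY.
have jE : j = (n.+1 - i)%N by rewrite -ijn addKn.
have iE : (i <= n.+1)%N by rewrite -ijn leq_addr.
have := congr1 (fun p : {poly R} => p`_i) (D n).
rewrite coef_deriv coefZ (_ : ('X + rho%:P) * P_ n = 'X * P_ n + rho *: P_ n); last first.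
  by rewrite mulrDl mul_polyC.
rewrite coefD coefXM coefZ !coefP ltnS iE subSS -jE.
set A := (if i == 0%N then _ else _); set D' := (if (i <= n)%N then _ else _).
(* Absorption identities for binomial coefficients make both terms multiples of ['C(n+1, i)]. In the
   boundary cases [i = 0] and [j = 0] the factors [i%:R] and [j%:R] vanish, so the value at the
   truncated predecessor is immaterial. *)
have hA : n.+1%:R * A = 'C(n.+1, i)%:R * (i%:R * mon i.-1 j).
  rewrite /A; case: (i) iE jE => [|k] iE jE; first by rewrite mul0r !mulr0.
  have kn : (k <= n)%N by [].
  have /(congr1 (fun u : nat => u%:R : R)) := mul_bin_diag n.+1 k.
  by rewrite /= kn !natrM => e; rewrite jE subSS !mulrA e; ring.
have hD : n.+1%:R * D' = 'C(n.+1, i)%:R * (j%:R * mon i j.-1).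
  rewrite /D'; case: leqP => ni.
    have -> : j.-1 = (n - i)%N by rewrite jE subSn.
    have /(congr1 (fun u : nat => u%:R : R)) := mul_bin_down n.+1 i.
    by rewrite /= !natrM -jE => e; rewrite !mulrA e; ring.
  have -> : j = 0%N by apply/eqP; rewrite jE subn_eq0.
  by rewrite mul0r !mulr0.
have /(congr1 (fun u : nat => u%:R : R)) := mul_bin_diag n.+2 i.
rewrite /= !natrM => e; rewrite -[_ *+ i.+1]mulr_natl mulrA -e.
rewrite (_ : _ * _ * (A + _) = n.+2%:R * (n.+1%:R * A + rho * (n.+1%:R * D'))); last by ring.
rewrite hA hD (_ : _ + rho * _ = 'C(n.+1, i)%:R *
  (i%:R * mon i.-1 j + rho * j%:R * mon i j.-1)); last by ring.
move=> h.
have c0 : 'C(n.+1, i)%:R != 0 :> R by rewrite pnatr_eq0 -lt0n bin_gt0.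
have n0 : n.+2%:R != 0 :> R by rewrite pnatr_eq0.
by apply: (mulfI c0); apply: (mulfI n0); rewrite mulrA h.
Qed.

(** Both sides are bilinear in [(p, r)], so the monomial case [mon_rec] is enough. *)
Let stein p r : B ('X * p) r = B p^`() r + rho * B p r^`().
Proof.
elim/poly_linear_ind: p => [p q hp hq|a i].
  by rewrite mulrDr derivD !BDl hp hq; ring.
rewrite -scalerAr derivZ !BZl.
suff -> : B ('X * 'X^i) r = B ('X^i)^`() r + rho * B 'X^i r^`() by ring.
elim/poly_linear_ind: r => [r q hr hq|b j].
  by rewrite derivD !BDr hr hq; ring.
rewrite derivZ !BZr.
suff -> : B ('X * 'X^i) 'X^j = B ('X^i)^`() 'X^j + rho * B 'X^i ('X^j)^`() by ring.
have dX n : ('X^n)^`() = n%:R *: 'X^(n.-1) :> {poly R} by rewrite derivXn scaler_nat.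
rewrite -exprS !dX BZl BZr.
by have := mon_rec i j; rewrite /mon => ->; ring.
Qed.

Let steinY r : B 1 ('X * r) = B 1 r^`().
Proof.
have h : \int[P]_w Y w = 0 := gp_mean2 XY.
have := gaussian_variable_by_parts r mY gY h; rewrite (gp_var2 XY) mul1r /B.
have e q : \int[P]_w ((1 : {poly R}).[X w] * q.[Y w]) = \int[P]_w q.[Y w].
  by apply: eq_Rintegral => w _; rewrite hornerE mul1r.
rewrite !e => <-; apply: eq_Rintegral => w _; by rewrite !hornerE.
Qed.

(** In [H_{j+1} = x H_j - H_j'] the subtracted term cancels the first term of [stein], which leaves
    [B H_{j+1} r = rho B H_j r']. As [H_{k+1}' = (k + 1) H_k], both indices drop together at the
    price of a factor [rho (k + 1)]. *)
Lemma hermite_cov j k : B (hermite j) (hermite k) =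
  if j == k then k`!%:R * rho ^+ k else 0.
Proof.
have BN p r : B (- p) r = - B p r by rewrite -scaleN1r BZl mulN1r.
have BNr p r : B p (- r) = - B p r by rewrite -scaleN1r BZr mulN1r.
have B0 p : B p 0 = 0 by rewrite -(scale0r 0) BZr mul0r.
have step i r : B (hermite i.+1) r = rho * B (hermite i) r^`().
  by rewrite hermiteS BDl BN stein; ring.
elim: j k => [|j ih] [|k].
- rewrite /B eqxx fact0 mul1r expr0 (_ : \int[P]_w _ = \int[P]_w (1 : R)); last first.
    by apply: eq_Rintegral => w _; rewrite /= !hornerE.
  by rewrite Rintegral_cst// [X in fine X](@probability_setT _ _ _ P) mul1r.
- by rewrite hermiteS BDr BNr /= steinY subrr.
- by rewrite step /= -polyC1 derivC B0 mulr0.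
- rewrite step deriv_hermite BZr ih eqSS; case: eqP => // _; last by rewrite !mulr0.
  by rewrite factS natrM exprS; ring.
Qed.

Lemma hermite_cov_sum n (c e : nat -> R) :
  \int[P]_w ((\sum_(j < n) c j *: hermite j).[X w] * (\sum_(j < n) e j *: hermite j).[Y w]) =
  \sum_(j < n) c j * e j * j`!%:R * rho ^+ j.
Proof.
rewrite -/(B _ _).
have Bl r : {morph (fun p => B p r) : p q / p + q} by move=> p q; exact: BDl.
have Bl0 r : B 0 r = 0 by rewrite -(scale0r 0) BZl mul0r.
have Br p : {morph (fun r => B p r) : r q / r + q} by move=> r q; exact: BDr.
have Br0 p : B p 0 = 0 by rewrite -(scale0r 0) BZr mul0r.
rewrite (big_morph _ (Bl _) (Bl0 _)); apply: eq_bigr => j _.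
rewrite BZl (big_morph _ (Br _) (Br0 _)) (bigD1 j)//= BZr hermite_cov eqxx big1 => [|i ij].
  by rewrite addr0; ring.
by rewrite BZr hermite_cov eq_sym (negbTE (_ : i != j :> nat)) ?mulr0.
Qed.

End gaussian_pair.

(** * Decay of covariances of functions orthogonal to low Hermite polynomials *)

Section standard_gaussian.
Context d (T : measurableType d) (R : realType) (P : probability T R).
Implicit Types (X Y L : T -> R) (p q r : {poly R}) (F : R -> R).
Local Notation gam := (@normal_prob R 0 1).

(** A centred point mass has second moment 0, which excludes it. Otherwise integration by parts
    yields [m = 0] and [s^2 = 1]; the sign of [s] stays open, but the density depends on [s^2]
    only. *)
Lemma gaussian_standard_law L : measurable_fun setT L -> gaussian_variable P L ->
  \int[P]_w L w = 0 -> \int[P]_w (L w ^+ 2) = 1 ->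
  forall A : set R, measurable A -> P (L @^-1` A) = gam A.
Proof.
move=> mL gL L0 L1; have [m [s H]] := gL.
have i1 : P.-integrable setT (EFin \o L).
  have := gaussian_variable_integrable mL gL (exp_dominated_horner 'X).
  by under eq_fun do rewrite hornerX.
move: H; rewrite /gaussian_law; case: eqVneq => [_|s0] H.
  have : {ae P, forall w, L w = m}.
    exists (L @^-1` (~` [set m])); split.
    - by rewrite -[X in measurable X]setTI; apply: mL => //; exact: measurableC.
    - by rewrite H ?diracE ?memNset//; [move=> /(_ erefl)|exact: measurableC].
    - by move=> w /= Lm; exact: Lm.
  move=> Lm.
  have E (f : R -> R) : measurable_fun setT f -> \int[P]_w f (L w) = f m.
    move=> mf; transitivity (\int[P]_w f m).
      congr fine; apply: ae_eq_integral => //.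
      + by apply/measurable_EFinP; exact: measurableT_comp mf mL.
      + by apply: filterS Lm => w /= -> _.
    by rewrite Rintegral_cst// [X in fine X](@probability_setT _ _ _ P) mulr1.
  have m0 : m = 0 by have := E (fun x => x) (@measurable_id _ _ _); rewrite L0 => <-.
  have := E (fun x => x ^+ 2) (measurable_funX 2 (@measurable_id _ _ _)).
  by rewrite L1 m0 expr0n/= => /eqP; rewrite oner_eq0.
have iq q := exp_dominated_integrable m s0 (exp_dominated_horner q).
have E q : \int[P]_w q.[L w] = \int[normal_prob m s]_x q.[x].
  by rewrite (@Rintegral_law _ _ _ (measurableTypeR R) R P (normal_prob m s) L mL H _ (iq q)).
have nT : \int[normal_prob m s]_x (1 : R) = 1.
  by rewrite Rintegral_cst// [X in fine X](@probability_setT _ _ _ (normal_prob m s)) mul1r.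
have m0 : m = 0.
  have := normal_by_parts m s0 1; rewrite -polyC1 derivC.
  under eq_Rintegral do rewrite hornerC mulr1.
  under [in X in _ = X -> _]eq_Rintegral do rewrite horner0.
  rewrite Rintegral_cst// mul0r mulr0 => h.
  have := E ('X - m%:P).
  under [in X in _ = X -> _]eq_Rintegral do rewrite hornerXsubC.
  rewrite h; under eq_Rintegral do rewrite hornerXsubC.
  rewrite RintegralB//; last exact: (sqint_integrable (sqint_cst _ _)).
  rewrite L0 Rintegral_cst// [X in fine X](@probability_setT _ _ _ P) mulr1 sub0r.
  by move=> /eqP; rewrite oppr_eq0 => /eqP.
have s1 : s ^+ 2 = 1.
  have := normal_by_parts m s0 'X; rewrite derivX m0.
  under [in X in _ = X -> _]eq_Rintegral do rewrite -polyC1 hornerC.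
  rewrite -m0 nT mulr1 => <-.
  have := E 'X^2; under eq_Rintegral do rewrite hornerXn.
  rewrite L1 => ->; apply: eq_Rintegral => x _.
  by rewrite hornerXn hornerX m0 subr0.
move=> A mA; rewrite H// m0 /normal_prob; apply: eq_integral => x _.
by rewrite !normal_pdfE ?oner_eq0// /normal_fun /normal_peak s1 expr1n.
Qed.

(** At correlation 1 the covariance formulas become orthogonality relations in [L2] of the standard
    Gaussian measure, so these need no separate computation. *)
Lemma gaussian_pair_diag X Y rho : gaussian_pair P X Y rho -> gaussian_pair P Y Y 1.
Proof.
move=> [mX mY l m1 m2 v1 v2 c]; split => //.
move=> a b; have := l 0 (a + b).
by under eq_fun do rewrite mul0r add0r mulrDl.
Qed.

Variables (X Y : T -> R) (rho : R).
Hypothesis XY : gaussian_pair P X Y rho.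

Let mX := gp_measurable1 XY.
Let mY := gp_measurable2 XY.

Lemma gaussian_pair_law : forall A : set R, measurable A -> P (X @^-1` A) = gam A.
Proof.
apply: gaussian_standard_law => //; [|exact: gp_mean1 XY|exact: gp_var1 XY].
by have := gp_linear XY 1 0; under eq_fun do rewrite mul1r mul0r addr0.
Qed.

Let lawY : forall A : set R, measurable A -> P (Y @^-1` A) = gam A.
Proof.
apply: gaussian_standard_law => //; [|exact: gp_mean2 XY|exact: gp_var2 XY].
by have := gp_linear XY 0 1; under eq_fun do rewrite mul1r mul0r add0r.
Qed.

Let sX F : sqint gam F -> sqint P (fun w => F (X w)).
Proof. exact: (@sqint_law _ _ _ (measurableTypeR R) R P gam X mX gaussian_pair_law). Qed.

Let sY F : sqint gam F -> sqint P (fun w => F (Y w)).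
Proof. exact: (@sqint_law _ _ _ (measurableTypeR R) R P gam Y mY lawY). Qed.

Let nX F : sqint gam F -> normL2 P (fun w => F (X w)) = normL2 gam F.
Proof. exact: (@normL2_law _ _ _ (measurableTypeR R) R P gam X mX gaussian_pair_law). Qed.

Let nY F : sqint gam F -> normL2 P (fun w => F (Y w)) = normL2 gam F.
Proof. exact: (@normL2_law _ _ _ (measurableTypeR R) R P gam Y mY lawY). Qed.

Hypothesis rho01 : 0 <= rho <= 1.

Let gammul p q : \int[gam]_x (p.[x] * q.[x]) = \int[P]_w (p.[Y w] * q.[Y w]).
Proof.
rewrite -(@Rintegral_law _ _ _ (measurableTypeR R) R P gam Y mY lawY (fun x => p.[x] * q.[x]))//.
exact: sqint_mul (sqint_horner p) (sqint_horner q).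
Qed.

(* With [p = \sum_j c_j H_j], the left-hand side is [\sum_j c_j^2 j! rho^j]; the
   terms [j <= k] are bounded using [rho <= 1], the others using
   [rho^j <= rho^(k+1)]. *)
Lemma poly_cov_bound k p : `|\int[P]_w (p.[X w] * p.[Y w])| <=
  \sum_(j < k.+1) (\int[gam]_x (p.[x] * (hermite j).[x])) ^+ 2 / j`!%:R +
  rho ^+ k.+1 * \int[gam]_x (p.[x] ^+ 2).
Proof.
have /andP[r0 r1] := rho01.
pose n := maxn (size p) k.+1.
have [c pc] := @hermite_expansion R n p (leq_maxl _ _).
have D := gaussian_pair_diag XY.
have coefE j : (j < n)%N -> \int[gam]_x (p.[x] * (hermite j).[x]) = c j * j`!%:R.
  move=> jn; rewrite gammul {1}pc.
  have hj : hermite j = \sum_(i < n) (nat_of_ord i == j)%:R *: @hermite R i.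
    rewrite (bigD1 (Ordinal jn))//= eqxx scale1r big1 ?addr0// => i ij.
    by rewrite (negbTE (_ : i != j :> nat)) ?scale0r.
  rewrite hj (hermite_cov_sum D n c (fun i => (i == j)%:R)) (bigD1 (Ordinal jn))//= eqxx big1 => [|i ij].
    by rewrite expr1n !mulr1 addr0.
  by rewrite (negbTE (_ : i != j :> nat)) ?mulr0 ?mul0r.
have normE : \int[gam]_x (p.[x] ^+ 2) = \sum_(j < n) c j * c j * j`!%:R.
  under eq_Rintegral do rewrite expr2.
  rewrite gammul {1 2}pc (hermite_cov_sum D).
  by apply: eq_bigr => j _; rewrite expr1n mulr1.
rewrite {1 2}pc (hermite_cov_sum XY) normE mulr_sumr.
rewrite (big_ord_widen n (fun j => (\int[gam]_x (p.[x] * (hermite j).[x])) ^+ 2 / j`!%:R)) ?leq_maxr//.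
rewrite [X in _ <= X + _]big_mkcond -big_split/= (le_trans (ler_norm_sum _ _ _))//.
apply: ler_sum => j _.
have a0 : 0 <= c j * c j * j`!%:R by rewrite mulr_ge0// -expr2 sqr_ge0.
have j0 : j`!%:R != 0 :> R by rewrite pnatr_eq0 -lt0n fact_gt0.
have t0 : 0 <= c j * c j * j`!%:R * rho ^+ j by apply: mulr_ge0 => //; exact: exprn_ge0.
rewrite ger0_norm//; case: ifPn => jk.
  rewrite coefE// (_ : _ / _ = c j * c j * j`!%:R); last by field.
  apply: (@le_trans _ _ (c j * c j * j`!%:R)); last first.
    by rewrite lerDl; apply: mulr_ge0 => //; exact: exprn_ge0.
  by rewrite ler_piMr// exprn_ile1.
rewrite add0r mulrC ler_wpM2r//; move: jk; rewrite -leqNgt => jk.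
by apply: ler_wiXn2l => //.
Qed.

(** For a polynomial [p] close to [F] the coefficients of order at most [k] are small rather than
    zero, which is why [poly_cov_bound] keeps them. Replacing [F] by [p] in one factor at a time
    costs two further terms, bounded by Cauchy-Schwarz. *)
Lemma gaussian_cov_bound k F : sqint gam F ->
  (forall j, (j <= k)%N -> \int[gam]_x (F x * (hermite j).[x]) = 0) ->
  `|\int[P]_w (F (X w) * F (Y w))| <= rho ^+ k.+1 * \int[gam]_x (F x ^+ 2).
Proof.
move=> sF F0; have /andP[r0 r1] := rho01; have [_ dF] := polynomials_dense sF.
set a := normL2 gam F; have a0 : 0 <= a := normL2_ge0 _ _.
pose h := \sum_(j < k.+1) normL2 gam (horner (hermite j)) ^+ 2 / j`!%:R.
have h0 : 0 <= h by apply: sumr_ge0 => j _; rewrite divr_ge0 ?sqr_ge0.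
rewrite -sqr_normL2 -/a; apply/ler_addgt0Pr => dl dl0.
(* The errors [b4], [b6], [b7], [b8] add up to [e^2 h + 4 a e + 2 e^2], which is below
   [e (h + 4 a + 3)] because [e <= 1]. *)
pose e := Num.min 1 (dl / (h + 4 * a + 3)).
have den0 : 0 < h + 4 * a + 3 by rewrite ltr_wpDl// addr_ge0// mulr_ge0.
have e0 : 0 < e by rewrite lt_min ltr01 divr_gt0.
have e1 : e <= 1 by rewrite ge_min lexx.
have edl : e * (h + 4 * a + 3) <= dl by rewrite -ler_pdivlMr// ge_min lexx orbT.
have [p Fp] := dF (e ^+ 2) (exprn_gt0 2 e0).
have sp := @sqint_horner R p.
have sFp : sqint gam (fun x => F x - p.[x]) by exact: sqintB.
have nFp : normL2 gam (fun x => F x - p.[x]) <= e.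
  by rewrite -(@ler_pXn2r _ 2)// ?nnegrE ?normL2_ge0 ?(ltW e0)// sqr_normL2 ltW.
have np : normL2 gam (fun x => p.[x]) <= a + e.
  have -> : (fun x => p.[x]) = (fun x => F x + (-1) * (F x - p.[x])).
    by apply/funext => x; ring.
  apply: (le_trans (normL2_triangle sF (sqintZ _ sFp))); rewrite lerD2l.
  rewrite (_ : normL2 _ _ = normL2 gam (fun x => F x - p.[x]))//.
  by congr Num.sqrt; apply: eq_Rintegral => x _; ring.
have -> : \int[P]_w (F (X w) * F (Y w)) = \int[P]_w (p.[X w] * p.[Y w]) +
   (\int[P]_w ((F (X w) - p.[X w]) * F (Y w)) + \int[P]_w (p.[X w] * (F (Y w) - p.[Y w]))).
  rewrite -!RintegralD//.
  - by apply: eq_Rintegral => w _; ring.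
  - exact: (sqint_mul (sX sp) (sY sp)).
  - apply: integrable_EFinD; first exact: (sqint_mul (sX sFp) (sY sF)).
    exact: (sqint_mul (sX sp) (sY sFp)).
  - exact: (sqint_mul (sX sFp) (sY sF)).
  - exact: (sqint_mul (sX sp) (sY sFp)).
have b1 := normr_dotL2_le (sX sFp) (sY sF); rewrite (nX sFp) (nY sF) -/a in b1.
have b2 := normr_dotL2_le (sX sp) (sY sFp); rewrite (nX sp) (nY sFp) in b2.
have b3 := poly_cov_bound k p.
have b4 : \sum_(j < k.+1) (\int[gam]_x (p.[x] * (hermite j).[x])) ^+ 2 / j`!%:R <= e ^+ 2 * h.
  rewrite /h mulr_sumr; apply: ler_sum => j _.
  rewrite mulrA ler_wpM2r ?invr_ge0//.
  have sh := @sqint_horner R (hermite j).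
  (* Since [F] is orthogonal to [hermite j], the coefficient of [p] is minus that of [F - p], hence
     of order [e]. *)
  have -> : \int[gam]_x (p.[x] * (hermite j).[x]) = - \int[gam]_x ((F x - p.[x]) * (hermite j).[x]).
    have -> : \int[gam]_x ((F x - p.[x]) * (hermite j).[x]) =
        \int[gam]_x (F x * (hermite j).[x]) - \int[gam]_x (p.[x] * (hermite j).[x]).
      rewrite -RintegralB//; [|exact: (sqint_mul sF sh)|exact: (sqint_mul sp sh)].
      by apply: eq_Rintegral => x _; rewrite mulrBl.
    by rewrite F0 ?sub0r ?opprK// -ltnS.
  rewrite sqrrN -real_normK ?num_real// -exprMn lerXn2r ?nnegrE// ?mulr_ge0 ?normL2_ge0 ?(ltW e0)//.
  by rewrite (le_trans (normr_dotL2_le sFp sh))// ler_wpM2r ?normL2_ge0.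
rewrite -sqr_normL2 in b3.
have rk0 : 0 <= rho ^+ k.+1 by rewrite exprn_ge0.
have rk1 : rho ^+ k.+1 <= 1 by rewrite exprn_ile1.
have b5 : normL2 gam (fun x => p.[x]) ^+ 2 <= (a + e) ^+ 2.
  by rewrite lerXn2r ?nnegrE ?normL2_ge0// addr_ge0 ?(ltW e0).
have b6 : rho ^+ k.+1 * normL2 gam (fun x => p.[x]) ^+ 2 <= rho ^+ k.+1 * a ^+ 2 + (2 * a * e + e ^+ 2).
  apply: (le_trans (ler_wpM2l rk0 b5)).
  rewrite sqrrD -addrA mulrDr lerD2l.
  rewrite (_ : a * e *+ 2 + e ^+ 2 = 2 * a * e + e ^+ 2); last by ring.
  by rewrite ler_piMl// addr_ge0 ?sqr_ge0// !mulr_ge0// ltW.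
have b7 : normL2 gam (fun x => F x - p.[x]) * a <= e * a by rewrite ler_wpM2r.
have b8 : normL2 gam (fun x => p.[x]) * normL2 gam (fun x => F x - p.[x]) <= (a + e) * e.
  by rewrite ler_pM ?normL2_ge0.
have e2e : e ^+ 2 <= e by rewrite expr2 ler_piMl// ltW.
have e2h : e ^+ 2 * h <= e * h by rewrite ler_wpM2r.
apply: (le_trans (ler_normD _ _)); apply: (le_trans (lerD b3 (ler_normD _ _))).
nra.
Qed.

Lemma gaussian_pair_hermite k :
  \int[P]_w ((hermite k).[X w] * (hermite k).[Y w]) = k`!%:R * rho ^+ k.
Proof. by rewrite (hermite_cov XY) eqxx. Qed.

End standard_gaussian.

(** * Moments of integrated processes *)

Section Rfubini.
Context d1 d2 (T1 : measurableType d1) (T2 : measurableType d2) (R : realType).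
Variables (m1 : {finite_measure set T1 -> \bar R})
  (m2 : {finite_measure set T2 -> \bar R}).
Implicit Types f : T1 * T2 -> R.

Lemma integrable_prod_swap f : measurable_fun setT f ->
  (m1 \x m2)%E.-integrable setT (EFin \o f) <->
  (m2 \x m1)%E.-integrable setT (EFin \o (fun p => f (p.2, p.1))).
Proof.
move=> mf; have mfE : measurable_fun setT (EFin \o f) by exact/measurable_EFinP.
have mfs : measurable_fun setT (EFin \o (fun p : T2 * T1 => f (p.2, p.1))).
  by apply/measurable_EFinP; apply: measurableT_comp mf _; exact: measurable_fun_pair.
split => h.
  by apply/(integrable12ltyP _ _ mfs); move/(integrable21ltyP _ _ mfE) : h.
by apply/(integrable21ltyP _ _ mfE); move/(integrable12ltyP _ _ mfs) : h.
Qed.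

(** Where the inner extended integral is infinite or undefined, the real one takes a default value;
    by Fubini's theorem this concerns a null set only. *)
Lemma integrable_Rintegral1 f : (m1 \x m2)%E.-integrable setT (EFin \o f) ->
  m1.-integrable setT (EFin \o (fun x => \int[m2]_y f (x, y))) /\
  \int[m1]_x \int[m2]_y f (x, y) = \int[(m1 \x m2)%E]_p f p.
Proof.
move=> fi; have iF := integrable_fubini_F fi.
have mF := measurable_int _ iF.
have mfF : measurable_fun setT (EFin \o (fun x => \int[m2]_y f (x, y))).
  by apply/measurable_EFinP; apply: measurableT_comp mF; exact: fine_measurable.
have ae : ae_eq m1 setT (EFin \o (fun x => \int[m2]_y f (x, y)))
    (fubini_F m2 (EFin \o f)).
  by have := integrable_ae measurableT iF; apply: filterS => x h _; rewrite /= fineK// h.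
split.
  apply/integrableP; split => //; have /integrableP[_] := iF; apply: le_lt_trans.
  apply: ae_ge0_le_integral => //; try exact: measurableT_comp.
  by apply: filterS ae => x h _; rewrite h.
rewrite -[LHS]/(fine _) (ae_eq_integral (fubini_F m2 (EFin \o f)))//.
by rewrite integral12_prod_meas1.
Qed.

End Rfubini.

Section Rfubini_swap.
Context d1 d2 (T1 : measurableType d1) (T2 : measurableType d2) (R : realType).
Variables (m1 : {finite_measure set T1 -> \bar R})
  (m2 : {finite_measure set T2 -> \bar R}).
Implicit Types f : T1 * T2 -> R.

Lemma integrable_Rintegral2 f : (m1 \x m2)%E.-integrable setT (EFin \o f) ->
  m2.-integrable setT (EFin \o (fun y => \int[m1]_x f (x, y))).
Proof.
move=> fi; have mf : measurable_fun setT f.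
  by apply/measurable_EFinP; exact: measurable_int fi.
by move/(integrable_prod_swap m1 m2 mf) : fi => /integrable_Rintegral1[].
Qed.

Lemma Rfubini f : (m1 \x m2)%E.-integrable setT (EFin \o f) ->
  \int[m1]_x \int[m2]_y f (x, y) = \int[m2]_y \int[m1]_x f (x, y).
Proof.
move=> fi; have mf : measurable_fun setT f.
  by apply/measurable_EFinP; exact: measurable_int fi.
have [_ ->] := integrable_Rintegral1 fi.
have /(integrable_prod_swap m1 m2 mf)/integrable_Rintegral1[_ ->] := fi.
congr fine; rewrite -integral21_prod_meas1//.
rewrite -[RHS]integral12_prod_meas1//.
by move/(integrable_prod_swap m1 m2 mf) : fi.
Qed.

End Rfubini_swap.

Section integrated_process.
Context d1 d2 (T : measurableType d1) (Omega : measurableType d2) (R : realType).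
Variables (m : {finite_measure set T -> \bar R}) (P : probability Omega R).
Variables (Z : T -> Omega -> R) (V : R).
Hypothesis mZ : measurable_fun setT (fun p : T * Omega => Z p.1 p.2).
Hypothesis sZ : forall x, sqint P (Z x).
Hypothesis ZV : forall x, \int[P]_w (Z x w ^+ 2) <= V.

Let K w := \int[m]_x Z x w.

Let integrable_bound (f : T * Omega -> R) (C : R) : measurable_fun setT f ->
  (forall x, P.-integrable setT (EFin \o (fun w => f (x, w)))) ->
  (forall x, \int[P]_w `|f (x, w)| <= C) ->
  (m \x P)%E.-integrable setT (EFin \o f).
Proof.
move=> mf fi fC; have mfE : measurable_fun setT (EFin \o f) by exact/measurable_EFinP.
apply/(integrable12ltyP _ _ mfE).
apply: (@le_lt_trans _ _ (\int[m]_x `|C|%:E)%E); last first.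
  rewrite integral_cst// lte_mul_pinfty ?lee_fin//.
  by rewrite -ge0_fin_numE// fin_num_measure.
apply: ge0_le_integral => //.
- by move=> x _; apply: integral_ge0.
- apply: (@measurable_fun_fubini_tonelli_F _ _ _ _ _ P (fun p => `|(f p)%:E|%E)) => //.
  exact: measurableT_comp.
- move=> x _; have := fC x; rewrite -lee_fin fineK; last first.
    have /integrable_fin_num := integrable_norm (fi x); exact.
  by move=> /le_trans; apply; rewrite lee_fin ler_norm.
Qed.

Let iZ x : P.-integrable setT (EFin \o Z x).
Proof. exact: sqint_integrable. Qed.

Let iZZ : (m \x P)%E.-integrable setT (EFin \o (fun p => Z p.1 p.2 ^+ 2)).
Proof.
apply: (@integrable_bound _ V); first exact: measurable_funX.
  by move=> x /=; have := sqint_sqr (sZ x).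
move=> x /=; rewrite (le_trans _ (ZV x))// le_eqVlt; apply/orP; left; apply/eqP.
by apply: eq_Rintegral => w _; rewrite ger0_norm// sqr_ge0.
Qed.

Let le_1sqr (x : R) : `|x| <= 1 + x ^+ 2.
Proof. by rewrite -(real_normK (num_real x)); have := sqr_ge0 (`|x| - 1); nra. Qed.

Let iZ1 : (m \x P)%E.-integrable setT (EFin \o (fun p => Z p.1 p.2)).
Proof.
apply: (@integrable_bound _ (1 + V)) => //= x.
rewrite (@le_trans _ _ (\int[P]_w (1 + Z x w ^+ 2)))//.
  apply: le_Rintegral => //.
  - exact: (integrable_norm (iZ x)).
  - apply: integrable_EFinD; last exact: sqint_sqr.
    exact: (sqint_integrable (sqint_cst P 1)).
rewrite RintegralD//; [|exact: (sqint_integrable (sqint_cst P 1))|exact: sqint_sqr].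
by rewrite Rintegral_cst// [X in fine X](@probability_setT _ _ _ P) mulr1 lerD2l.
Qed.

Let mK : measurable_fun setT K.
Proof. by have /measurable_int/measurable_EFinP := integrable_Rintegral2 iZ1. Qed.

Lemma Rintegral_integrated : \int[P]_w K w = \int[m]_x \int[P]_w Z x w.
Proof. by have := Rfubini iZ1. Qed.

Lemma ae_sqint : {ae P, forall w, sqint m (Z ^~ w)}.
Proof.
have := ae_integrable2 iZZ; apply: filterS => w h; split.
  exact: (measurable_fun_pair1 w mZ).
exact: h.
Qed.

(** Cauchy-Schwarz on the finite measure [m] bounds [K^2] by [m(T)] times the integral of [Z^2], for
    almost every [w]. *)
Lemma sqint_integrated : sqint P K.
Proof.
split => //.
have H := integrable_EFinZ (fine (m setT)) (integrable_Rintegral2 iZZ).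
apply/integrableP; split; first by apply/measurable_EFinP; exact: measurable_funX.
have /integrableP[mH] := H; apply: le_lt_trans.
apply: ae_ge0_le_integral => //.
- by apply: measurableT_comp => //; apply/measurable_EFinP; exact: measurable_funX.
- exact: measurableT_comp.
- move: ae_sqint; apply: filterS => w sw _ /=.
  rewrite lee_fin ger0_norm ?sqr_ge0// (le_trans _ (ler_norm _))//.
  have := cauchy_schwarz_L2 (sqint_cst m 1) sw.
  rewrite (_ : \int[m]_x (1 * Z x w) = K w); last by apply: eq_Rintegral => x _; rewrite mul1r.
  by rewrite [X in _ <= X * _](_ : _ = fine (m setT))// Rintegral_cst// expr1n mul1r.
Qed.

(** Fubini twice on two-fold products in place of a three-fold one: [K^2] is the integral of [Z_x K]
    over [x], and [E (Z_x K)] is the integral of [E (Z_x Z_y)] over [y]. Moving a factor in or out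
    of a path integral is legitimate only for integrable paths, hence the almost-everywhere
    comparisons. *)
Lemma sqr_integrated : \int[P]_w (K w ^+ 2) =
  \int[m]_x \int[m]_y \int[P]_w (Z x w * Z y w).
Proof.
have sK := sqint_integrated.
have iKZ : (m \x P)%E.-integrable setT (EFin \o (fun p => Z p.1 p.2 * K p.2)).
  apply: (@integrable_bound _ (V + \int[P]_w (K w ^+ 2))).
  - by apply: measurable_funM => //; exact: measurableT_comp mK _.
  - by move=> x; exact: (sqint_mul (sZ x) sK).
  - move=> x; apply: (@le_trans _ _ (\int[P]_w (Z x w ^+ 2 + K w ^+ 2))).
      apply: le_Rintegral => //.
      + exact: (integrable_norm (sqint_mul (sZ x) sK)).
      + by apply: integrable_EFinD; exact: sqint_sqr.
      + move=> w _ /=; rewrite normrM -(real_normK (num_real (Z x w))) -(real_normK (num_real (K w))).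
        by have := sqr_ge0 (`|Z x w| - `|K w|); have := sqr_ge0 (`|Z x w| + `|K w|); nra.
    by rewrite RintegralD//; try exact: sqint_sqr; rewrite lerD2r.
have := Rfubini iKZ => /= e.
transitivity (\int[P]_w \int[m]_x (Z x w * K w)).
  congr fine; apply: ae_eq_integral => //.
  - by apply/measurable_EFinP; exact: measurable_funX.
  - by have /measurable_int := integrable_Rintegral2 iKZ.
  - move: ae_sqint; apply: filterS => w sw _ /=.
    by rewrite RintegralZr// ?expr2//; exact: sqint_integrable.
rewrite -e; apply: eq_Rintegral => x _.
have iZx : (m \x P)%E.-integrable setT (EFin \o (fun p => Z x p.2 * Z p.1 p.2)).
  apply: (@integrable_bound _ (V + V)).
  - apply: measurable_funM => //.
    by apply: (measurableT_comp (sqint_measurable (sZ x))).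
  - by move=> y; exact: (sqint_mul (sZ x) (sZ y)).
  - move=> y; apply: (@le_trans _ _ (\int[P]_w (Z x w ^+ 2 + Z y w ^+ 2))).
      apply: le_Rintegral => //.
      + exact: (integrable_norm (sqint_mul (sZ x) (sZ y))).
      + by apply: integrable_EFinD; exact: sqint_sqr.
      + move=> w _ /=; rewrite normrM -(real_normK (num_real (Z x w))) -(real_normK (num_real (Z y w))).
        by have := sqr_ge0 (`|Z x w| - `|Z y w|); have := sqr_ge0 (`|Z x w| + `|Z y w|); nra.
    by rewrite RintegralD//; try exact: sqint_sqr; rewrite lerD.
have /= -> := Rfubini iZx.
congr fine; apply: ae_eq_integral => //.
- by apply/measurable_EFinP; apply: measurable_funM => //; exact: sqint_measurable (sZ x).
- by have /measurable_int := integrable_Rintegral2 iZx.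
- move: ae_sqint; apply: filterS => w sw _ /=.
  by rewrite RintegralZl//; exact: sqint_integrable.
Qed.

End integrated_process.

(** * Limit distributions of asymptotically equal variables *)

(** Compactness of the segment for [x] alone; [y] may leave it, because in the application only one
    of the two variables is truncated. *)
Lemma uniform_continuity_segment (R : realType) (f : R -> R) (N e : R) :
  continuous f -> 0 < e -> exists2 dl, 0 < dl &
    forall x y, `|x| <= N -> `|x - y| < dl -> `|f x - f y| < e.
Proof.
move=> cf e0.
have /compact_near_coveringP K := @segment_compact R (- N) N.
have := K R (0^'+) (fun dl x => forall y, `|x - y| < dl -> `|f x - f y| < e) _.
have H x : `[- N, N]%classic x -> \forall x' \near x & dl \near 0^'+,
    forall y, `|x' - y| < dl -> `|f x' - f y| < e.
  move=> _; have e2 : 0 < e / 2 by rewrite divr_gt0.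
  have /cvgrPdist_lt/(_ _ e2) := cf x; move=> /nbhs_ballP[d /= d0 dP].
  have d2 : 0 < d / 2 by rewrite divr_gt0.
  exists (ball x (d / 2), [set t | t < d / 2]).
    split => /=; first exact: nbhsx_ballx.
    exact: nbhs_right_lt.
  move=> [x' dl] /= [xx' ddl] y x'y.
  have h1 : `|f x - f x'| < e / 2.
    by apply: dP; rewrite /ball/= (lt_trans xx')// ltr_pdivrMr// mulr2n mulrDr mulr1 ltrDl.
  have h2 : `|f x - f y| < e / 2.
    apply: dP; rewrite /ball/= -(subrKA x') (le_lt_trans (ler_normD _ _))//.
    by rewrite [ltRHS]splitr ltrD// (lt_trans x'y).
  rewrite (_ : f x' - f y = (f x - f y) - (f x - f x')); last by ring.
  by rewrite (le_lt_trans (ler_normB _ _))// [ltRHS]splitr ltrD.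
move=> /(_ _ H) [d /= d0 dP]; exists (d / 2); first by rewrite divr_gt0.
move=> x y xN xy; apply: (dP (d / 2)) => //=.
- by rewrite sub0r normrN gtr0_norm ?divr_gt0// ltr_pdivrMr// mulr2n mulrDr mulr1 ltrDl.
- by rewrite divr_gt0.
- by rewrite in_itv/= -ler_norml.
Qed.

Section slutsky.
Context d (Omega : measurableType d) (R : realType) (P : probability Omega R).
Implicit Types (X Y : R -> Omega -> R) (mu : probability R R).

(** Chebyshev's inequality in pointwise form. Off the event [|X| <= N], [|X - Y| < dl] the
    difference is at most [2 F], and there one of the two quadratic terms is at least [2 F]. *)
Let bound_diff (f : R -> R) (X Y : Omega -> R) (F N dl e : R) :
  0 < N -> 0 < dl -> 0 <= e -> continuous f -> (forall x, `|f x| <= F) ->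
  (forall x y, `|x| <= N -> `|x - y| < dl -> `|f x - f y| < e) ->
  sqint P X -> sqint P Y ->
  `|\int[P]_w f (X w) - \int[P]_w f (Y w)| <=
  e + 2 * F / N ^+ 2 * \int[P]_w (X w ^+ 2) +
  2 * F / dl ^+ 2 * \int[P]_w ((X w - Y w) ^+ 2).
Proof.
move=> N0 dl0 e0 cf fF unif sX sY.
have F0 : 0 <= F by rewrite (le_trans _ (fF 0)).
have mf : measurable_fun setT f by exact: continuous_measurable_fun.
have if_ (Z : Omega -> R) : sqint P Z -> P.-integrable setT (EFin \o (fun w => f (Z w))).
  move=> sZ; apply: sqint_integrable; apply: (@bounded_sqint _ _ _ _ _ F) => //.
  exact: measurableT_comp mf (sqint_measurable sZ).
have sXY := sqintB sX sY.
have i1 : P.-integrable setT (EFin \o (fun=> e)) by exact: (sqint_integrable (sqint_cst P e)).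
have i2 := integrable_EFinZ (2 * F / N ^+ 2) (sqint_sqr sX).
have i3 := integrable_EFinZ (2 * F / dl ^+ 2) (sqint_sqr sXY).
have iD := integrable_EFinB (if_ _ sX) (if_ _ sY).
rewrite -RintegralB//; try exact: if_.
apply: (le_trans (le_normr_Rintegral _ iD)) => //.
have -> : e = \int[P]_w e by rewrite Rintegral_cst// [X in fine X](@probability_setT _ _ _ P) mulr1.
rewrite -!RintegralZl//; try exact: sqint_sqr.
rewrite -RintegralD// -RintegralD//; last exact: integrable_EFinD.
apply: le_Rintegral => //.
- exact: (integrable_norm iD).
- by apply: integrable_EFinD => //; exact: integrable_EFinD.
have q0 (a : R) : 0 <= 2 * F / a ^+ 2 by exact: divr_ge0 (mulr_ge0 (ler0n _ 2) F0) (sqr_ge0 a).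
move=> w _ /=.
have c1 : 0 <= 2 * F / N ^+ 2 * X w ^+ 2.
  by apply: mulr_ge0; [exact: q0|exact: sqr_ge0].
have c2 : 0 <= 2 * F / dl ^+ 2 * (X w - Y w) ^+ 2.
  by apply: mulr_ge0; [exact: q0|exact: sqr_ge0].
have b2 : `|f (X w) - f (Y w)| <= 2 * F.
  by rewrite (le_trans (ler_normB _ _))// mulr2n mulrDl mul1r lerD.
have big (a b : R) : 0 < a -> a <= `|b| -> 2 * F <= 2 * F / a ^+ 2 * b ^+ 2.
  move=> a0 ab; rewrite -mulrA ler_peMr ?mulr_ge0//.
  rewrite mulrC ler_pdivlMr ?exprn_gt0// mul1r -(real_normK (num_real b)).
  by rewrite lerXn2r ?nnegrE// ltW.
have [XN|XN] := leP `|X w| N; last by have := big _ _ N0 (ltW XN); lra.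
have [xy|xy] := ltP `|X w - Y w| dl; first by have := unif _ _ XN xy; lra.
by have := big _ _ dl0 xy; lra.
Qed.

(** Slutsky's theorem in [L2]: bounded second moments provide tightness, and the mean-square
    distance controls the event where the variables are far apart. *)
Lemma limit_distribution_close X Y (M : R) mu :
  (\forall r \near +oo, [/\ sqint P (X r), sqint P (Y r) &
     \int[P]_w (X r w ^+ 2) <= M]) ->
  \int[P]_w ((X r w - Y r w) ^+ 2) @[r --> +oo] --> 0 ->
  limit_distribution P X mu <-> limit_distribution P Y mu.
Proof.
move=> H XY.
suff D f : continuous f -> bounded_fun f ->
    \int[P]_w f (X r w) - \int[P]_w f (Y r w) @[r --> +oo] --> 0.
  have E f : continuous f -> bounded_fun f ->
    ('E_P[fun w => f (X r w)]%E @[r --> +oo] --> (\int[mu]_x (f x)%:E)%E) <->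
    ('E_P[fun w => f (Y r w)]%E @[r --> +oo] --> (\int[mu]_x (f x)%:E)%E).
    move=> cf bf; have mf : measurable_fun setT f by exact: continuous_measurable_fun.
    have [F FP] : exists F, forall x, `|f x| <= F.
      have [M0 [M0r]] := bf; move=> /(_ (M0 + 1)); rewrite ltrDl ltr01 => /(_ isT) h.
      by exists (M0 + 1) => x; exact: h.
    have fin (Z : Omega -> R) : sqint P Z -> 'E_P[fun w => f (Z w)]%E = (\int[P]_w f (Z w))%:E.
      move=> sZ; rewrite unlock /Rintegral fineK//.
      apply: integrable_fin_num => //; apply: sqint_integrable.
      apply: (@bounded_sqint _ _ _ _ _ F) => //.
      exact: measurableT_comp mf (sqint_measurable sZ).
    have lfin : (\int[mu]_x (f x)%:E)%E = (\int[mu]_x f x)%:E.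
      rewrite /Rintegral fineK//; apply: integrable_fin_num => //.
      by apply: (@sqint_integrable _ _ _ mu); apply: (@bounded_sqint _ _ _ _ _ F).
    rewrite lfin.
    have toR (Z : R -> Omega -> R) : (\forall r \near +oo, sqint P (Z r)) ->
        ('E_P[fun w => f (Z r w)]%E @[r --> +oo] --> (\int[mu]_x f x)%:E) <->
        (\int[P]_w f (Z r w) @[r --> +oo] --> \int[mu]_x f x).
      move=> sZ; split => [/fine_cvg|h].
        apply: cvg_trans; apply: near_eq_cvg; near=> r.
        by rewrite /= fin//; near: r.
      apply: cvg_EFin; first by near=> r; rewrite fin//; near: r.
      apply: cvg_trans h; apply: near_eq_cvg; near=> r.
      by rewrite /= fin//; near: r.
    have hX : \forall r \near +oo, sqint P (X r) by apply: filterS H => r [].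
    have hY : \forall r \near +oo, sqint P (Y r) by apply: filterS H => r [].
    rewrite (toR X hX) (toR Y hY); have d0 := D f cf bf; split => h.
      rewrite -[X in _ --> X]subr0; apply: (cvg_trans _ (cvgB h d0)).
      by apply: near_eq_cvg; near=> r; rewrite !fctE; ring.
    rewrite -[X in _ --> X]addr0; apply: (cvg_trans _ (cvgD h d0)).
    by apply: near_eq_cvg; near=> r; rewrite !fctE; ring.
  by split => h f cf bf; apply/(E f cf bf); exact: h.
move=> cf bf; have [F FP] : exists F, forall x, `|f x| <= F.
  have [M0 [M0r]] := bf; move=> /(_ (M0 + 1)); rewrite ltrDl ltr01 => /(_ isT) h.
  by exists (M0 + 1) => x; exact: h.
have F0 : 0 <= F by rewrite (le_trans _ (FP 0)).
have q0 (a : R) : 0 <= 2 * F / a ^+ 2 by exact: divr_ge0 (mulr_ge0 (ler0n _ 2) F0) (sqr_ge0 a).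
apply/cvgr0Pnorm_lt => e e0.
have e4 : 0 < e / 4 by rewrite divr_gt0.
(* Chosen so that [2 F |M| / N <= e / 4]; the summand 1 ensures [N <= N^2], so that the quadratic
   term obeys the same bound. *)
pose N := 1 + 8 * F * `|M| / e.
have N1 : 1 <= N by rewrite lerDl divr_ge0 ?(ltW e0)// !mulr_ge0.
have N0 : 0 < N by rewrite (lt_le_trans _ N1).
have [dl dl0 unif] := uniform_continuity_segment N cf e4.
have XYs : \forall r \near +oo, `|\int[P]_w ((X r w - Y r w) ^+ 2)| <
    e / 4 / (2 * F / dl ^+ 2 + 1).
  have den : 0 < 2 * F / dl ^+ 2 + 1 by rewrite ltr_wpDl.
  by have /cvgr0_norm_lt := XY; apply; rewrite divr_gt0.
near=> r; have [sX sY XM] : [/\ sqint P (X r), sqint P (Y r) &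
     \int[P]_w (X r w ^+ 2) <= M] by near: r.
apply: (le_lt_trans (bound_diff N0 dl0 (ltW e4) cf FP unif sX sY)).
have h1 : 2 * F / N ^+ 2 * \int[P]_w (X r w ^+ 2) <= e / 4.
  apply: (@le_trans _ _ (2 * F / N * `|M|)).
    apply: ler_pM => //; [exact: sqrL2_ge0| |exact: (le_trans XM (ler_norm M))].
    rewrite ler_wpM2l ?mulr_ge0// lef_pV2 ?posrE ?exprn_gt0//.
    by rewrite expr2 ler_peMl// ltW.
  rewrite mulrAC ler_pdivrMr// /N mulrDr mulr1 (_ : e / 4 * _ = 2 * F * `|M|);
    last by field; rewrite gt_eqF.
  by rewrite lerDr ltW.
have h2 : 2 * F / dl ^+ 2 * \int[P]_w ((X r w - Y r w) ^+ 2) <= e / 4.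
  have den : 0 < 2 * F / dl ^+ 2 + 1 by rewrite ltr_wpDl.
  have h : `|\int[P]_w ((X r w - Y r w) ^+ 2)| < e / 4 / (2 * F / dl ^+ 2 + 1) by near: r.
  have {}h := le_trans (ler_norm _) (ltW h).
  rewrite ler_pdivlMr// in h; apply: le_trans h.
  by rewrite mulrC ler_wpM2l ?sqrL2_ge0// lerDl.
move: h1 h2; set u := _ * \int[P]_w (X r w ^+ 2); set v := _ * \int[P]_w _; lra.
Unshelve. all: by end_near. Qed.

End slutsky.

(** * Energies of a covariance kernel *)

Lemma bounded_integrable_prod d1 d2 (T1 : measurableType d1) (T2 : measurableType d2)
    (R : realType) (m1 : {finite_measure set T1 -> \bar R})
    (m2 : {finite_measure set T2 -> \bar R}) (f : T1 * T2 -> R) (M : R) :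
  measurable_fun setT f -> (forall p, `|f p| <= M) ->
  (m1 \x m2)%E.-integrable setT (EFin \o f).
Proof.
move=> mf fM; have /measurable_EFinP mEf := mf.
apply/(integrable12ltyP m1 m2 mEf).
apply: (@le_lt_trans _ _ (\int[m1]_x \int[m2]_y `|M|%:E)%E).
  apply: ge0_le_integral => //.
  - by move=> x _; apply: integral_ge0.
  - apply: (@measurable_fun_fubini_tonelli_F _ _ _ _ _ m2 (fun p => `|(f p)%:E|%E)) => //.
    exact: measurableT_comp.
  - move=> x _; apply: ge0_le_integral => //.
    + by apply: measurableT_comp => //; apply/measurable_EFinP; exact: (measurable_fun_pair2 x mf).
    + by move=> y _; rewrite lee_fin (le_trans (fM _))// ler_norm.
under eq_integral do rewrite integral_cst//.
have fin1 : m1 setT \is a fin_num by exact: fin_num_measure.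
have fin2 : m2 setT \is a fin_num by exact: fin_num_measure.
rewrite integral_cst//.
by rewrite -ge0_fin_numE ?mule_ge0// !fin_numM.
Qed.

Section restricted_measure.
Context d (T : measurableType d) (R : realType) (mu : {measure set T -> \bar R}).
Variables (D : set T) (mD : measurable D) (muD : (mu D < +oo)%E).
Implicit Types f g : T -> R.
Local Notation m := (mfrestr mD muD).

Let mindic : measurable_fun setT (\1_D : T -> R).
Proof. exact: measurable_indic. Qed.

Let indic_pos (x : T) : 0 <= \1_D x :> R.
Proof. by rewrite indicE. Qed.

Let restr_density (A : set T) : measurable A ->
  m A = (\int[mu]_(x in A) (\1_D x)%:E)%E.
Proof. by move=> mA; rewrite integral_indic// setIC. Qed.

(** The Hausdorff measure to which this is applied is not sigma-finite on the whole space, whereas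
    its restriction to a surface is finite, as the use of Fubini's theorem requires. *)
Lemma Rintegral_mfrestr f : measurable_fun setT f ->
  \int[m]_x f x = \int[mu]_(x in D) f x.
Proof.
move=> mf; rewrite (Rintegral_density mindic indic_pos restr_density mf).
rewrite [RHS]Rintegral_mkcond; apply: eq_Rintegral => x _.
by rewrite patchE indicE; case: (x \in D); rewrite ?mulr1 ?mulr0.
Qed.

Lemma le_Rintegral_mfrestr f g : m.-integrable setT (EFin \o f) ->
  m.-integrable setT (EFin \o g) -> (forall x, D x -> f x <= g x) ->
  \int[m]_x f x <= \int[m]_x g x.
Proof.
move=> fi gi fg.
have mf : measurable_fun setT f by apply/measurable_EFinP; exact: measurable_int fi.
have mg : measurable_fun setT g by apply/measurable_EFinP; exact: measurable_int gi.
rewrite !(Rintegral_density mindic indic_pos restr_density)//.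
apply: le_Rintegral => //.
- exact: ((integrable_density mindic indic_pos restr_density mf).1 fi).
- exact: ((integrable_density mindic indic_pos restr_density mg).1 gi).
- move=> x _; rewrite indicE; case: (boolP (x \in D)) => [/set_mem Dx|_].
    by rewrite !mulr1 fg.
  by rewrite !mulr0.
Qed.

Variable c : T * T -> R.
Hypothesis mc : measurable_fun setT c.
Hypothesis c01 : forall p, 0 <= c p <= 1.

Definition kernel_energy (k : nat) : R := \int[m]_x \int[m]_y c (x, y) ^+ k.

Let total : R := fine (mu D).

Let totalE : fine (m setT) = total.
Proof. by rewrite /total /mfrestr /mrestr setTI. Qed.

Let mcx k x : measurable_fun setT (fun y => c (x, y) ^+ k).
Proof. by apply: measurable_funX; exact: (measurable_fun_pair2 x mc). Qed.

Let ck1 k p : `|c p ^+ k| <= 1.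
Proof.
have /andP[c0 c1] := c01 p.
by rewrite ger0_norm ?exprn_ge0// exprn_ile1.
Qed.

Let icx k x : m.-integrable setT (EFin \o (fun y => c (x, y) ^+ k)).
Proof. by apply/sqint_integrable/(@bounded_sqint _ _ _ _ _ 1). Qed.

Let iproduct k : (m \x m)%E.-integrable setT (EFin \o (fun p => c p ^+ k)).
Proof. by apply: (@bounded_integrable_prod _ _ _ _ _ _ _ _ 1) => //; exact: measurable_funX. Qed.

Let iinner k : m.-integrable setT (EFin \o (fun x => \int[m]_y c (x, y) ^+ k)).
Proof. by have [] := integrable_Rintegral1 (iproduct k). Qed.

Let icst (a : R) : m.-integrable setT (EFin \o (fun=> a)).
Proof. exact: (sqint_integrable (sqint_cst m a)). Qed.

Let iind (A : set T) : measurable A -> m.-integrable setT (EFin \o (\1_A : T -> R)).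
Proof. by move=> mA; exact: integrable_indic. Qed.

Variables (N : T -> set T) (b : R).
Hypothesis mN : forall x, measurable (N x).
Hypothesis Nb : forall x, D x -> fine (mu (D `&` N x)) <= b.

Let near_mass x : D x -> \int[m]_y (\1_(N x) y : R) <= b.
Proof.
move=> Dx; have := Nb Dx.
by rewrite /Rintegral integral_indic// setIT /mfrestr /mrestr setIC.
Qed.

(** For fixed [x], the points [y] in [N x] contribute at most their mass since [c <= 1]; elsewhere
    one factor [c] is replaced by [q]. *)
Lemma kernel_energyS_le k q : 0 <= q ->
  (forall x y, D x -> D y -> ~ N x y -> c (x, y) <= q) ->
  kernel_energy k.+1 <= b * fine (mu D) + q * kernel_energy k.
Proof.
move=> q0 H.
have ib : m.-integrable setT (EFin \o (fun x => b + q * \int[m]_y c (x, y) ^+ k)).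
  by apply: integrable_EFinD => //; exact: integrable_EFinZ.
apply: (@le_trans _ _ (\int[m]_x (b + q * \int[m]_y c (x, y) ^+ k))).
  apply: le_Rintegral_mfrestr => // x Dx.
  have iq : m.-integrable setT (EFin \o (fun y => q * c (x, y) ^+ k)) by exact: integrable_EFinZ.
  apply: (@le_trans _ _ (\int[m]_y (\1_(N x) y + q * c (x, y) ^+ k))).
    apply: le_Rintegral_mfrestr => //; first by apply: integrable_EFinD => //; exact: iind.
    move=> y Dy; have /andP[c0 c1] := c01 (x, y); rewrite indicE.
    case: (boolP (y \in N x)) => [_|/negP nN].
      by rewrite (le_trans (ler_norm _))// (le_trans (ck1 _ _))// lerDl mulr_ge0// exprn_ge0.
    rewrite add0r exprS ler_wpM2r ?exprn_ge0// H// => Ny; apply: nN; exact: mem_set.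
  rewrite RintegralD//; last exact: iind.
  by rewrite RintegralZl// lerD2r near_mass.
rewrite RintegralD//; last exact: integrable_EFinZ.
by rewrite RintegralZl// Rintegral_cst// -/total -totalE.
Qed.

(** Nonnegativity of [c] allows the pairs with [y] in [N x] to be discarded, at the price of mass at
    most [b] for each [x]. *)
Lemma kernel_energy_ge k q : 0 <= q ->
  (forall x y, D x -> D y -> ~ N x y -> q <= c (x, y) ^+ k) ->
  q * (fine (mu D) * (fine (mu D) - b)) <= kernel_energy k.
Proof.
move=> q0 H; rewrite -/total -totalE.
have i1 x : m.-integrable setT (EFin \o (fun y => 1 - \1_(N x) y : R)).
  by apply: integrable_EFinB => //; exact: iind.
apply: (@le_trans _ _ (\int[m]_x (q * (fine (m setT) - b)))).
  by rewrite Rintegral_cst//; lra.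
apply: le_Rintegral_mfrestr => // x Dx.
apply: (@le_trans _ _ (\int[m]_y (q * (1 - \1_(N x) y)))).
  rewrite RintegralZl// ler_wpM2l// RintegralB//; last exact: iind.
  by rewrite Rintegral_cst// mul1r lerD2l lerN2 near_mass.
apply: le_Rintegral_mfrestr => //; first exact: integrable_EFinZ.
move=> y Dy; have /andP[c0 c1] := c01 (x, y); rewrite indicE.
case: (boolP (y \in N x)) => [_|/negP nN].
  by rewrite subrr mulr0 exprn_ge0.
by rewrite subr0 mulr1 H// => Ny; apply: nN; exact: mem_set.
Qed.

End restricted_measure.

(** * Ahlfors-David regular surfaces *)

Section regular_surface.
Context {R : realType} {d : nat}.
Implicit Types (S A : set 'rV[R]_d) (x y : 'rV[R]_d).

Lemma enorm_continuous : continuous (@enorm R d).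
Proof.
move=> x; apply: (@continuous_comp _ _ _ (fun x : 'rV[R]_d => dotp x x) Num.sqrt);
  last exact: sqrt_continuous.
have -> : (fun x : 'rV[R]_d => dotp x x) =
    \sum_(i < d) (fun x : 'rV[R]_d => x ord0 i * x ord0 i).
  by apply/funext => y; rewrite fct_sumE.
elim/big_ind : _ => [|f g cf cg|i _].
- exact: cst_continuous.
- exact: continuousD.
- by apply: continuousM; exact: coord_continuous.
Qed.

Lemma closed_eball x (s : R) : closed (eball x s).
Proof.
have -> : eball x s = (fun y => enorm (y - x)) @^-1` [set t | t <= s] by [].
apply: preimage_closed; last exact: closed_le.
move=> y _; apply: continuous_comp; last exact: enorm_continuous.
by apply: continuousB; [exact: id|exact: cst_continuous].
Qed.

Lemma compact_enorm_bounded S : compact S -> exists M : R, forall x, S x -> enorm x <= M.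
Proof.
move=> cS; have /compact_bounded[N [_ NS]] :=
  continuous_compact (continuous_subspaceT enorm_continuous) cS.
exists (N + 1) => x Sx; have := NS (N + 1).
rewrite ltrDl ltr01 => /(_ isT (enorm x)) /=.
by move=> /(_ (ex_intro2 _ _ x Sx erefl)); rewrite ger0_norm// enorm_ge0.
Qed.

Local Notation sigma := (@hausdorff_measure R d d.-1).

(** [D] is the diameter, finite by compactness and positive because the measure is. A ball of radius
    [D] about a point of [S] contains [S], so the upper regularity bound also yields finiteness of
    the measure. *)
Lemma regular_surface_bounds S : (2 <= d)%N -> compact S -> (0 < sigma S)%E ->
  ahlfors_david_regular S ->
  exists D C : R, [/\ 0 < D, 0 < C, (sigma S < +oo)%E,
    forall x y, S x -> S y -> enorm (x - y) <= D &
    forall x s, S x -> 0 < s -> s <= D -> (sigma (S `&` eball x s) <= (C * s ^+ d.-1)%:E)%E].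
Proof.
move=> d2 cS S0 [C [C0 ball]]; have [M SM] := compact_enorm_bounded cS.
have d10 : (0 < d.-1)%N by case: d d2 => [|[]].
have [x0 Sx0] : S !=set0.
  by apply/set0P/negP => /eqP SE; move: S0; rewrite SE measure0 ltxx.
have Dfin : (ediam S < +oo)%E.
  apply: (@le_lt_trans _ _ (M + M)%:E); last by rewrite ltry.
  apply: ge_ereal_sup => _ [[x y] [/= Sx Sy] <-]; rewrite lee_fin.
  by rewrite (le_trans (enormD _ _))// enormN lerD// SM.
have Dge0 : (0 <= ediam S)%E by apply: ediam_ge0; exists x0.
have DE : ediam S = (fine (ediam S))%:E by rewrite fineK// ge0_fin_numE.
have D0 : 0 < fine (ediam S).
  rewrite lt_neqAle fine_ge0// andbT; apply/eqP => e0; move: S0.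
  rewrite (@hausdorff_measure_subsingleton R d d.-1 S)// ?ltxx// => x y Sx Sy.
  apply/eqP; rewrite -subr_eq0 -enorm_eq0 eq_le enorm_ge0 andbT.
  by have := le_ediam Sx Sy; rewrite DE -e0 lee_fin.
have dist x y : S x -> S y -> enorm (x - y) <= fine (ediam S).
  by move=> Sx Sy; rewrite -lee_fin -DE; exact: le_ediam.
have ball_le x s : S x -> 0 < s -> s <= fine (ediam S) ->
    (sigma (S `&` eball x s) < (C * s ^+ d.-1)%:E)%E.
  move=> Sx s0 sD; have sE : (s%:E <= ediam S)%E by rewrite DE lee_fin.
  by have /andP[] := ball x s Sx s0 sE.
exists (fine (ediam S)), C; split => //; last by move=> *; exact/ltW/ball_le.
have := ball_le x0 _ Sx0 D0 (lexx _).
have -> : S `&` eball x0 (fine (ediam S)) = S.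
  by apply/seteqP; split => [x []//|x Sx]; split => //; exact: dist.
by move=> /lt_trans; apply; rewrite ltry.
Qed.

Lemma dilate_eball (r : R) x (s : R) S : 0 < r ->
  dilate r S `&` eball (r *: x) s = dilate r (S `&` eball x (s / r)).
Proof.
move=> r0; apply/seteqP; split.
  move=> _ [[y Sy <-]]; rewrite /eball /= -scalerBr (enormZ _ (ltW r0)) => ys.
  by exists y => //; split => //; rewrite /= ler_pdivlMr// mulrC.
move=> x0 [y [Sy +] <-]; rewrite /eball /= ler_pdivlMr// => ys.
by split; [exists y|rewrite /= -scalerBr (enormZ _ (ltW r0)) mulrC].
Qed.

(** A ball of radius [s] on the dilate comes from one of radius [s / r], and measures scale by
    [r^(d-1)]: the powers of [r] cancel and the same [C] serves all [r]. *)
Lemma regular_dilated_bounds S : (2 <= d)%N -> compact S -> (0 < sigma S)%E ->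
  ahlfors_david_regular S ->
  exists D C M : R, [/\ 0 < D, 0 < C, 0 < M & forall r : R, 0 < r ->
   [/\ closed (dilate r S), sigma (dilate r S) = (r ^+ d.-1 * M)%:E,
    forall x y, dilate r S x -> dilate r S y -> enorm (x - y) <= r * D &
    forall x s, dilate r S x -> 0 < s -> s <= r * D ->
      (sigma (dilate r S `&` eball x s) <= (C * s ^+ d.-1)%:E)%E]].
Proof.
move=> d2 cS S0 aS; have [D [C [D0 C0 Sfin dist ball]]] := regular_surface_bounds d2 cS S0 aS.
have SE : sigma S = (fine (sigma S))%:E by rewrite fineK// ge0_fin_numE.
exists D, C, (fine (sigma S)); split => //; first by rewrite fine_gt0// S0.
move=> r r0; split.
- rewrite dilateE ?gt_eqF//; apply: preimage_closed => [y _|]; first exact: continuous_scale.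
  by apply: compact_closed => //; exact: norm_hausdorff.
- by rewrite hausdorff_measure_dilate// SE.
- move=> _ _ [x Sx <-] [y Sy <-]; rewrite -scalerBr (enormZ _ (ltW r0)).
  by rewrite ler_pM2l// dist.
- move=> _ s [x Sx <-] s0 sD; rewrite dilate_eball// hausdorff_measure_dilate//.
  apply: (@le_trans _ _ ((r ^+ d.-1)%:E * (C * (s / r) ^+ d.-1)%:E)%E).
    rewrite lee_pmul2l ?lte_fin ?exprn_gt0//; apply: ball => //.
    - by rewrite divr_gt0.
    - by rewrite ler_pdivrMr// mulrC.
  rewrite -EFinM lee_fin mulrCA -exprMn mulrC [r * _]mulrC divfK ?gt_eqF//.
  by rewrite mulrC.
Qed.

End regular_surface.

(** * Gaussian fields *)

(** By polarization the covariance is half of [E (Z_x + Z_y)^2] minus the common second moment, and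
    Tonelli's theorem makes the integral of a nonnegative function measurable in its parameters. *)
Lemma measurable_cov d1 d2 (T : measurableType d1) (Omega : measurableType d2)
    (R : realType) (P : probability Omega R) (Z : T -> Omega -> R) (V : R) :
  measurable_fun setT (fun p : T * Omega => Z p.1 p.2) ->
  (forall x, sqint P (Z x)) -> (forall x, \int[P]_w (Z x w ^+ 2) = V) ->
  measurable_fun setT (fun p : T * T => \int[P]_w (Z p.1 w * Z p.2 w)).
Proof.
move=> mZ sZ Z1.
have polar p : \int[P]_w (Z p.1 w * Z p.2 w) =
    fine (\int[P]_w ((Z p.1 w + Z p.2 w) ^+ 2)%:E) / 2 - V.
  rewrite -/(Rintegral P setT (fun w => (Z p.1 w + Z p.2 w) ^+ 2)).
  have := sqrL2_lincomb 1 1 (sZ p.1) (sZ p.2); rewrite !Z1.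
  by under eq_Rintegral do rewrite !mul1r; move=> ->; lra.
under eq_fun do rewrite polar.
apply: measurable_funB => //; apply: measurable_funM => //.
apply: measurableT_comp => //.
apply: (measurable_fun_fubini_tonelli_F
  (fun q : (T * T) * Omega => ((Z q.1.1 q.2 + Z q.1.2 q.2) ^+ 2)%:E)); last first.
  by move=> q; rewrite lee_fin sqr_ge0.
apply/measurable_EFinP; apply: measurable_funX; apply: measurable_funD.
- have m1 : measurable_fun setT (fun q : (T * T) * Omega => (q.1.1, q.2)).
    apply: measurable_fun_pair => //.
    exact: (measurableT_comp measurable_fst measurable_fst).
  exact: (measurableT_comp mZ m1).
- have m2 : measurable_fun setT (fun q : (T * T) * Omega => (q.1.2, q.2)).
    apply: measurable_fun_pair => //.
    exact: (measurableT_comp measurable_snd measurable_fst).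
  exact: (measurableT_comp mZ m2).
Qed.

Section gaussian_fields.
Context {R : realType} {d : nat} {disp : measure_display} {Omega : measurableType disp}.
Variables (P : probability Omega R) (eta : 'rV[R]_d -> Omega -> R).
Hypothesis eta_measurable : measurable_field eta.
Hypothesis eta_gaussian : gaussian_field P eta.
Hypothesis eta_centered : forall x, 'E_P[eta x]%E = 0%E.

Lemma field_measurable (x : 'rV[R]_d) : measurable_fun setT (eta x).
Proof.
have -> : eta x = (fun p : borelV R d * Omega => eta p.1 p.2) \o (fun w => (x : borelV R d, w)).
  by [].
by apply: measurableT_comp; [exact: eta_measurable|exact: pair1_measurable].
Qed.

Lemma field_linear (x y : 'rV[R]_d) a b : gaussian_variable P (fun w => a * eta x w + b * eta y w).
Proof.
have [m [s H]] := eta_gaussian (fun i : 'I_2 => if i == ord0 then a else b)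
  (fun i : 'I_2 => if i == ord0 then x else y).
exists m, s => A mA; rewrite -H//; congr (P (_ @^-1` A)).
by apply/funext => w; rewrite big_ord_recl big_ord1.
Qed.

Lemma field_gaussian (x : 'rV[R]_d) : gaussian_variable P (eta x).
Proof.
have [m [s H]] := field_linear x x 1 0; exists m, s => A mA; rewrite -H//.
by congr (P (_ @^-1` A)); apply/funext => w; rewrite mul1r mul0r addr0.
Qed.

Lemma field_sqint (x : 'rV[R]_d) : sqint P (eta x).
Proof.
split; first exact: field_measurable.
have := gaussian_variable_integrable (field_measurable x) (field_gaussian x)
  (@exp_dominated_horner R ('X ^+ 2)).
by congr (_.-integrable _ _); apply/funext => w /=; rewrite hornerXn.
Qed.

Definition field_cov (p : 'rV[R]_d * 'rV[R]_d) : R := \int[P]_w (eta p.1 w * eta p.2 w).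

Lemma field_mean x : \int[P]_w eta x w = 0.
Proof. by have := eta_centered x; rewrite unlock /Rintegral => ->. Qed.

Lemma field_covarianceE x y : covariance P (eta x) (eta y) = (field_cov (x, y))%:E.
Proof.
have i := sqint_mul (field_sqint x) (field_sqint y).
rewrite unlock !eta_centered /= unlock fineK ?(integrable_fin_num _ i)//.
by apply: eq_integral => w _; rewrite fctE /= !subr0.
Qed.

Lemma covariance_functionE x : covariance_function P eta x = (field_cov (0, x))%:E.
Proof.
rewrite /covariance_function unlock fineK//.
exact: (integrable_fin_num _ (sqint_mul (field_sqint 0) (field_sqint x))).
Qed.

Hypothesis eta_homogeneous : homogeneous_field P eta.

Lemma field_cov_shift x y : field_cov (x, y) = field_cov (0, y - x).
Proof.
apply: EFin_inj; rewrite -!field_covarianceE.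
have [_] := eta_homogeneous 0 (y - x) x.
by rewrite add0r subrK.
Qed.

Hypothesis cov0 : covariance_function P eta 0 = 1%E.

Lemma field_cov_diag x : field_cov (x, x) = 1.
Proof.
by apply: EFin_inj; rewrite field_cov_shift subrr -covariance_functionE.
Qed.

Lemma field_var x : \int[P]_w (eta x w ^+ 2) = 1.
Proof. by rewrite -(field_cov_diag x) /field_cov /=; under eq_Rintegral do rewrite expr2. Qed.

Lemma field_gaussian_pair x y : gaussian_pair P (eta x) (eta y) (field_cov (x, y)).
Proof.
split => //; [exact: field_measurable|exact: field_measurable|exact: field_linear|
  exact: field_mean|exact: field_mean|exact: field_var|exact: field_var].
Qed.

Variable f : R -> R.
Hypothesis f_gt0 : forall t, 0 < t -> 0 < f t.
Hypothesis cov : forall x, x != 0 -> covariance_function P eta x = (f (enorm x))%:E.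

Lemma field_cov_neq x y : x != y -> field_cov (x, y) = f (enorm (x - y)).
Proof.
move=> xy; apply: EFin_inj.
by rewrite field_cov_shift -covariance_functionE cov ?subr_eq0 1?eq_sym// -[y - x]opprB enormN.
Qed.

(** The lower bound comes from the positivity of [f], the upper one from Cauchy-Schwarz at variance
    1. In this range the powers [rho^j] decrease in [j]. *)
Lemma field_cov01 p : 0 <= field_cov p <= 1.
Proof.
case: p => x y; apply/andP; split.
  have [->|xy] := eqVneq x y; first by rewrite field_cov_diag.
  by rewrite field_cov_neq// ltW// f_gt0// lt_neqAle enorm_ge0 eq_sym enorm_eq0 subr_eq0 xy.
have := cauchy_schwarz_L2 (field_sqint x) (field_sqint y); rewrite !field_var mul1r.
rewrite -/(field_cov (x, y)) => c1.
by rewrite leNgt; apply/negP => lt1; move: c1; rewrite leNgt expr_gt1 ?lt1// ltW// (lt_trans _ lt1).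
Qed.

End gaussian_fields.

Lemma variance_centered d (T : measurableType d) (R : realType) (P : probability T R)
    (X : T -> R) : \int[P]_w X w = 0 -> fine 'V_P[X]%E = \int[P]_w (X w ^+ 2).
Proof.
move=> X0; have E0 : fine 'E_P[X]%E = 0 by rewrite unlock.
rewrite /variance unlock E0 unlock /Rintegral; congr fine.
by apply: eq_integral => w _; rewrite fctE /= !subr0 expr2.
Qed.

(** * Hermite coefficients and second moments of integrated functions of a Gaussian field *)

Section hermite_L2.
Context d (T : measurableType d) (R : realType) (P : probability T R).
Local Notation gam := (@normal_prob R 0 1).

(** The pair supplies a standard Gaussian variable [Y], along which [hermite_cov] at correlation 1
    is transferred to the Gaussian measure. *)
Lemma hermite_orthogonal (X Y : T -> R) rho j k : gaussian_pair P X Y rho ->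
  \int[gam]_x ((hermite j).[x] * (hermite k).[x]) = if j == k then k`!%:R else 0.
Proof.
move=> /gaussian_pair_diag YY; have := hermite_cov YY j k.
rewrite expr1n mulr1 => <-.
rewrite -(@Rintegral_law _ _ _ (measurableTypeR R) R P gam Y (gp_measurable1 YY) (gaussian_pair_law YY)
  (fun x => (hermite j).[x] * (hermite k).[x]))//.
by apply: sqint_mul; apply: exp_dominated_sqint; exact: exp_dominated_horner.
Qed.

End hermite_L2.

Section gaussian_L2.
Context {R : realType}.
Local Notation gam := (@normal_prob R 0 1).
Implicit Types G : R -> R.

Lemma gaussian_L2_sqint G : gaussian_L2 G -> sqint gam G.
Proof.
move=> [mG iG]; split => //; apply/integrable_normal_prob; first exact: measurable_funX.
apply/integrableP; split.
  apply/measurable_EFinP; apply: measurable_funM; first exact: measurable_funX.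
  exact: measurable_normal_pdf.
apply: le_lt_trans iG; apply: ge0_le_integral => //.
- apply: measurableT_comp => //; apply/measurable_EFinP; apply: measurable_funM.
    exact: measurable_funX.
  exact: measurable_normal_pdf.
- apply/measurable_EFinP; apply: measurable_funM; first exact: measurable_funX.
  exact: measurable_normal_pdf.
- by move=> x _; rewrite /= lee_fin ger0_norm// mulr_ge0 ?sqr_ge0 ?normal_pdf_ge0.
Qed.

Lemma hermite_coefE G j : measurable_fun setT G ->
  hermite_coef G j = \int[gam]_x (G x * (hermite j).[x]).
Proof.
move=> mG; rewrite Rintegral_normal_prob//; apply: measurable_funM => //.
exact: (exp_dominated_horner _).1.
Qed.

End gaussian_L2.

Section integrated_field.
Context d1 d2 (T : measurableType d1) (Omega : measurableType d2) (R : realType).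
Variables (m : {finite_measure set T -> \bar R}) (P : probability Omega R).
Variable Z : T -> Omega -> R.
Hypothesis mZ : measurable_fun setT (fun p : T * Omega => Z p.1 p.2).
Let c (p : T * T) : R := \int[P]_w (Z p.1 w * Z p.2 w).
Hypothesis Zpair : forall x y, gaussian_pair P (Z x) (Z y) (c (x, y)).
Hypothesis c01 : forall p, 0 <= c p <= 1.
Local Notation gam := (@normal_prob R 0 1).
Implicit Types F G : R -> R.

Let mZx x : measurable_fun setT (Z x). Proof. exact: gp_measurable1 (Zpair x x). Qed.

Let Zlaw x A : measurable A -> P (Z x @^-1` A) = gam A.
Proof. exact: gaussian_pair_law (Zpair x x) A. Qed.
Let sF F x : sqint gam F -> sqint P (fun w => F (Z x w)).
Proof. exact: (@sqint_law _ _ _ (measurableTypeR R) R P gam (Z x) (mZx x) (@Zlaw x)). Qed.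

Let EF F x : gam.-integrable setT (EFin \o F) -> \int[P]_w F (Z x w) = \int[gam]_x F x.
Proof. exact: (@Rintegral_law _ _ _ (measurableTypeR R) R P gam (Z x) (mZx x) (@Zlaw x)). Qed.

Let mF F : sqint gam F -> measurable_fun setT (fun p : T * Omega => F (Z p.1 p.2)).
Proof. by move=> [mF _]; exact: (measurableT_comp mF mZ). Qed.

Let VF F x : sqint gam F -> \int[P]_w (F (Z x w) ^+ 2) = \int[gam]_x (F x ^+ 2).
Proof. by move=> [_ iF]; exact: (EF x iF). Qed.

Let VF_le F : sqint gam F -> forall x, \int[P]_w (F (Z x w) ^+ 2) <= \int[gam]_x (F x ^+ 2).
Proof. by move=> hF x; rewrite VF. Qed.

Lemma measurable_gaussian_cov : measurable_fun setT c.
Proof.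
apply: (measurable_cov mZ (V := 1)) => x; last exact: gp_var1 (Zpair x x).
have := sF x (exp_dominated_sqint (@exp_dominated_horner R 'X)).
by apply: sqint_eq => w; rewrite hornerX.
Qed.

Lemma integrated_sqint F : sqint gam F -> sqint P (fun w => \int[m]_x F (Z x w)).
Proof.
move=> hF; exact: (@sqint_integrated _ _ _ _ _ m P (fun x w => F (Z x w))
  (\int[gam]_x (F x ^+ 2)) (mF hF) (fun x => sF x hF) (VF_le hF)).
Qed.

Lemma integrated_mean F : sqint gam F -> \int[gam]_x F x = 0 ->
  \int[P]_w \int[m]_x F (Z x w) = 0.
Proof.
move=> hF F0; rewrite (Rintegral_integrated m (Z := fun x w => F (Z x w))
  (mF hF) (fun x => sF x hF) (VF_le hF)).
have EF0 x : \int[P]_w F (Z x w) = 0.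
  by rewrite EF ?F0//; exact: (sqint_integrable hF).
by under eq_Rintegral do rewrite EF0; rewrite Rintegral_cst// mul0r.
Qed.

(** [gaussian_cov_bound] at each pair [(x, y)], integrated over pairs; boundedness of both kernels
    turns the iterated integrals into integrals on the product, where they can be compared. *)
Lemma integrated_sqr_le F k : sqint gam F ->
  (forall j, (j <= k)%N -> \int[gam]_x (F x * (hermite j).[x]) = 0) ->
  \int[P]_w ((\int[m]_x F (Z x w)) ^+ 2) <=
  \int[gam]_x (F x ^+ 2) * \int[m]_x \int[m]_y c (x, y) ^+ k.+1.
Proof.
move=> hF Fk; rewrite (sqr_integrated m (Z := fun x w => F (Z x w))
  (mF hF) (fun x => sF x hF) (VF_le hF)).
set V := \int[gam]_x (F x ^+ 2).
have bound p : `|\int[P]_w (F (Z p.1 w) * F (Z p.2 w))| <= c p ^+ k.+1 * V.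
  by case: p => x y; exact: (gaussian_cov_bound (Zpair x y)).
have V0 : 0 <= V by exact: sqrL2_ge0.
have c1 p : `|c p ^+ k.+1| <= 1.
  by have /andP[? ?] := c01 p; rewrite ger0_norm ?exprn_ge0// exprn_ile1.
have mck : measurable_fun setT (fun p => c p ^+ k.+1)
  by apply: measurable_funX; exact: measurable_gaussian_cov.
have ick := bounded_integrable_prod m m mck c1.
have mFF : measurable_fun setT (fun p : T * T => \int[P]_w (F (Z p.1 w) * F (Z p.2 w))).
  exact: (measurable_cov (Z := fun x w => F (Z x w)) (mF hF) (fun x => sF x hF) (fun x => VF x hF)).
have bFF p : `|\int[P]_w (F (Z p.1 w) * F (Z p.2 w))| <= V.
  rewrite (le_trans (bound p))// ler_piMl//.
  by have := c1 p; apply: le_trans; exact: ler_norm.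
have iFF := bounded_integrable_prod m m mFF bFF.
rewrite (integrable_Rintegral1 iFF).2 (integrable_Rintegral1 ick).2.
rewrite -RintegralZl//; apply: le_Rintegral => //; first exact: integrable_EFinZ.
by move=> p _; rewrite mulrC (le_trans (ler_norm _)).
Qed.

Lemma integrated_hermite_sqr k :
  \int[P]_w ((\int[m]_x (hermite k).[Z x w]) ^+ 2) =
  k`!%:R * \int[m]_x \int[m]_y c (x, y) ^+ k.
Proof.
have hk := exp_dominated_sqint (@exp_dominated_horner R (hermite k)).
rewrite (sqr_integrated m (Z := fun x w => (hermite k).[Z x w]) (mF hk) (fun x => sF x hk) (VF_le hk)).
have c1 p : `|c p ^+ k| <= 1.
  by have /andP[? ?] := c01 p; rewrite ger0_norm ?exprn_ge0// exprn_ile1.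
have mck : measurable_fun setT (fun p => c p ^+ k)
  by apply: measurable_funX; exact: measurable_gaussian_cov.
have ick := bounded_integrable_prod m m mck c1.
rewrite -RintegralZl//; last exact: (integrable_Rintegral1 ick).1.
apply: eq_Rintegral => x _; rewrite -RintegralZl//.
  by apply: eq_Rintegral => y _; exact: gaussian_pair_hermite (Zpair x y) k.
apply/sqint_integrable/(@bounded_sqint _ _ _ _ _ 1) => //.
exact: (measurable_fun_pair2 x mck).
Qed.

(* The integrals over [T] need only exist for almost every [w], whence an
   identity of second moments rather than of functions. *)
Lemma integrated_sub_sqr F G a : sqint gam F -> sqint gam G ->
  \int[P]_w ((\int[m]_x F (Z x w) - a * \int[m]_x G (Z x w)) ^+ 2) =
  \int[P]_w ((\int[m]_x (F (Z x w) - a * G (Z x w))) ^+ 2).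
Proof.
move=> hF hG; have hFG := sqintB hF (sqintZ a hG).
have sK := integrated_sqint hF; have sL := sqintZ a (integrated_sqint hG).
have sKL := integrated_sqint hFG.
congr fine; apply: ae_eq_integral => //.
- exact/measurable_EFinP/measurable_funX/measurable_funB/sL.1/sK.1.
- exact/measurable_EFinP/measurable_funX/sKL.1.
have hwF := @ae_sqint _ _ _ _ _ m P (fun x w => F (Z x w)) _ (mF hF) (fun x => sF x hF) (VF_le hF).
have hwG := @ae_sqint _ _ _ _ _ m P (fun x w => G (Z x w)) _ (mF hG) (fun x => sF x hG) (VF_le hG).
move: hwF hwG; apply: filterS2 => w sFw sGw _ /=.
rewrite RintegralB ?RintegralZl//; try exact: sqint_integrable.
exact: (sqint_integrable (sqintZ a sGw)).
Qed.

End integrated_field.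

(** * Asymptotics of the energies *)

Section energy_asymptotics.
Context {R : realType}.

Lemma powR_unbounded (g B : R) : 0 < g -> exists T, 0 < T /\ forall t, T <= t -> B <= t `^ g.
Proof.
move=> g0; pose B' := Num.max B 1; have B'1 : 1 <= B' by rewrite le_max lexx orbT.
have B'0 : 0 < B' by exact: lt_le_trans B'1.
exists (B' `^ g^-1); split; first exact: powR_gt0.
move=> t Tt; apply: (@le_trans _ _ B'); first by rewrite le_max lexx.
rewrite -[leLHS](powRr1 (ltW B'0)) -(mulVf (lt0r_neq0 g0)) powRrM.
apply: (ge0_ler_powR (ltW g0)) => //; rewrite nnegrE ?powR_ge0//.
exact: le_trans (powR_ge0 _ _) Tt.
Qed.

Variables (n k : nat) (alpha : R) (L : R -> R).
Hypotheses (k0 : (0 < k)%N) (alpha0 : 0 < alpha) (alphan : alpha * k%:R < n%:R).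
Hypothesis Lsv : slowly_varying L.
Let f t := t `^ (- alpha) * L t.

(** Granting the slowly varying factor the growth [t^(alpha / 2)] still leaves the decay
    [t^(- alpha / 2)]. *)
Lemma regular_variation_small e : 0 < e -> exists A, 0 < A /\ forall t, A < t -> f t <= e.
Proof.
move=> e0; have [T [C [T0 C0 H]]] := slowly_varying_growth Lsv (divr_gt0 alpha0 (ltr0Sn R 1)).
have [A [A0 HA]] := powR_unbounded (C / e) (divr_gt0 alpha0 (ltr0Sn R 1)).
exists (Num.max A T); split; first by rewrite lt_max A0.
move=> t; rewrite gt_max => /andP[At Tt]; have t0 := lt_trans A0 At.
have /andP[_ LC] := H t (ltW Tt).
apply: (@le_trans _ _ (t `^ (- alpha) * (C * t `^ (alpha / 2)))).
  by rewrite ler_wpM2l ?powR_ge0.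
have -> : t `^ (- alpha) * (C * t `^ (alpha / 2)) = C / t `^ (alpha / 2).
  rewrite mulrCA -powRD ?(gt_eqF t0) ?implybT//.
  by rewrite -powRN; congr (_ * _ `^ _); lra.
by rewrite ler_pdivrMr ?powR_gt0// -ler_pdivrMl// mulrC HA// ltW.
Qed.

Lemma regular_variation_large B :
  exists T, 0 < T /\ forall t, T < t -> B <= t ^+ n * f t ^+ k.
Proof.
(* Half of the spare exponent [n - alpha k] is ceded to the [k] slowly varying factors, [e] to each;
   the other half still forces growth. *)
pose e := (n%:R - alpha * k%:R) / (2 * k%:R).
have kR : 0 < k%:R :> R by rewrite ltr0n.
have e0 : 0 < e by rewrite divr_gt0 ?mulr_gt0// subr_gt0.
have [T [C [T0 C0 H]]] := slowly_varying_growth Lsv e0.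
have g0 : 0 < (n%:R - alpha * k%:R) / 2 by rewrite divr_gt0// subr_gt0.
have [A [A0 HA]] := powR_unbounded (B * C ^+ k) g0.
exists (Num.max A T); split; first by rewrite lt_max A0.
move=> t; rewrite gt_max => /andP[At Tt]; have t0 := lt_trans A0 At.
have /andP[LC _] := H t (ltW Tt).
have fge : C^-1 * t `^ (- alpha - e) <= f t.
  apply: le_trans (ler_wpM2l (powR_ge0 t (- alpha)) LC).
  by rewrite mulrCA -powRD ?(gt_eqF t0) ?implybT.
have : t ^+ n * (C^-1 * t `^ (- alpha - e)) ^+ k <= t ^+ n * f t ^+ k.
  have l0 : 0 <= C^-1 * t `^ (- alpha - e) by rewrite mulr_ge0 ?powR_ge0// invr_ge0 ltW.
  apply: ler_wpM2l; first exact/exprn_ge0/ltW.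
  by apply: lerXn2r; rewrite ?nnegrE// (le_trans l0).
apply: le_trans.
rewrite exprMn -(powR_mulrn k (powR_ge0 t _)) -powRrM -(powR_mulrn n (ltW t0)).
rewrite mulrCA -powRD ?(gt_eqF t0) ?implybT//.
rewrite (_ : n%:R + _ = (n%:R - alpha * k%:R) / 2); last by rewrite /e; field; rewrite gt_eqF.
by rewrite exprVn ler_pdivlMl ?exprn_gt0// mulrC HA// ltW.
Qed.

Variables (D C M : R) (J0 J1 : R -> R).
Hypotheses (D0 : 0 < D) (C0 : 0 < C) (M0 : 0 < M).
(** The surface at scale [r] enters through its measure [r^n M], the diameter bound [r D], and the
    bound [C A^n] on the measure of its intersection with balls of radius [A]. *)
Hypothesis upper : forall r A q, 0 < r -> 0 < A -> A <= r * D -> 0 <= q ->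
  (forall t, A < t -> t <= r * D -> f t <= q) ->
  J1 r <= C * A ^+ n * (r ^+ n * M) + q * J0 r.
Hypothesis lower : forall r A q, 0 < r -> 0 < A -> A <= r * D -> 0 <= q ->
  (forall t, A < t -> t <= r * D -> q <= f t ^+ k) ->
  q * (r ^+ n * M * (r ^+ n * M - C * A ^+ n)) <= J0 r.

(* [A] is chosen so that [f <= e / 2] beyond [A]. The lower bound is used with
   [A := T], where [T] makes [t^n f(t)^k] larger than a constant [B] large enough
   for [J0 r] to dominate the contribution of the balls of radius [A]. *)
Lemma energy_ratio e : 0 < e -> \forall r \near +oo, 0 < J0 r /\ J1 r <= e * J0 r.
Proof.
move=> e0; have [A [A0 HA]] := regular_variation_small (divr_gt0 e0 (ltr0Sn R 1)).
(* The solution of [B / (r D)^n (r^n M)^2 / 2 = (2 C A^n / e) (r^n M)]: half of the total mass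
   remains after removing a ball of radius [T], and the right-hand side makes the near part of
   [J1 r] at most [e / 2 * J0 r]. *)
pose B := 4 * C * A ^+ n * D ^+ n / (e * M).
have B0 : 0 < B by rewrite divr_gt0 ?mulr_gt0 ?exprn_gt0.
have [T [T0 HT]] := regular_variation_large B.
have n0 : (0 < n)%N.
  by rewrite -(ltr0n R) (le_lt_trans _ alphan)// mulr_ge0// ltW.
near=> r.
have r1 : 1 <= r by near: r; exact: nbhs_pinfty_ge.
have r0 : 0 < r by exact: lt_le_trans r1.
have Ar : A <= r * D by rewrite -ler_pdivrMr//; near: r; exact: nbhs_pinfty_ge.
have Tr : T <= r * D by rewrite -ler_pdivrMr//; near: r; exact: nbhs_pinfty_ge.
have Cr : 2 * (C * T ^+ n) <= r ^+ n * M.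
  rewrite -ler_pdivrMr//; apply: (@le_trans _ _ r); last by rewrite ler_eXnr.
  by near: r; apply: nbhs_pinfty_ge; exact: num_real.
have rD0 : 0 < r * D by rewrite mulr_gt0.
have rn0 : 0 < r ^+ n * M by rewrite mulr_gt0// exprn_gt0.
have J0ge : 2 * C * A ^+ n / e * (r ^+ n * M) <= J0 r.
  have /(lower r0 T0 Tr) : 0 <= B / (r * D) ^+ n by rewrite divr_ge0 ?exprn_ge0 ?ltW.
  have H t : T < t -> t <= r * D -> B / (r * D) ^+ n <= f t ^+ k.
    move=> Tt trD; have t0 := lt_trans T0 Tt.
    rewrite ler_pdivrMr ?exprn_gt0// (le_trans (HT t Tt))// mulrC.
    rewrite ler_wpM2l//.
      rewrite exprn_ge0// mulr_ge0 ?powR_ge0//.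
      by case: Lsv => _ Lpos _; exact/ltW/Lpos.
    by rewrite lerXn2r// nnegrE ltW.
  move=> /(_ H); apply: le_trans.
  apply: (@le_trans _ _ (B / (r * D) ^+ n * (r ^+ n * M * (r ^+ n * M / 2)))); last first.
    apply: ler_wpM2l; first by rewrite divr_ge0 ?exprn_ge0 ?ltW.
    by apply: ler_wpM2l; [exact: ltW|lra].
  rewrite exprMn /B le_eqVlt; apply/orP; left; apply/eqP; field.
  by rewrite !expf_neq0 ?gt_eqF.
have J0gt : 0 < J0 r.
  by apply: lt_le_trans J0ge; rewrite mulr_gt0// divr_gt0// !mulr_gt0// exprn_gt0.
split => //.
have := upper r0 A0 Ar (ltW (divr_gt0 e0 (ltr0Sn R 1))) (fun t At _ => HA t At).
move=> /le_trans; apply.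
have : C * A ^+ n * (r ^+ n * M) <= e / 2 * J0 r.
  rewrite -ler_pdivrMl ?divr_gt0//; apply: le_trans J0ge.
  by rewrite le_eqVlt; apply/orP; left; apply/eqP; field; rewrite gt_eqF.
by lra.
Unshelve. all: by end_near. Qed.

End energy_asymptotics.

(** * Normalizations *)

Section normalization.
Context d (Omega : measurableType d) (R : realType) (P : probability Omega R).
Variables K L : R -> Omega -> R.
Hypothesis KL : \forall r \near +oo, [/\ sqint P (K r), sqint P (L r),
  \int[P]_w K r w = 0, \int[P]_w L r w = 0 & 0 < \int[P]_w (L r w ^+ 2)].
Hypothesis close : forall e, 0 < e -> \forall r \near +oo,
  \int[P]_w ((K r w - L r w) ^+ 2) <= e * \int[P]_w (L r w ^+ 2).

Let sqr_scale (X : Omega -> R) a : sqint P X ->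
  \int[P]_w ((a * X w) ^+ 2) = a ^+ 2 * \int[P]_w (X w ^+ 2).
Proof.
move=> sX; rewrite -RintegralZl//; last exact: sqint_sqr.
by apply: eq_Rintegral => w _; rewrite exprMn.
Qed.

Let normalizedE X Y r : \int[P]_w Y r w = 0 ->
  normalized_by P X Y r = (fun w => (normL2 P (Y r))^-1 * X r w) :> (Omega -> R).
Proof. by move=> Y0; apply/funext => w; rewrite /normalized_by variance_centered// mulrC. Qed.

(** Both variables share the denominator, so their mean-square distance is exactly the ratio
    controlled by [close]. *)
Lemma limit_distribution_numerator mu :
  limit_distribution P (normalized_by P L L) mu <->
  limit_distribution P (normalized_by P K L) mu.
Proof.
apply: (limit_distribution_close (M := 1)).
  move: KL; apply: filterS => r [sK sL K0 L0 L2]; rewrite !normalizedE//.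
  split; [exact: sqintZ|exact: sqintZ|].
  by rewrite sqr_scale// exprVn sqr_normL2 mulVf ?gt_eqF.
apply/cvgrPdist_le => e e0; move: KL (close e0); apply: filterS2 => r [sK sL K0 L0 L2] KLe.
rewrite !normalizedE// sub0r normrN ger0_norm ?sqrL2_ge0//.
under eq_Rintegral do rewrite -mulrBr.
rewrite sqr_scale; last exact: sqintB.
rewrite exprVn sqr_normL2 ler_pdivrMl//.
under eq_Rintegral do rewrite -opprB sqrrN.
by rewrite mulrC.
Qed.

(** With [a] and [b] the norms of [K r] and [L r], the distance is [|b - a| / b] when [a] is
    nonzero; the reverse triangle inequality bounds it by the norm of [K r - L r] over [b]. *)
Lemma limit_distribution_denominator mu :
  limit_distribution P (normalized_by P K K) mu <->
  limit_distribution P (normalized_by P K L) mu.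
Proof.
apply: (limit_distribution_close (M := 1)).
  move: KL; apply: filterS => r [sK sL K0 L0 L2]; rewrite !normalizedE//.
  split; [exact: sqintZ|exact: sqintZ|].
  rewrite sqr_scale// exprVn sqr_normL2.
  (* The norm of [K r] may vanish for some [r]; the inverse of 0 being 0, the normalized variable
     then has second moment 0. *)
  have [->|K2] := eqVneq (\int[P]_w (K r w ^+ 2)) 0; first by rewrite mulr0.
  by rewrite mulVf.
apply/cvgrPdist_le => e e0; move: KL (close e0); apply: filterS2 => r [sK sL K0 L0 L2] KLe.
rewrite !normalizedE// sub0r normrN ger0_norm ?sqrL2_ge0//.
under eq_Rintegral do rewrite -mulrBl.
rewrite sqr_scale//.
set a := normL2 P (K r); set b := normL2 P (L r); set D := normL2 P (fun w => K r w - L r w).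
have b0 : 0 < b by rewrite sqrtr_gt0.
have a0 : 0 <= a by exact: normL2_ge0.
have D2 : D ^+ 2 <= e * b ^+ 2 by rewrite !sqr_normL2.
have ab : `|b - a| <= D.
  have sKL := sqintB sK sL.
  have h1 : a <= D + b.
    apply: le_trans (normL2_triangle sKL sL); rewrite le_eqVlt; apply/orP; left; apply/eqP.
    by congr (normL2 P _); apply/funext => w; rewrite subrK.
  have h2 : b <= D + a.
    have := normL2_triangle (sqintZ (-1) sKL) sK.
    have -> : normL2 P (fun w => -1 * (K r w - L r w)) = D.
      by rewrite /D /normL2 sqr_scale// sqrrN expr1n mul1r.
    apply: le_trans; rewrite le_eqVlt; apply/orP; left; apply/eqP.
    by congr (normL2 P _); apply/funext => w; lra.
  by rewrite ler_norml; lra.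
rewrite -sqr_normL2 -/a -exprMn.
have [->|a1] := eqVneq a 0; first by rewrite mulr0 expr0n ltW.
have -> : (a^-1 - b^-1) * a = (b - a) / b by field; rewrite a1 gt_eqF.
rewrite expr_div_n ler_pdivrMr ?exprn_gt0//; apply: le_trans D2.
rewrite -(@real_normK _ (b - a)) ?num_real//.
by apply: lerXn2r => //; rewrite nnegrE// (le_trans _ ab).
Qed.

End normalization.

(** * Surface functionals *)

Section surface_functionals.
Context {R : realType} {d : nat} {disp : measure_display} {Omega : measurableType disp}.
Variables (P : probability Omega R) (eta : 'rV[R]_d -> Omega -> R).
Hypothesis eta_measurable : measurable_field eta.
Hypothesis eta_pair : forall x y, gaussian_pair P (eta x) (eta y) (field_cov P eta (x, y)).
Hypothesis eta_cov01 : forall p, 0 <= field_cov P eta p <= 1.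
Local Notation sigma := (@hausdorff_measure R d d.-1).
Local Notation gam := (@normal_prob R 0 1).

(** The integral [J_k] of the overview, encoded as a second moment so that, unlike [kernel_energy],
    it does not depend on proofs that [S] is measurable and of finite measure; [hermite_energyE]
    identifies the two. *)
Definition hermite_energy (S : set 'rV[R]_d) k : R :=
  \int[P]_w (surface_functional S (fun u => (hermite k).[u]) eta w ^+ 2) / k`!%:R.

Variable S : set (borelV R d).
Hypothesis mS : measurable S.
Hypothesis fS : (sigma S < +oo)%E.
Local Notation m := (mfrestr mS fS).

Let sqint_hermite k : sqint gam (fun x => (hermite k).[x]).
Proof. exact/exp_dominated_sqint/exp_dominated_horner. Qed.

Lemma surface_functionalE F : measurable_fun setT F ->
  surface_functional S F eta = (fun w => \int[m]_x F (eta x w)).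
Proof.
move=> mF; apply/funext => w; rewrite [RHS]Rintegral_mfrestr//.
exact: (measurableT_comp mF (measurable_fun_pair1 w eta_measurable)).
Qed.

Lemma sqint_surface_functional F : sqint gam F -> sqint P (surface_functional S F eta).
Proof.
move=> sF; rewrite surface_functionalE; last exact: sF.1.
exact: (integrated_sqint m (T := borelV R d) (Z := eta) eta_measurable eta_pair).
Qed.

Lemma surface_functional_mean F : sqint gam F -> \int[gam]_x F x = 0 ->
  \int[P]_w surface_functional S F eta w = 0.
Proof.
move=> sF F0; rewrite surface_functionalE; last exact: sF.1.
exact: (integrated_mean m (T := borelV R d) (Z := eta) eta_measurable eta_pair).
Qed.

Let kernel k := kernel_energy mS fS (fun p : borelV R d * borelV R d => field_cov P eta p) k.

Let mc := measurable_gaussian_cov (T := borelV R d) (Z := eta) eta_measurable eta_pair.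
Let hermite_energyE k : hermite_energy S k = kernel k.
Proof.
rewrite /hermite_energy surface_functionalE; last exact: (sqint_hermite k).1.
rewrite (integrated_hermite_sqr m (T := borelV R d) (Z := eta) eta_measurable eta_pair eta_cov01).
by rewrite mulrC mulKf// pnatr_eq0 -lt0n fact_gt0.
Qed.

Lemma surface_functional_sub_sqr_le F a k : sqint gam F ->
  (forall j, (j <= k)%N ->
    \int[gam]_x ((F x - a * (hermite k).[x]) * (hermite j).[x]) = 0) ->
  \int[P]_w ((surface_functional S F eta w -
    a * surface_functional S (fun u => (hermite k).[u]) eta w) ^+ 2) <=
  \int[gam]_x ((F x - a * (hermite k).[x]) ^+ 2) * hermite_energy S k.+1.
Proof.
move=> sF orth; rewrite hermite_energyE !surface_functionalE; [|exact: (sqint_hermite k).1|exact: sF.1].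
rewrite (integrated_sub_sqr m (T := borelV R d) (Z := eta)
  eta_measurable eta_pair a sF (sqint_hermite k)).
have sG := sqintB sF (sqintZ a (sqint_hermite k)).
exact: (integrated_sqr_le m (T := borelV R d) (Z := eta) eta_measurable eta_pair eta_cov01 sG orth).
Qed.

Section energy_bounds.
Variables (A b q : R).
Hypothesis q0 : 0 <= q.
Hypothesis ball_le : forall x, S x -> (sigma (S `&` eball x A) <= b%:E)%E.

Let ball_fine x : S x -> fine (sigma (S `&` eball x A)) <= b.
Proof.
move=> /ball_le h; have m0 : (0 <= sigma (S `&` eball x A))%E by exact: measure_ge0.
by rewrite -lee_fin fineK// ge0_fin_numE// (le_lt_trans h)// ltry.
Qed.

Let mball x : measurable (eball x A : set (borelV R d)).
Proof. by apply: closed_measurable_borelV; exact: closed_eball. Qed.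

Lemma hermite_energyS_le k :
  (forall x y, S x -> S y -> A < enorm (x - y) -> field_cov P eta (x, y) <= q) ->
  hermite_energy S k.+1 <= b * fine (sigma S) + q * hermite_energy S k.
Proof.
move=> H; rewrite !hermite_energyE.
apply: (kernel_energyS_le mS fS mc eta_cov01 mball ball_fine k q0) => x y Sx Sy /negP.
by rewrite -ltNge -enormN opprB; exact: H.
Qed.

Lemma hermite_energy_ge k :
  (forall x y, S x -> S y -> A < enorm (x - y) -> q <= field_cov P eta (x, y) ^+ k) ->
  q * (fine (sigma S) * (fine (sigma S) - b)) <= hermite_energy S k.
Proof.
move=> H; rewrite !hermite_energyE.
apply: (kernel_energy_ge mS fS mc eta_cov01 mball ball_fine q0) => x y Sx Sy /negP.
by rewrite -ltNge -enormN opprB; exact: H.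
Qed.

End energy_bounds.

End surface_functionals.

(** * Reduction to the leading Hermite term on the dilated surfaces *)

Lemma hermite_remainder_orthogonal d (T : measurableType d) (R : realType)
    (P : probability T R) (X Y : T -> R) rho (G : R -> R) k :
  gaussian_pair P X Y rho -> sqint (@normal_prob R 0 1) G ->
  (forall j, (j < k)%N -> hermite_coef G j = 0) -> forall j, (j <= k)%N ->
  \int[@normal_prob R 0 1]_x
    ((G x - hermite_coef G k / k`!%:R * (hermite k).[x]) * (hermite j).[x]) = 0.
Proof.
move=> XY sG Gk j jk; set a := _ / _.
have sH i : sqint (@normal_prob R 0 1) (fun x => (hermite i).[x]).
  exact/exp_dominated_sqint/exp_dominated_horner.
under eq_Rintegral do rewrite -mulNr.
rewrite (dotL2_Dl sG (sqintZ (- a) (sH k)) (sH j)) (dotL2_Zl (- a) (sH k) (sH j)).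
rewrite -hermite_coefE; last exact: sG.1.
rewrite (hermite_orthogonal k j XY).
(* At order [k] the subtracted multiple removes the coefficient, since [hermite k] has squared norm
   [k!]; below [k] the rank condition applies. *)
have [<-|kj] := eqVneq k j.
  by rewrite /a mulNr divfK ?subrr// pnatr_eq0 -lt0n fact_gt0.
by rewrite mulr0 addr0 Gk// ltn_neqAle eq_sym kj.
Qed.

Theorem theorem1 (R : realType) (d : nat) (d_ge2 : (2 <= d)%N)
    (Delta : set 'rV[R]_d)
    (Delta_bounded : bounded_set Delta)
    (Delta_hypersurface : closed_hypersurface (boundary Delta))
    (Delta_regular : ahlfors_david_regular (boundary Delta))
    (Delta_decay : fourier_decay (boundary Delta))
    (kappa : nat) (G : R -> R)
    (G_L2 : gaussian_L2 G) (G_rank : hermite_rank G kappa)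
    (disp : measure_display) (Omega : measurableType disp)
    (P : probability Omega R)
    (eta : 'rV[R]_d -> Omega -> R)
    (eta_measurable : measurable_field eta)
    (eta_continuous : ms_continuous P eta)
    (eta_gaussian : gaussian_field P eta)
    (eta_homogeneous : homogeneous_field P eta)
    (eta_isotropic : isotropic_field P eta)
    (eta_centered : forall x, 'E_P[eta x]%E = 0%E)
    (alpha : R) (L0 : R -> R)
    (L0_slowly_varying : slowly_varying L0)
    (alpha_gt0 : 0 < alpha) (alpha_lt : alpha < d.-1%:R / kappa%:R)
    (cov0 : covariance_function P eta 0 = 1%E)
    (cov : forall x, x != 0 -> covariance_function P eta x =
      (enorm x `^ (- alpha) * L0 (enorm x))%:E) :
  let K := Kr Delta G eta in
  let Kk := Kr_rank Delta G kappa eta in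
  let X1 := normalized_by P K K in
  let X2 := normalized_by P K Kk in
  let X3 := normalized_by P Kk Kk in
  forall mu : probability R R,
    [\/ limit_distribution P X1 mu, limit_distribution P X2 mu
      | limit_distribution P X3 mu] ->
    [/\ limit_distribution P X1 mu, limit_distribution P X2 mu
      & limit_distribution P X3 mu].
Proof.
move=> K Kk X1 X2 X3.
pose f t := t `^ (- alpha) * L0 t.
have f_gt0 t : 0 < t -> 0 < f t.
  by move=> t0; rewrite mulr_gt0 ?powR_gt0//; case: L0_slowly_varying => _ + _; exact.
have pair x y := field_gaussian_pair eta_measurable eta_gaussian eta_centered
  eta_homogeneous cov0 x y.
have c01 := field_cov01 eta_measurable eta_gaussian eta_centered eta_homogeneous cov0 f_gt0 cov.
have cE x y : 0 < enorm (x - y) -> field_cov P eta (x, y) = f (enorm (x - y)).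
  move=> xy; apply: (field_cov_neq eta_measurable eta_gaussian eta_centered eta_homogeneous cov).
  by move: xy; rewrite lt_neqAle eq_sym enorm_eq0 subr_eq0 => /andP[].
have [kappa0 Gj Gk] := G_rank.
have sG := gaussian_L2_sqint G_L2.
have sH k : sqint (@normal_prob R 0 1) (fun x => (hermite k).[x]).
  exact/exp_dominated_sqint/exp_dominated_horner.
have [S_compact S_gt0 _] := Delta_hypersurface.
have [D [C [M [D0 C0 M0 surf]]]] := regular_dilated_bounds d_ge2 S_compact S_gt0 Delta_regular.
have bdE r : 0 < r -> boundary (dilate r Delta) = dilate r (boundary Delta).
  by move=> r0; rewrite boundary_dilate ?gt_eqF.
have mS r : 0 < r -> measurable (boundary (dilate r Delta) : set (borelV R d)).
  by move=> r0; rewrite bdE//; apply: closed_measurable_borelV; have [] := surf r r0.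
have SE r : 0 < r -> @hausdorff_measure R d d.-1 (boundary (dilate r Delta)) = (r ^+ d.-1 * M)%:E.
  by move=> r0; rewrite bdE//; have [] := surf r r0.
have fS r : 0 < r -> (@hausdorff_measure R d d.-1 (boundary (dilate r Delta)) < +oo)%E.
  by move=> r0; rewrite SE// ltry.
pose J k r := hermite_energy P eta (boundary (dilate r Delta)) k.
have ball_le r A x : 0 < r -> 0 < A -> A <= r * D -> boundary (dilate r Delta) x ->
    (@hausdorff_measure R d d.-1 (boundary (dilate r Delta) `&` eball x A) <= (C * A ^+ d.-1)%:E)%E.
  by move=> r0 A0 Ar; rewrite bdE// => Sx; have [_ _ _] := surf r r0; exact.
have dist r x y : 0 < r -> boundary (dilate r Delta) x -> boundary (dilate r Delta) y ->
    enorm (x - y) <= r * D.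
  by move=> r0; rewrite bdE// => Sx Sy; have [_ _ + _] := surf r r0; exact.
have alphan : alpha * kappa%:R < d.-1%:R by rewrite -ltr_pdivlMr// ltr0n.
(* The dimension exponent is [n = d.-1]. The two arguments left open are the bounds [upper] and
   [lower], supplied by the estimates on [hermite_energy]. *)
have ratio := @energy_ratio R d.-1 kappa alpha L0 kappa0 alpha_gt0 alphan L0_slowly_varying
  D C M (J kappa) (J kappa.+1) D0 C0 M0 _ _.
have {}ratio e : 0 < e -> \forall r \near +oo, 0 < J kappa r /\ J kappa.+1 r <= e * J kappa r.
  apply: ratio => r A q r0 A0 Ar q0 H.
    have := hermite_energyS_le eta_measurable pair c01 (mS r r0) (fS r r0) q0
      (fun x => ball_le r A x r0 A0 Ar) kappa.
    rewrite SE//=; apply=> x y Sx Sy xy.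
    by rewrite cE ?H ?dist// (lt_trans A0).
  have H' x y : boundary (dilate r Delta) x -> boundary (dilate r Delta) y ->
      A < enorm (x - y) -> q <= field_cov P eta (x, y) ^+ kappa.
    by move=> Sx Sy xy; rewrite cE ?H ?dist// (lt_trans A0).
  have := hermite_energy_ge eta_measurable pair c01 (mS r r0) (fS r r0) q0
      (fun x => ball_le r A x r0 A0 Ar) H'.
  by rewrite SE.
set a := hermite_coef G kappa / kappa`!%:R.
have a0 : a != 0 by rewrite mulf_neq0// invr_eq0 pnatr_eq0 -lt0n fact_gt0.
have Kk2 r : 0 < r -> \int[P]_w (Kk r w ^+ 2) = a ^+ 2 * kappa`!%:R * J kappa r.
  move=> r0; rewrite /J /hermite_energy -mulrA [_ * (_ / _)]mulrC divfK; last first.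
    by rewrite pnatr_eq0 -lt0n fact_gt0.
  rewrite -RintegralZl//; last first.
    exact: (sqint_sqr (sqint_surface_functional eta_measurable pair (mS r r0) (fS r r0) (sH kappa))).
  by apply: eq_Rintegral => w _; rewrite -exprMn.
have mean0 r F : 0 < r -> sqint (@normal_prob R 0 1) F -> hermite_coef F 0 = 0 ->
    \int[P]_w surface_functional (boundary (dilate r Delta)) F eta w = 0.
  move=> r0 sF F0; apply: (surface_functional_mean eta_measurable pair (mS r r0) (fS r r0) sF).
  (* As [hermite 0] is 1, the coefficient of order 0 is the Gaussian mean. *)
  rewrite -[RHS]F0 hermite_coefE; last exact: sF.1.
  by apply: eq_Rintegral => x _; rewrite hornerC mulr1.
have H0 : hermite_coef (fun x : R => (hermite kappa).[x]) 0 = 0.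
  rewrite hermite_coefE; last exact: (sH kappa).1.
  by rewrite (hermite_orthogonal kappa 0 (pair 0 0)) gtn_eqF.
have KL : \forall r \near +oo, [/\ sqint P (K r), sqint P (Kk r),
    \int[P]_w K r w = 0, \int[P]_w Kk r w = 0 & 0 < \int[P]_w (Kk r w ^+ 2)].
  near=> r; have r0 : 0 < r by near: r; exact: nbhs_pinfty_gt.
  have sKk := sqint_surface_functional eta_measurable pair (mS r r0) (fS r r0) (sH kappa).
  split.
  - exact: (sqint_surface_functional eta_measurable pair (mS r r0) (fS r r0) sG).
  - exact: sqintZ.
  - exact: (mean0 _ _ r0 sG (Gj 0 kappa0)).
  - by rewrite RintegralZl ?(mean0 _ _ r0 (sH kappa) H0) ?mulr0//; exact: sqint_integrable.
  - rewrite Kk2//; apply: mulr_gt0; first by rewrite mulr_gt0 ?exprn_even_gt0//= ltr0n fact_gt0.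
    by near: r; have := ratio 1 ltr01; apply: filterS => s [].
pose V := \int[@normal_prob R 0 1]_x ((G x - a * (hermite kappa).[x]) ^+ 2).
have V0 : 0 <= V by exact: sqrL2_ge0.
have V1 : 0 < V + 1 by lra.
have close e : 0 < e -> \forall r \near +oo,
    \int[P]_w ((K r w - Kk r w) ^+ 2) <= e * \int[P]_w (Kk r w ^+ 2).
  (* [e'] absorbs the constants relating [J kappa] to the variance of [Kk r]. Dividing by [V + 1]
     rather than [V] covers [V = 0], when [G] is almost everywhere its leading Hermite term. *)
  move=> e0; pose e' := e * (a ^+ 2 * kappa`!%:R) / (V + 1).
  have b0 : 0 < a ^+ 2 * kappa`!%:R.
    by rewrite mulr_gt0 ?exprn_even_gt0//= ltr0n fact_gt0.
  have e'0 : 0 < e' by rewrite divr_gt0// mulr_gt0.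
  near=> r; have r0 : 0 < r by near: r; exact: nbhs_pinfty_gt.
  have [J0 J1] : 0 < J kappa r /\ J kappa.+1 r <= e' * J kappa r.
    by near: r; exact: ratio.
  rewrite Kk2//.
  have := surface_functional_sub_sqr_le eta_measurable pair c01 (mS r r0) (fS r r0) sG
    (hermite_remainder_orthogonal (pair 0 0) sG Gj).
  move=> /le_trans; apply; rewrite -/a -/V -/(J _ _).
  apply: (@le_trans _ _ (V * (e' * J kappa r))); first exact: ler_wpM2l.
  have -> : V * (e' * J kappa r) = V / (V + 1) * (e * (a ^+ 2 * kappa`!%:R * J kappa r)).
    by rewrite /e'; field; rewrite gt_eqF.
  apply: ler_piMl; first exact/ltW/mulr_gt0/mulr_gt0.
  by rewrite ler_pdivrMr// mul1r lerDl.
move=> mu.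
have h3 := limit_distribution_numerator KL close mu.
have h1 := limit_distribution_denominator KL close mu.
(* [X2] shares its numerator with [X1] and its denominator with [X3], hence mediates between
   them. *)
have all2 : limit_distribution P X2 mu ->
    [/\ limit_distribution P X1 mu, limit_distribution P X2 mu & limit_distribution P X3 mu].
  by move=> h; split => //; [exact/h1|exact/h3].
by move=> [/h1/all2|/all2|/h3/all2].
Unshelve. all: by end_near. Qed.
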